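(* Let $\mu>0$, $\alpha>0$, $v_0>0$, $\sigma\in\mathbb{R}$, $\beta\in(0,1)$ and $\gamma=\beta-\alpha\in[0,1)$. Let $K:(0,\infty)^4\to[0,\infty)$ be continuous and satisfy, for all $(a,v,a',v')\in(0,\infty)^4$ and $\lambda>0$, $$K(\lambda^{2/3}a,\lambda v,\lambda^{2/3}a',\lambda v')=\lambda^{\gamma}K(a,v,a',v'),\qquad K(a,v,a',v')=K(a',v',a,v),$$ $$K_1(v^{-\alpha}v'^{\beta}+v'^{-\alpha}v^{\beta})\le K(a,v,a',v')\le K_0(v^{-\alpha}v'^{\beta}+v'^{-\alpha}v^{\beta})$$ for some constants $K_0,K_1>0$. Let $r\in C^1((0,\infty)^2)$ satisfy, for some constants $R_0,R_1>0$ and all $(a,v)\in(0,\infty)^2$, $\lambda>0$, $$R_0a^{\mu}v^{\sigma}\le r(a,v)\le R_1a^{\mu}v^{\sigma},\qquad r(\lambda^{2/3}a,\lambda v)=\lambda^{\gamma-1}r(a,v),\qquad \tfrac23\mu+\sigma=\gamma-1,$$ and, for some constant $B>0$ and all $(a,v)\in(0,\infty)^2$ with $a\ge c_0v^{2/3}$, $$[\partial_ar(a,v)-\mu a^{-1}r(a,v)](a-c_0v^{2/3})+r(a,v)\ge0,\qquad \partial_ar(a,v)\le Ba^{-1}r(a,v).$$ Then there exists a self-similar profile $g$ for the two-dimensional coagulation equation (in the sense for $\alpha>0$ recalled in the context) with $\int_{(0,\infty)^2}v\,g(a,v)\,dv\,da=v_0$. In addition, $M_{n,k}(g)<\infty$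 for all $n,k\in\mathbb{R}$.
   Context: Notation: $c_0:=(36\pi)^{1/3}$, $\eta=(a,v)\in(0,\infty)^2$. Measures are written as if they had densities: $g(a,v)\,dv\,da=g(\eta)\,d\eta$. $\mathscr{M}_+((0,\infty)^2)$ is the set of non-negative Radon measures on $(0,\infty)^2$ and $\mathscr{M}_+^I((0,\infty)^2)$ is the subset of those $h$ with $h(\{a<c_0v^{2/3}\})=0$. For $k,l\in\mathbb{R}$, $M_{k,l}(g):=\int_{(0,\infty)^2}a^kv^lg(a,v)\,dv\,da$. For a test function $\varphi$, $$\langle\mathbb{K}[g],\varphi\rangle:=\tfrac12\int_{(0,\infty)^2}\int_{(0,\infty)^2}K(a,v,a',v')\,[\varphi(a+a',v+v')-\varphi(a,v)-\varphi(a',v')]\,g(a',v')g(a,v)\,dv'da'dv\,da.$$ Definition (case $\alpha>0$). A measure $g\in\mathscr{M}_+^I((0,\infty)^2)$ is a self-similar profile for the two-dimensional coagulation equation if $\int_{(0,\infty)^2}(v^{-\alpha}+v^{\beta})g(a,v)\,dv\,da<\infty$ and for every $\varphi\in C_c^1((0,\infty)^2)$ $$\int g(\eta)\varphi(\eta)d\eta-\tfrac23\int g(\eta)a\,\partial_a\varphi(\eta)d\eta-\int g(\eta)v\,\partial_v\varphi(\eta)d\eta+(1-\gamma)\langle\mathbb{K}[g],\varphi\rangle+(1-\gamma)\int r(\eta)(c_0v^{2/3}-a)g(\eta)\partial_a\varphi(\eta)d\eta=0,$$ all integrals being over $(0,\infty)^2$. *)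

(* Defs.v *)
From HB Require Import structures.
From mathcomp Require Import all_boot all_order all_algebra.
From mathcomp Require Import all_classical all_reals all_analysis.

Set Implicit Arguments.
Unset Strict Implicit.
Unset Printing Implicit Defensive.

Import Order.TTheory GRing.Theory Num.Theory.
Import numFieldNormedType.Exports.

#[global] Open Scope classical_set_scope.
#[global] Open Scope ring_scope.

(* Points eta = (a, v) of the open quadrant are pairs x : R * R with x.1 = a
   and x.2 = v.  Functions on the quadrant are total functions on R * R whose
   values outside the quadrant are irrelevant. *)
Definition quadrant (R : realType) : set (R * R) :=
  [set x | 0 < x.1 /\ 0 < x.2].

Definition c0 (R : realType) : R := (36 * pi) `^ (3^-1).

Definition partial_a (R : realType) (f : R * R -> R) : R * R -> R :=
  'D_((1, 0) : R * R) f.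

Definition partial_v (R : realType) (f : R * R -> R) : R * R -> R :=
  'D_((0, 1) : R * R) f.

Definition C1_quadrant (R : realType) (f : R * R -> R) : Prop :=
  forall x, quadrant x ->
    [/\ derivable f x ((1, 0) : R * R), derivable f x ((0, 1) : R * R),
        {for x, continuous (partial_a f)} &
        {for x, continuous (partial_v f)}].

(* C_c^1((0,oo)^2), a function being identified with its extension by zero. *)
Definition C1c_quadrant (R : realType) (f : R * R -> R) : Prop :=
  [/\ C1_quadrant f,
      compact (closure [set x | f x != 0]) &
      closure [set x | f x != 0] `<=` @quadrant R].

(* A Radon measure on the quadrant is encoded as a Borel measure on R * R
   (the product sigma-algebra is the Borel one) that is carried by the quadrant
   and finite on its compact subsets; regularity is automatic, the quadrant
   being an open subset of the plane. *)
Definition radon_quadrant (R : realType)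
    (g : {measure set (R * R)%type -> \bar R}) : Prop :=
  g (~` @quadrant R) = 0%E /\
  forall C : set (R * R), compact C -> C `<=` @quadrant R -> (g C < +oo)%E.

Definition radon_quadrant_I (R : realType)
    (g : {measure set (R * R)%type -> \bar R}) : Prop :=
  radon_quadrant g /\
  g [set x | quadrant x /\ x.1 < c0 R * x.2 `^ (2 / 3)] = 0%E.

Definition moment (R : realType) (g : {measure set (R * R)%type -> \bar R})
    (k l : R) : \bar R :=
  (\int[g]_(x in @quadrant R) (x.1 `^ k * x.2 `^ l)%:E)%E.

Definition coag_form (R : realType) (K : (R * R) * (R * R) -> R)
    (g : {measure set (R * R)%type -> \bar R}) (phi : R * R -> R) : R :=
  2^-1 * \int[g]_(x in @quadrant R) \int[g]_(y in @quadrant R)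
           (K (x, y) * (phi (x + y) - phi x - phi y)).

(* Under the moment bound, and for kernels dominated by
   v^-alpha v'^beta + v'^-alpha v^beta, all the real-valued integrals below
   converge absolutely. *)
Definition self_similar_profile (R : realType) (alpha beta gamma : R)
    (K : (R * R) * (R * R) -> R) (r : R * R -> R)
    (g : {measure set (R * R)%type -> \bar R}) : Prop :=
  [/\ radon_quadrant_I g,
      (\int[g]_(x in @quadrant R)
          (x.2 `^ (- alpha) + x.2 `^ beta)%:E < +oo)%E &
      forall phi : R * R -> R, C1c_quadrant phi ->
        \int[g]_(x in @quadrant R) phi x
        - 2 / 3 * \int[g]_(x in @quadrant R) (x.1 * partial_a phi x)
        - \int[g]_(x in @quadrant R) (x.2 * partial_v phi x)
        + (1 - gamma) * coag_form K g phi
        + (1 - gamma) * \int[g]_(x in @quadrant R)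
            (r x * (c0 R * x.2 `^ (2 / 3) - x.1) * partial_a phi x) = 0].

(* Main.v *)
(* The profile is a limit of finite systems. On a logarithmic grid of volumes v and
   a grid of aspects a / v^(2/3), the self-similar rescaling, the fusion and the
   coalescence (with v + v' rounded down) become jumps between finitely many
   states; stationary weights of total volume v0 are a zero of a quadratic vector
   field tangent to a simplex, which exists by a Sperner-type lemma.

   Testing stationarity with powers of v and a gives moment bounds that are uniform
   in the mesh. Low and negative powers of v are controlled by coalescence, which
   decreases v^(l - 1) for l < 1, and by the lower bound v^-alpha v'^beta on the
   kernel; high powers of v are controlled by the rescaling; powers of a are
   controlled by the fusion, whose strength a^mu v^sigma absorbs the coalescence
   term, the negative ones being reduced to powers of v by a >= c0 v^(2/3).

   The weights converge vaguely along an ultrafilter, and the moment bounds allow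
   the passage to the limit in the stationarity equation, once its coalescence term
   has been symmetrised. *)

(* The unknown of the finite system is the distribution of volume, [wt s * vol s / v0], not that of
   particles. Seen on it, coalescence is asymmetric: a unit of volume sitting in a particle of
   volume v jumps to the state chosen for v + v', at a rate proportional to the density of partners.
   All three mechanisms are then jumps, so rounding and the ends of the grid lose no volume: the
   total is exactly v0 at every mesh, and the simplex excludes the zero solution. Rounding survives
   only as the factor (v + v') / [vol (coalesce s s')], which tends to 1. The danger is that volume
   escapes to 0 or to infinity in the limit, so the bounds must not depend on the mesh. They start
   from the power 1 - alpha of v, which a quadratic inequality bounds by the mass alone. Integer
   powers follow; they force a fixed amount of volume to lie in particles that are not small; small
   particles must merge with those, and this gains a factor v^(-alpha) at each turn. Once all
   moments are bounded, multiplying an integrand by a, 1/a, v or 1/v keeps it bounded, and this is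
   the uniform integrability used in every limit. *)
Require Import Defs.
From HB Require Import structures.
From mathcomp Require Import all_boot all_order all_algebra.
From mathcomp Require Import ring lra zify.

Set Implicit Arguments.
Unset Strict Implicit.
Unset Printing Implicit Defensive.

(** * A Sperner-type lemma *)

Section Sperner.
Local Open Scope nat_scope.
Variables (T I : finType) (f : I -> T + I -> nat).
Hypothesis f_inj : forall i, injective (f i).
Hypothesis f_min : forall i y, f i (inr i) <= f i y.
Hypothesis f_big : forall i k x, k != i -> f i (inl x) < f i (inr k).

(* The points [inr i] are slack elements that play the part of the vertices of
   a simplex; dominant sets play the part of the faces of a triangulation. *)
Definition dominant (r : {set T + I}) :=
  [forall x, exists i, [forall y in r, f i x <= f i y]].

Lemma dominantP (r : {set T + I}) :
  reflect (forall x, exists i, forall y, y \in r -> f i x <= f i y) (dominant r).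
Proof.
apply: (iffP forallP) => h x.
  by have /existsP[i /forall_inP hi] := h x; exists i.
by have [i hi] := h x; apply/existsP; exists i; apply/forall_inP.
Qed.

Lemma dominantS (d r : {set T + I}) : d \subset r -> dominant r -> dominant d.
Proof.
move=> /subsetP dr /dominantP h; apply/dominantP => x.
by have [i hi] := h x; exists i => y /dr; exact: hi.
Qed.

Definition min_at (x0 : T + I) (r : {set T + I}) (i : I) :=
  [arg min_(y < x0 in r) f i y].

Lemma min_atP x0 (r : {set T + I}) i : x0 \in r ->
  min_at x0 r i \in r /\ forall y, y \in r -> f i (min_at x0 r i) <= f i y.
Proof. by move=> x0r; rewrite /min_at; case: arg_minnP. Qed.

Lemma min_at_unique x0 (r : {set T + I}) i z : x0 \in r -> z \in r ->
  (forall y, y \in r -> f i z <= f i y) -> z = min_at x0 r i.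
Proof.
move=> x0r zr hz; have [mr hm] := min_atP i x0r.
by apply: (@f_inj i); apply/eqP; rewrite eqn_leq hz// hm.
Qed.

(** Dominance applied to an element of r makes it the minimum of some ranking; with as many elements
    as rankings, this correspondence is a bijection. *)
Lemma min_at_inj x0 (r : {set T + I}) : x0 \in r -> #|r| = #|I| -> dominant r ->
  injective (min_at x0 r) /\ (forall y, y \in r -> exists i, y = min_at x0 r i).
Proof.
move=> x0r cr /dominantP dr.
have surj y : y \in r -> exists i, y = min_at x0 r i.
  move=> yr; have [i hi] := dr y; exists i; exact: min_at_unique.
split => //.
have im : [set min_at x0 r i | i in I] = r.
  apply/setP => y; apply/imsetP/idP => [[i _ ->]|/surj[i ->]].
    by have [] := min_atP i x0r.
  by exists i.
have : {in I &, injective (min_at x0 r)}.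
  by apply/imset_injP; rewrite im cr.
by move=> h i j; apply: h.
Qed.

(** The count is 0 or 2. In a room [x |: d] every ranking has its own minimum, so on d exactly two
    rankings j and k share their minimum, and x is the minimum for one of them, say c. Then x is
    forced: it is the largest for c among the points above the minima of d for all other rankings. A
    genuine point of d keeps this set nonempty, because the slack [inr c] lies above it there. *)
Lemma even_rooms_of_door (d : {set T + I}) t :
  #|d|.+1 = #|I| -> inl t \in d ->
  ~~ odd #|[set x | (x \notin d) && dominant (x |: d)]|.
Proof.
move=> cd td; set A := [set x | _].
have [->|[x0]] := set_0Vmem A; first by rewrite cards0.
rewrite inE => /andP[x0d dom0].
have crd x : x \notin d -> #|x |: d| = #|I| by move=> xd; rewrite cardsU1 xd -cd.
pose md := min_at (inl t) d.
have mdP i := min_atP i td.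
have domd : dominant d by apply: dominantS dom0; exact: subsetUr.
have key x : x \notin d -> dominant (x |: d) -> exists c,
    [/\ forall i, i != c -> f i (md i) < f i x,
        forall y, y \in d -> exists2 i, i != c & y = md i &
        forall i k, i != c -> k != c -> md i = md k -> i = k].
  move=> xd domx; have xr : x \in x |: d by rewrite setU11.
  have [inj surj] := min_at_inj xr (crd _ xd) domx.
  have [c xc] := surj _ xr; exists c.
  have mE i : i != c -> md i = min_at x (x |: d) i.
    move=> ic; have [m1 m2] := min_atP i xr.
    apply/esym/min_at_unique => //; last first.
      by move=> y yd; apply: m2; rewrite !inE yd orbT.
    move: m1; rewrite !inE => /orP[/eqP m1|//].
    by move: ic; rewrite -(inj_eq inj) -xc m1 eqxx.
  split.
  - move=> i ic; rewrite mE//; have [m1 m2] := min_atP i xr.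
    rewrite ltn_neqAle m2// andbT; apply/eqP => /f_inj e.
    by move: ic; rewrite -(inj_eq inj) -xc e eqxx.
  - move=> y yd; have [|i yi] := surj y; first by rewrite !inE yd orbT.
    have ic : i != c.
      by apply: contraNneq xd => ic; rewrite xc -ic -yi.
    by exists i => //; rewrite mE.
  - by move=> i k ic kc; rewrite !mE// => /inj.
have [j [x0j surjj injj]] := key _ x0d dom0.
have [k kj mjk] := surjj _ (proj1 (mdP j)).
have jk : j != k by rewrite eq_sym.
have surjk y : y \in d -> exists2 i, i != k & y = md i.
  move=> /surjj[i ij ->]; have [->|ik] := eqVneq i k; last by exists i.
  by exists j.
pose Xc c := [set x | [forall (i | i != c), f i (md i) < f i x]].
have XcP c x : reflect (forall i, i != c -> f i (md i) < f i x) (x \in Xc c).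
  by rewrite inE; apply: forall_inP.
pose e c := [arg max_(x > inr c in Xc c) f c x].
have eP c : e c \in Xc c /\ forall x, x \in Xc c -> f c x <= f c (e c).
  rewrite /e; case: arg_maxnP => //=.
  apply/XcP => i ic; apply: leq_ltn_trans (f_big _ _).
    by have [_ /(_ _ td)] := mdP i; apply.
  by rewrite eq_sym.
(* Adding [e c] keeps dominance: a point of [Xc c] lies below [e c] and d in the ranking c, and any
   other point lies below the minimum of d for some ranking i != c. *)
have eA c : (forall y, y \in d -> exists2 i, i != c & y = md i) -> e c \in A.
  move=> sc; have [/XcP e1 e2] := eP c; rewrite inE; apply/andP; split.
    apply/negP => /sc[i ic eE]; by have := e1 _ ic; rewrite {1}eE ltnn.
  apply/dominantP => y.
  have [yX|/XcP yX] := boolP (y \in Xc c).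
    exists c => z; rewrite !inE => /orP[/eqP->|zd]; first exact: e2.
    have /dominantP/(_ y)[i hi] := domd.
    have [<-|ic] := eqVneq i c; first exact: hi.
    have /XcP/(_ _ ic) := yX.
    by rewrite ltnNge hi//; have [] := mdP i.
  have [i ic yi] : exists2 i, i != c & f i y <= f i (md i).
    apply/exists_inP; apply: contra_notT yX => /exists_inPn h i ic.
    by have := h _ ic; rewrite -ltnNge.
  exists i => z; rewrite !inE => /orP[/eqP->|zd].
    by apply: leq_trans yi _; apply: ltnW; exact: e1.
  by apply: leq_trans yi _; have [_] := mdP i; apply.
have AE : A = [set e j; e k].
  apply/setP => x; apply/idP/idP; last first.
    by rewrite in_set2 => /orP[]/eqP->; exact: eA.
  rewrite inE => /andP[xd domx]; have [c [xc surjc injc]] := key _ xd domx.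
  have cE : (c == j) || (c == k).
    apply: contraT; rewrite negb_or => /andP[cj ck].
    by move: jk; rewrite (injc j k) ?eqxx// eq_sym.
  suff -> : x = e c.
    by rewrite !inE; case/orP: cE => /eqP->; rewrite eqxx ?orbT.
  have [/XcP e1 e2] := eP c.
  apply: (@f_inj c); apply/eqP; rewrite eqn_leq e2/=; last exact/XcP.
  have /dominantP/(_ (e c))[i hi] := domx.
  have [ic|ic] := eqVneq i c; first by move: hi; rewrite ic => ->; rewrite ?setU11.
  have := e1 _ ic; rewrite ltnNge hi// !inE.
  by have [->] := mdP i; rewrite orbT.
rewrite AE cards2; suff -> : e j != e k by [].
(* Were the two points equal, that point would exceed the minimum of d in every ranking, against the
   dominance of d. *)
apply/eqP => ejk; have [/XcP ej _] := eP j; have [/XcP ek _] := eP k.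
have /dominantP/(_ (e j))[i hi] := domd.
have : f i (md i) < f i (e j).
  by have [->|/ej//] := eqVneq i j; rewrite ejk; apply: ek.
by rewrite ltnNge hi//; have [] := mdP i.
Qed.

Variables (lab : T -> I) (i0 : I) (t0 : T).

Definition slack_lab (x : T + I) := match x with inl t => lab t | inr i => i end.

(** If removing x leaves exactly the labels other than [i0], the label of x is repeated by a unique
    other element, and these two give the only doors. *)
Lemma even_doors_of_room (r : {set T + I}) : #|r| = #|I| ->
  slack_lab @: r != setT ->
  ~~ odd #|[set x in r | slack_lab @: (r :\ x) == ~: [set i0]]|.
Proof.
move=> cr nfull; set A := [set x in r | _].
have [->|[x]] := set_0Vmem A; first by rewrite cards0.
rewrite inE => /andP[xr /eqP xE].
have cI : #|~: [set i0]|.+1 = #|I| by rewrite -(cardsC [set i0]) cards1.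
have inj : {in r :\ x &, injective slack_lab}.
  by apply/imset_injP; rewrite xE -eqSS cI -cr (cardsD1 x r) xr.
have lx : slack_lab x != i0.
  apply: contraNneq nfull => lx; apply/eqP/setP => i; rewrite inE.
  have [->|ii0] := eqVneq i i0; first by rewrite -lx imset_f.
  have : i \in slack_lab @: (r :\ x) by rewrite xE !inE.
  by case/imsetP => z; rewrite inE => /andP[_ zr] ->; rewrite imset_f.
have /imsetP[x' x'r lxx'] : slack_lab x \in slack_lab @: (r :\ x).
  by rewrite xE !inE.
have /andP[x'x x'r'] : (x' != x) && (x' \in r) by move: x'r; rewrite !inE.
suff -> : A = [set x; x'] by rewrite cards2 eq_sym x'x.
apply/setP => z; rewrite inE !in_set2; apply/idP/idP.
  move=> /andP[zr /eqP zE]; apply: contraT; rewrite negb_or => /andP[zx zx'].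
  have zrx : z \in r :\ x by rewrite !inE zx.
  have : slack_lab z \in slack_lab @: (r :\ z) by rewrite zE -xE imset_f.
  case/imsetP => w; rewrite !inE => /andP[wz wr] e.
  have [wx|wx] := eqVneq w x.
    by move: zx'; rewrite (inj z x') ?eqxx// e wx.
  by move: wz; rewrite (inj w z) ?eqxx ?e// !inE wx.
case/orP => /eqP->; first by rewrite xr xE eqxx.
rewrite x'r' -xE; apply/eqP/setP => i; apply/imsetP/imsetP => -[u].
  rewrite !inE => /andP[ux' ur] ->; have [->|ux] := eqVneq u x; first by exists x'.
  by exists u => //; rewrite !inE ux.
rewrite !inE => /andP[ux ur] ->; have [->|ux'] := eqVneq u x'.
  by exists x => //; rewrite !inE eq_sym x'x.
by exists u => //; rewrite !inE ux'.
Qed.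

Definition outer_door : {set T + I} := inr @: (~: [set i0]).

(** The slack [inr i0] cannot complete the outer door, as a genuine point would then lie above every
    minimum; a genuine point completes it only if it is the largest for the ranking [i0]. *)
Lemma outer_door_rooms :
  #|[set x | (x \notin outer_door) && dominant (x |: outer_door)]| = 1.
Proof.
pose tm := [arg max_(t > t0) f i0 (inl t)].
have tmP t : f i0 (inl t) <= f i0 (inl tm).
  by rewrite /tm; case: arg_maxnP => // t1 _; apply.
have inlo t : inl t \notin outer_door by apply/negP => /imsetP[].
have inro k : (inr k \in outer_door) = (k != i0).
  by rewrite mem_imset ?inE// => ? ? [].
apply/eqP/cards1P; exists (inl tm); apply/setP => x; rewrite inE in_set1.
apply/andP/eqP => [[xd /dominantP dx]|->].
  case: x xd dx => [t _ dx|k]; last first.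
    rewrite inro negbK => /eqP-> dx; have [i] := dx (inl t0).
    move/(_ (inr i)); rewrite !inE inro.
    have -> : (inr i == inr i0 :> T + I) || (i != i0).
      by have [->|] := eqVneq i i0; rewrite ?eqxx ?orbT.
    move=> /(_ isT) h; have := f_inj (_ : f i (inl t0) = f i (inr i)).
    suff e : f i (inl t0) = f i (inr i) by move/(_ e).
    by apply/eqP; rewrite eqn_leq h f_min.
  have [i hi] := dx (inl tm).
  have [ii0|ii0] := eqVneq i i0.
    apply: (@f_inj i0); apply/eqP; rewrite eqn_leq tmP/= -ii0 hi//.
    by rewrite !inE eqxx.
  have h : f i (inl tm) <= f i (inr i) by rewrite hi// !inE inro ii0 orbT.
  have := f_inj (_ : f i (inl tm) = f i (inr i)).
  suff e : f i (inl tm) = f i (inr i) by move/(_ e).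
  by apply/eqP; rewrite eqn_leq h f_min.
split => //; apply/dominantP => -[t|k].
  exists i0 => y; rewrite !inE => /orP[/eqP->//|/imsetP[k]].
  by rewrite !inE => ki0 ->; apply: ltnW; exact: f_big.
by exists k => y _; exact: f_min.
Qed.

(* Sperner's parity argument, by double counting the pairs (door, room) where a
   room is a dominant set with #|I| elements and a door is a set with #|I| - 1
   elements carrying all labels but i0: were no room fully labelled, every room
   would have an even number of doors, while every door has an even number of
   rooms, except the outer door, which has one. *)
Lemma dominant_full : exists r : {set T + I},
  [/\ dominant r, #|r| = #|I| & slack_lab @: r = setT].
Proof.
have [/existsP[r /and3P[dr /eqP cr /eqP lr]]|/existsPn nex] :=
  boolP [exists r : {set T + I}, [&& dominant r, #|r| == #|I| & slack_lab @: r == setT]];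
  first by exists r.
exfalso.
pose door (d : {set T + I}) := slack_lab @: d == ~: [set i0].
pose isdoor (d : {set T + I}) := (#|d|.+1 == #|I|) && door d.
have cI : #|~: [set i0]|.+1 = #|I| by rewrite -(cardsC [set i0]) cards1.
have inr_inj : injective (inr : I -> T + I) by move=> ? ? [].
have door0 : isdoor outer_door.
  rewrite /isdoor card_imset// cI eqxx /door; apply/eqP/setP => i.
  apply/imsetP/idP => [[_ /imsetP[k ki ->] -> //]|ii0].
  by exists (inr i) => //; rewrite imset_f.
have : odd (\sum_(d | isdoor d) #|[set x | (x \notin d) && dominant (x |: d)]|).
  rewrite (bigD1 outer_door)//= outer_door_rooms oddD/=.
  rewrite (big_morph odd oddD (erefl _)) big1// => d /andP[/andP[/eqP cd /eqP ld] d0].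
  apply/negbTE; have [/existsP[t td]|/existsPn nt] := boolP [exists t, inl t \in d].
    exact: even_rooms_of_door td.
  case/eqP: d0; apply/eqP; rewrite eqEcard card_imset//.
  rewrite -ltnS cI cd leqnn andbT; apply/subsetP => -[t|k] h.
    by have := nt t; rewrite h.
  by rewrite imset_f// -ld -[k]/(slack_lab (inr k)) imset_f.
apply/negP.
under eq_bigr do rewrite -sum1_card big_mkcond/=.
rewrite exchange_big/=.
have -> : \sum_(x : T + I) \sum_(d | isdoor d)
      (if x \in [set x | (x \notin d) && dominant (x |: d)] then 1 else 0) =
   \sum_(x : T + I) \sum_(r : {set T + I} | dominant r && (#|r| == #|I|))
      (if x \in [set x in r | door (r :\ x)] then 1 else 0).
  apply: eq_bigr => x _; rewrite -!big_mkcondr/=.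
  rewrite (reindex_onto (fun r => r :\ x) (fun d => x |: d))/=; last first.
    by move=> d /andP[_]; rewrite inE => /andP[xd _]; rewrite setU1K.
  apply: eq_bigl => r; rewrite !inE eqxx/=.
  have [xr|xr] := boolP (x \in r); last first.
    rewrite andbF; apply/negbTE; rewrite negb_and; apply/orP; right.
    by apply: contraNneq xr => <-; rewrite setU11.
  rewrite setD1K// eqxx andbT (cardsD1 x r) xr /isdoor add1n.
  by rewrite [dominant r && _]andbC -!andbA; congr (_ && _); rewrite andbC.
rewrite exchange_big/= (big_morph odd oddD (erefl _)) big1// => r /andP[dr /eqP cr].
rewrite -big_mkcond/= sum1_card; apply/negbTE/even_doors_of_room => //.
by have := nex r; rewrite dr cr eqxx.
Qed.

End Sperner.

Section grid_Sperner.
Local Open Scope nat_scope.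

(* Obtained from [dominant_full] with the slack element of i ranked lowest for i
   and above all genuine points for the other rankings. *)
Lemma no_bullying (T I : finType) (g : I -> T -> nat) (lab : T -> I) (t0 : T) :
  (forall i, injective (g i)) ->
  exists (S : {set T}) (C : {set I}),
    (forall i, i \in C -> exists2 t, t \in S & lab t = i) /\
    (forall x, exists2 i, i \in C & forall t, t \in S -> g i x <= g i t).
Proof.
move=> ginj; pose B := (\max_i \max_x g i x).+2.
have gB i x : (g i x).+1 < B.
  rewrite !ltnS; apply: leq_trans (leq_bigmax_cond i _) => //.
  exact: (leq_bigmax_cond x).
pose f (i : I) (x : T + I) : nat := match x with
  | inl t => (g i t).+1
  | inr k => if k == i then 0 else B + enum_rank k end.
have f_inj i : injective (f i).
  case=> [t|k] [t'|k'] //=.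
  - by case=> /ginj->.
  - case: eqP => // _ h; have := gB i t; lia.
  - case: eqP => // _ h; have := gB i t'; lia.
  - case: eqP => [->|ki]; case: eqP => [->|k'i] //.
    by move/addnI/ord_inj/enum_rank_inj->.
have f_min i y : f i (inr i) <= f i y by rewrite /= eqxx.
have f_big i k x : k != i -> f i (inl x) < f i (inr k).
  by move=> /= /negbTE->; have := gB i x; lia.
have [r [/dominantP dr cr lr]] := dominant_full f_inj f_min f_big lab (lab t0) t0.
exists [set t | inl t \in r], [set i | inr i \notin r]; split => [i|x].
  rewrite inE => ir; have : i \in slack_lab lab @: r by rewrite lr inE.
  case/imsetP => -[t|k] zr /= iE; last by rewrite iE zr in ir.
  by exists t; rewrite ?inE.
have [i hi] := dr (inl x); exists i => [|t]; rewrite inE.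
  by apply/negP => /hi /=; rewrite eqxx.
by move/hi.
Qed.

(** No boundary condition is put on the labelling: a label missing from C is compensated by an
    almost vanishing coordinate. The rankings are the coordinates, ties being broken by an
    enumeration of the grid. If the minima m over S were too low, a grid point with coordinates at
    least [m k + 1] for k in C would violate dominance; hence these minima nearly exhaust N, and the
    points of S are close to one another. *)
Lemma grid_sperner (I : finType) (i1 : I) (N : nat) (lab : {ffun I -> nat} -> I) :
  exists (C : {set I}) (y : I -> {ffun I -> nat}) (z : {ffun I -> nat}),
  [/\ \sum_k z k = N,
      forall i, i \in C -> lab (y i) = i /\ \sum_k y i k = N,
      forall i, i \in C -> forall k, y i k <= z k + #|I| /\ z k <= y i k + #|I| &
      forall i, i \notin C -> z i <= #|I|].
Proof.
pose T : finType := {y : {ffun I -> 'I_N.+1} | \sum_k (y k : nat) == N}.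
pose toN (t : T) : {ffun I -> nat} := [ffun k => val t k : nat].
have sumT t : \sum_k toN t k = N.
  by rewrite -[RHS](eqP (valP t)); apply: eq_bigr => k _; rewrite ffunE.
have mkT (x : I -> nat) : \sum_k x k = N -> exists t : T, forall k, toN t k = x k.
  move=> sx; have xN k : x k < N.+1 by rewrite ltnS -sx (bigD1 k)//= leq_addr.
  have h : \sum_k ([ffun k => Ordinal (xN k)] k : nat) == N.
    by apply/eqP; rewrite -[RHS]sx; apply: eq_bigr => k _; rewrite ffunE.
  by exists (Sub [ffun k => Ordinal (xN k)] h : T) => k; rewrite ffunE SubK ffunE.
have [|t0 _] := mkT (fun k => if k == i1 then N else 0).
  by rewrite -big_mkcond big_pred1_eq.
pose g i (t : T) := (toN t i * #|T| + enum_rank t)%N.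
have ginj i : injective (g i).
  move=> t t' /(congr1 (modn^~ #|T|)); rewrite !modnMDl !modn_small//.
  by move/ord_inj/enum_rank_inj.
have gle i t t' : g i t <= g i t' -> toN t i <= toN t' i.
  apply: contraTT; rewrite -!ltnNge => h.
  rewrite /g; have := ltn_ord (enum_rank t').
  have := leq_mul h (leqnn #|T|); rewrite mulSn => h1 h2.
  by rewrite (leq_trans _ (leq_trans h1 (leq_addr _ _)))// addnC ltn_add2r.
have [S [C [hC hS]]] := no_bullying (lab \o toN) t0 ginj.
have [ic icC _] := hS t0; have [z zS _] := hC _ icC.
pose m k := toN [arg min_(t < z in S) toN t k] k.
have mP k t : t \in S -> m k <= toN t k.
  by move=> tS; rewrite /m; case: arg_minnP => // u _; apply.
have mE k : exists2 t, t \in S & m k = toN t k.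
  by rewrite /m; case: arg_minnP => // u uS _; exists u.
have sumC : N < \sum_(k in C) (m k).+1.
  rewrite ltnNge; apply/negP => le.
  pose e := N - \sum_(k in C) (m k).+1.
  have [|t ht] := mkT (fun k => (if k \in C then (m k).+1 else 0) +
                               (if k == ic then e else 0)).
    by rewrite big_split/= -!big_mkcond big_pred1_eq /e subnKC.
  have [i iC hi] := hS t; have [u uS mu] := mE i.
  have := gle _ _ _ (hi _ uS); rewrite ht iC -mu; lia.
have close t : t \in S -> forall k, toN t k <= (if k \in C then m k else 0) + #|I|.
  move=> tS k; have CI : #|C| <= #|I| by exact: max_card.
  have : \sum_j (if j \in C then m j else 0) + #|C| > N.
    move: sumC; rewrite -big_mkcond /=; under eq_bigr do rewrite -addn1.
    by rewrite big_split/= sum1_card.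
  rewrite -(sumT t) [X in X < _](bigD1 k)//= [X in _ < X + _](bigD1 k)//=.
  have : \sum_(i | i != k) (if i \in C then m i else 0) <= \sum_(i | i != k) toN t i.
    by apply: leq_sum => i _; case: ifP => // _; exact: mP.
  move: CI; set c1 := #|_|; set c2 := #|_|; case: (k \in C); lia. 
have /fin_all_exists[y hy] : forall i, exists t, i \in C -> t \in S /\ lab (toN t) = i.
  move=> i; have [iC|//] := boolP (i \in C); last by exists z.
  by have [t tS lt] := hC _ iC; exists t.
exists C, (fun i => toN (y i)), (toN z); split => //.
- by move=> i iC; have [_ ->] := hy _ iC.
- move=> i iC k; have [yS _] := hy _ iC; have := close _ yS k; have := close _ zS k.
  case: ifP => kC; last by lia.
  by have := mP k _ yS; have := mP k _ zS; lia.
- by move=> i /negbTE iC; have := close _ zS i; rewrite iC add0n.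
Qed.

End grid_Sperner.

From mathcomp Require Import all_classical all_reals all_analysis.
From mathcomp Require Import measurable_realfun.
Import Order.TTheory GRing.Theory Num.Theory.
Import numFieldNormedType.Exports.
Local Open Scope classical_set_scope.
Local Open Scope ring_scope.

(** * Limits along an ultrafilter and zeros of quadratic fields *)

Lemma free_ultrafilter : exists U : set_system nat, UltraFilter U /\ \oo `<=` U.
Proof. exact: ultraFilterLemma. Qed.

Lemma fmap_ultra (I T : Type) (U : set_system I) (u : I -> T) :
  UltraFilter U -> UltraFilter (u @ U).
Proof.
move=> UU; split; first exact: fmap_proper_filter.
move=> G PG uG; apply/seteqP; split => // A GA.
have [//|UC] := in_ultra_setVsetC (u @^-1` A) UU.
have : G (A `&` ~` A) by apply: filterI => //; exact: uG.
by rewrite setICr => /filter_not_empty.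
Qed.

Lemma ultra_compact_cvg (T : topologicalType) (I : Type) (U : set_system I)
  (A : set T) (u : I -> T) : UltraFilter U -> compact A ->
  U [set n | A (u n)] -> exists2 l, A l & u @ U --> l.
Proof.
move=> UU cA UA; have UuU := fmap_ultra u UU.
by move: cA; rewrite compact_ultra => /(_ _ UuU UA) [l [Al ul]]; exists l.
Qed.

Lemma ultra_bounded_cvg (R : realType) (I : Type) (U : set_system I)
  (u : I -> R) (a b : R) : UltraFilter U -> (forall n, a <= u n <= b) ->
  exists2 l, a <= l <= b & u @ U --> l.
Proof.
move=> UU ub.
have [||l] := @ultra_compact_cvg R I U `[a, b] u UU.
- exact: segment_compact.
- by apply: filterS filterT => n _ /=; rewrite in_itv/= ub.
- by rewrite /= in_itv/=; exists l.
Qed.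

Lemma cvg_sumr (R : realType) (I J : Type) (U : set_system I) (r : seq J)
  (P : pred J) {FU : Filter U} (u : J -> I -> R) (l : J -> R) :
  (forall j, P j -> u j @ U --> l j) ->
  (fun n => \sum_(j <- r | P j) u j n) @ U --> \sum_(j <- r | P j) l j.
Proof.
move=> ul; elim: r => [|j r ih].
  by rewrite big_nil; under eq_fun do rewrite big_nil; exact: cvg_cst.
rewrite big_cons; under eq_fun do rewrite big_cons.
by case: ifPn => // Pj; apply: cvgD => //; exact: ul.
Qed.

Lemma cvg_ge_near (R : realType) (U : set_system nat) {FU : ProperFilter U} (u : nat -> R) (l c : R) :
  u @ U --> l -> U [set n | c <= u n] -> c <= l.
Proof.
move=> ul cu; apply: (ler_cvg_to (_ : (fun=> c) @ U --> c) ul) => //.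
exact: cvg_cst.
Qed.

Lemma cvg_le_near (R : realType) (U : set_system nat) {FU : ProperFilter U} (u : nat -> R) (l c : R) :
  u @ U --> l -> U [set n | u n <= c] -> l <= c.
Proof.
move=> ul cu; apply: (ler_cvg_to ul (_ : (fun=> c) @ U --> c)) => //.
exact: cvg_cst.
Qed.

Lemma cvgr_uniq (R : realType) (I : Type) (U : set_system I) {FU : ProperFilter U} (u : I -> R) (l l' : R) :
  u @ U --> l -> u @ U --> l' -> l = l'.
Proof. by apply: cvg_unique => //; exact: norm_hausdorff. Qed.

Lemma near0_div_nat (R : realType) (U : set_system nat) {FU : Filter U} (c : R) :
  \oo `<=` U -> (fun N : nat => c / N.+1%:R) @ U --> (0 : R).
Proof.
move=> UN; have : (fun N : nat => c / N.+1%:R) @ \oo --> (0 : R).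
  rewrite -[X in _ --> X](mulr0 c); apply: cvgM; first exact: cvg_cst.
  exact: cvg_harmonic.
by apply: cvg_trans => A; exact: UN.
Qed.

(* The field t |-> sum p s p s' c s s' t is tangent to the simplex and points
   inwards on its faces. Every point of a fine grid is labelled by a coordinate
   along which the field does not decrease; a limit of fully labelled cells is
   then a point where no component of the field is negative. *)
Lemma quadratic_zero (R : realType) (S : finType) (s0 : S) (c : S -> S -> S -> R) :
  (forall s s', \sum_t c s s' t = 0) -> (forall s s' t, t != s -> 0 <= c s s' t) ->
  exists p : S -> R, [/\ forall s, 0 <= p s, \sum_s p s = 1 &
    forall t, \sum_s \sum_s' p s * p s' * c s s' t = 0].
Proof.
move=> csum cpos; pose B (p : S -> R) t := \sum_s \sum_s' p s * p s' * c s s' t.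
have Bsum p : \sum_t B p t = 0.
  rewrite exchange_big/=; apply: big1 => s _; rewrite exchange_big/=.
  by apply: big1 => s' _; rewrite -mulr_sumr csum mulr0.
have Bex p : exists t, 0 <= B p t.
  apply: contrapT => /forallNP neg; have : \sum_t - B p t = 0.
    by rewrite sumrN Bsum oppr0.
  have Bneg t : 0 <= - B p t by rewrite oppr_ge0 ltW// ltNge; exact/negP.
  move/eqP; rewrite psumr_eq0 => [/allP/(_ s0)|t _]; last exact: Bneg.
  rewrite mem_index_enum oppr_eq0 => /(_ isT)/eqP e.
  by apply: (neg s0); rewrite e.
have [lab labP] : exists lab : (S -> R) -> S, forall p, 0 <= B p (lab p).
  by have /choice[lab] := Bex; exists lab.
pose sc N (y : {ffun S -> nat}) (s : S) : R := (y s)%:R / N.+1%:R.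
have key N := grid_sperner s0 N.+1 (fun y => lab (sc N y)).
have /choice[C /choice[y /choice[z yz]]] := key.
have [U [UU UN]] := free_ultrafilter.
pose n : R := #|S|%:R.
have szP N s : 0 <= sc N (z N) s <= 1.
  have [zs _ _ _] := yz N; rewrite divr_ge0//= ler_pdivrMr ?ltr0n// mul1r ler_nat.
  by rewrite -zs (bigD1 s)//= leq_addr.
have /choice[p hp] : forall s, exists l : R, 0 <= l <= 1 /\ (fun N => sc N (z N) s) @ U --> l.
  by move=> s; have [l] := ultra_bounded_cvg UU (fun N => szP N s); exists l.
have B_cvg (q : nat -> S -> R) t : (forall s, (fun N => q N s) @ U --> p s) ->
    (fun N => B (q N) t) @ U --> B p t.
  move=> qp; apply: cvg_sumr => s _; apply: cvg_sumr => s' _.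
  by apply: cvgM; [apply: cvgM; exact: qp|exact: cvg_cst].
have c0p t : p t = 0 -> 0 <= B p t.
  move=> pt; apply: sumr_ge0 => s _; apply: sumr_ge0 => s' _.
  have [->|ts] := eqVneq s t; first by rewrite pt !mul0r.
  have /andP[s1 _] := (hp s).1; have /andP[s1' _] := (hp s').1.
  by rewrite !mulr_ge0// cpos// eq_sym.
have Bp t : 0 <= B p t.
  (* Either almost every cell has a vertex labelled t, and these vertices converge to p, or the
     coordinate t of almost every z is at most #|S|, and [p t = 0]. *)
  have [UC|UC] := in_ultra_setVsetC [set N | t \in C N] UU; last first.
    apply: c0p; apply/eqP; rewrite eq_le (proj1 (andP (hp t).1)) andbT.
    apply: (@ler_cvg_to _ U _ _ (fun N => sc N (z N) t) (fun N => n / N.+1%:R)).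
    - exact: (hp t).2.
    - exact: near0_div_nat.
    - apply: filterS UC => N /= tC; have [_ _ _ /(_ t)] := yz N.
      move/negP: tC => tC /(_ tC) zt.
      by rewrite ler_pM2r ?invr_gt0 ?ltr0n// ler_nat.
  pose q N := if t \in C N then sc N (y N t) else sc N (z N).
  have qp s : (fun N => q N s) @ U --> p s.
    have -> : (fun N => q N s) = (fun N => (q N s - sc N (z N) s) + sc N (z N) s).
      by apply/funext => N; rewrite subrK.
    rewrite -[X in _ --> X]add0r; apply: cvgD; last exact: (hp s).2.
    apply/cvgr0Pnorm_le => e e0.
    have /cvgr0Pnorm_le/(_ e e0) := @near0_div_nat R U (@ultra_proper _ _ UU) n UN.
    apply: filterS => N; apply: le_trans; rewrite [leRHS]ger0_norm ?divr_ge0//.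
    rewrite /q; case: ifPn => tC; last by rewrite subrr normr0 divr_ge0.
    have [_ _ /(_ t tC s)[h1 h2] _] := yz N.
    rewrite /sc -mulrBl normrM (@ger0_norm _ _^-1)//.
    rewrite ler_pM2r ?invr_gt0 ?ltr0n//.
    rewrite /n ler_norml !lerBlDr lerNl opprB lerBlDr -!natrD !ler_nat.
    by apply/andP; split; rewrite addnC.
  apply: (@cvg_ge_near _ U _ (fun N => B (q N) t)); first exact: B_cvg.
  apply: filterS UC => N /= tC; rewrite /q tC.
  have [_ /(_ t tC)[lt _] _ _] := yz N.
  by rewrite -{2}lt.
exists p; split.
- by move=> s; have /andP[] := (hp s).1.
- have : (fun N => \sum_s sc N (z N) s) @ U --> \sum_s p s.
    by apply: cvg_sumr => s _; exact: (hp s).2.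
  have -> : (fun N => \sum_s sc N (z N) s) = cst 1.
    apply/funext => N; rewrite -mulr_suml -natr_sum.
    by have [-> _ _ _] := yz N; rewrite divff ?pnatr_eq0.
  by move/cvgr_uniq => /(_ 1) <- //; exact: cvg_cst.
(* The components are nonnegative and sum to zero. *)
- move=> t; have := Bsum p; move/eqP; rewrite psumr_eq0 => [/allP/(_ t)|s _]; last exact: Bp.
  by rewrite mem_index_enum => /(_ isT)/eqP.
Qed.

(** * Moments of stationary schemes *)

Section powR_facts.
Context {R : realType}.
Implicit Types x y p q l e : R.

Lemma powRE x p : 0 < x -> x `^ p = expR (p * ln x).
Proof. by move=> x0; rewrite /powR gt_eqF. Qed.

Lemma powR_le_add x p l q : 0 < x -> p <= l <= q -> x `^ l <= x `^ p + x `^ q.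
Proof.
move=> x0 /andP[pl lq]; have [x1|x1] := leP x 1.
  by rewrite (le_trans (ger_powR _ pl)) ?x0// lerDl powR_ge0.
by rewrite (le_trans (ler_powR (ltW x1) lq))// lerDr powR_ge0.
Qed.

(** The crossover is [expR A], where e x^q = x^l: above it the first term suffices, and below it
    x^(l - p) is at most its value there, which is the constant. *)
Lemma powR_interpolation p l q e : 0 < e -> p <= l < q ->
  exists2 C : R, 0 < C & forall x, 0 < x -> x `^ l <= e * x `^ q + C * x `^ p.
Proof.
move=> e0 /andP[pl lq]; have ql : 0 < q - l by rewrite subr_gt0.
pose A := - ln e / (q - l); exists (expR (A * (l - p))); first exact: expR_gt0.
move=> x x0; rewrite !powRE// -{1}(lnK e0) -!expRD.
have [xA|xA] := leP (ln x) A.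
  apply: ler_wpDl; first exact: expR_ge0.
  by rewrite ler_expR; nra.
apply: ler_wpDr; first exact: expR_ge0.
by move: xA; rewrite ler_expR /A ltr_pdivrMr// => h; lra.
Qed.

(** The crossover is a^(Q - q) = v^(s - t) / e. Above it the first term suffices; below it,
    inserting the crossover value of a yields the constant and the exponent s'. *)
Lemma young_weighted (q Q s t e : R) : 0 < e -> 0 <= q < Q ->
  exists C s', 0 < C /\ forall a v, 0 < a -> 0 < v ->
    a `^ q * v `^ s <= e * (a `^ Q * v `^ t) + C * v `^ s'.
Proof.
move=> e0 /andP[q0 qQ]; have Qq : 0 < Q - q by rewrite subr_gt0.
exists (expR (- ln e * (q / (Q - q)))), (s + (s - t) * (q / (Q - q))).
split; first exact: expR_gt0.
move=> a v a0 v0; rewrite !powRE// -{1}(lnK e0) -!expRD.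
have [aA|aA] := leP (ln a * (Q - q)) ((s - t) * ln v - ln e).
  apply: ler_wpDl; first exact: expR_ge0.
  rewrite ler_expR.
  have := ler_wpM2l (divr_ge0 q0 (ltW Qq)) aA.
  have -> : q / (Q - q) * (ln a * (Q - q)) = q * ln a by field; rewrite gt_eqF.
  move: (q / (Q - q)) => z h; nra.
apply: ler_wpDr; first exact: expR_ge0.
by rewrite ler_expR; nra.
Qed.

(** A rearrangement of 1 - t / n <= exp(- t / n), for either sign of t; it bounds the difference
    quotients of the rescaling uniformly in the speed n. *)
Lemma expR_slope (n : R) t : 1 <= n -> n * (expR (t / n) - 1) <= t * expR (t / n).
Proof.
move=> n1; have n0 : 0 < n by exact: lt_le_trans n1.
have := expR_ge1Dx (- (t / n)); rewrite expRN -(ler_pM2r (expR_gt0 (t / n))).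
rewrite mulVf ?gt_eqF ?expR_gt0// => h.
rewrite -[X in X * _ <= _]mulr1 -ler_pdivlMl ?mulr1//.
by rewrite mulrA [n^-1 * t]mulrC; lra.
Qed.

(** The pure power of x cancels, so every remaining term carries a factor y. After a further
    multiplication by x, no term has its whole degree on a single particle. *)
Lemma expD_sub_le (n : nat) : exists2 C : R, 0 < C & forall x y, 0 <= x -> 0 <= y ->
  (x + y) ^+ n.+1 - x ^+ n.+1 <= C * (x ^+ n * y + y ^+ n.+1).
Proof.
have D x y : 0 <= x -> 0 <= y -> (x + y) ^+ n <= 2 ^+ n * (x ^+ n + y ^+ n).
  move=> x0 y0; wlog xy : x y x0 y0 / x <= y.
    move=> h; have [/h|/ltW/h] := leP x y; first exact.
    by rewrite addrC [y ^+ _ + _]addrC; apply.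
  apply: (@le_trans _ _ ((2 * y) ^+ n)).
    by apply: lerXn2r; rewrite ?nnegrE ?addr_ge0 ?mulr_ge0//; lra.
  by rewrite exprMn ler_wpM2l ?exprn_ge0// lerDr exprn_ge0.
exists (n.+1%:R * 2 ^+ n); first by rewrite mulr_gt0 ?ltr0n// exprn_gt0.
move=> x y x0 y0.
have : (x + y) ^+ n.+1 - x ^+ n.+1 <= n.+1%:R * (y * (x + y) ^+ n).
  rewrite subrXX; have -> : x + y - x = y by lra.
  rewrite mulrCA ler_wpM2l//; apply: le_trans (_ : \sum_(i < n.+1) (x + y) ^+ n <= _).
    apply: ler_sum => i _.
    have -> : (x + y) ^+ n = (x + y) ^+ (n.+1.-1 - i) * (x + y) ^+ i.
      by rewrite -exprD subnK// -ltnS.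
    by rewrite ler_wpM2l ?exprn_ge0 ?addr_ge0// lerXn2r ?nnegrE ?addr_ge0// lerDl.
  by rewrite sumr_const card_ord mulr_natl.
move=> /le_trans; apply; rewrite -!mulrA ler_wpM2l//.
have := ler_wpM2l y0 (D _ _ x0 y0); move=> /le_trans; apply.
by rewrite exprS mulrCA ler_wpM2l ?exprn_ge0// mulrDr [y * x ^+ n]mulrC.
Qed.

End powR_facts.

(** * Stationary finite systems and bounds for all their moments *)

Section moments.
Context {R : realType}.
Variables (alpha beta mu sigma kappa v0 K0 K1 R0 R1 c : R).

(* A stationary finite Markov-type approximation of the profile equation, in
   which a particle of area and volume (area s, vol s) shrinks by the self-similar
   rescaling, fuses towards the sphere, and coalesces; all test functions carry
   the factor vol, which makes each of the three mechanisms conserve the weight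
   wt s * vol s. The constant kappa stands for 1 - gamma. *)
Record scheme := Scheme {
  st : finType;
  wt : st -> R; vol : st -> R; area : st -> R;
  ker : st -> st -> R; rate : st -> R; frate : st -> R;
  shrink : st -> st; fuse : st -> st; coalesce : st -> st -> st; speed : R;
  wt_ge0 : forall s, 0 <= wt s;
  vol_gt0 : forall s, 0 < vol s;
  area_gt0 : forall s, 0 < area s;
  area_ge : forall s, c * vol s `^ (2 / 3) <= area s;
  ker_bounds : forall s s',
    K1 * (vol s `^ (- alpha) * vol s' `^ beta + vol s' `^ (- alpha) * vol s `^ beta)
      <= ker s s' <=
    K0 * (vol s `^ (- alpha) * vol s' `^ beta + vol s' `^ (- alpha) * vol s `^ beta);
  rate_bounds : forall s, R0 * area s `^ mu * vol s `^ sigma <= rate s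
     <= R1 * area s `^ mu * vol s `^ sigma;
  speed_ge1 : 1 <= speed;
  vol_shrink : forall s, vol (shrink s) = expR (- speed^-1) * vol s \/
     vol (shrink s) = vol s /\ vol s <= 1;
  area_shrink : forall s, area (shrink s) <= area s;
  vol_fuse : forall s, vol (fuse s) = vol s;
  area_fuse : forall s n, frate s * (area (fuse s) ^+ n.+1 - area s ^+ n.+1)
     <= - (rate s * (area s - c * vol s `^ (2 / 3)) * area s ^+ n);
  vol_coalesce_ge : forall s s', vol s <= vol (coalesce s s');
  vol_coalesce_le : forall s s', vol (coalesce s s') <= vol s + vol s';
  vol_coalesce_gt : forall s s', vol s <= vol s' -> vol s <= 1 ->
     3 / 2 * vol s <= vol (coalesce s s');
  area_coalesce : forall s s', area (coalesce s s') <= area s + area s';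
  mass : \sum_s wt s * vol s = v0;
  balance : forall psi : st -> R,
    \sum_s wt s * (vol s * (speed * (psi (shrink s) - psi s)))
    + kappa * (\sum_s wt s * (vol s * (frate s * (psi (fuse s) - psi s))))
    + kappa * (\sum_s \sum_s' wt s * wt s' *
        (vol s * (ker s s' * (psi (coalesce s s') - psi s)))) = 0
}.

Hypotheses (alpha_gt0 : 0 < alpha) (beta01 : 0 < beta < 1)
  (mu_gt0 : 0 < mu) (kappa_gt0 : 0 < kappa)
  (v0_gt0 : 0 < v0) (K0_gt0 : 0 < K0) (K1_gt0 : 0 < K1) (R0_gt0 : 0 < R0)
  (R1_gt0 : 0 < R1) (c_gt0 : 0 < c).

Definition E (X : scheme) (f : st X -> R) := \sum_s wt s * f s.
Definition EE (X : scheme) (f : st X -> st X -> R) :=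
  \sum_s \sum_s' wt s * wt s' * f s s'.

Lemma E_le (X : scheme) (f g : st X -> R) : (forall s, f s <= g s) -> E f <= E g.
Proof. by move=> fg; apply: ler_sum => s _; rewrite ler_wpM2l// wt_ge0. Qed.

Lemma E_ge0 (X : scheme) (f : st X -> R) : (forall s, 0 <= f s) -> 0 <= E f.
Proof. by move=> f0; apply: sumr_ge0 => s _; rewrite mulr_ge0// wt_ge0. Qed.

Lemma EZ (X : scheme) (k : R) (f : st X -> R) : E (fun s => k * f s) = k * E f.
Proof. by rewrite /E mulr_sumr; apply: eq_bigr => s _; rewrite mulrCA. Qed.

Lemma ED (X : scheme) (f g : st X -> R) : E (fun s => f s + g s) = E f + E g.
Proof. by rewrite /E -big_split; apply: eq_bigr => s _; rewrite mulrDr. Qed.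

Lemma EB (X : scheme) (f g : st X -> R) : E (fun s => f s - g s) = E f - E g.
Proof. by rewrite /E -sumrB; apply: eq_bigr => s _; rewrite mulrBr. Qed.

Lemma EE_le (X : scheme) (f g : st X -> st X -> R) :
  (forall s s', f s s' <= g s s') -> EE f <= EE g.
Proof.
move=> fg; apply: ler_sum => s _; apply: ler_sum => s' _.
by rewrite ler_wpM2l ?mulr_ge0// wt_ge0.
Qed.

Lemma EEZ (X : scheme) (k : R) (f : st X -> st X -> R) :
  EE (fun s s' => k * f s s') = k * EE f.
Proof.
rewrite /EE mulr_sumr; apply: eq_bigr => s _; rewrite mulr_sumr.
by apply: eq_bigr => s' _; rewrite mulrCA.
Qed.

Lemma EED (X : scheme) (f g : st X -> st X -> R) :
  EE (fun s s' => f s s' + g s s') = EE f + EE g.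
Proof.
rewrite /EE -big_split; apply: eq_bigr => s _; rewrite -big_split.
by apply: eq_bigr => s' _; rewrite mulrDr.
Qed.

Lemma EEM (X : scheme) (f g : st X -> R) :
  EE (fun s s' => f s * g s') = E f * E g.
Proof.
rewrite /EE /E mulr_suml; apply: eq_bigr => s _; rewrite mulr_sumr.
by apply: eq_bigr => s' _; rewrite mulrACA.
Qed.

Lemma EEC (X : scheme) (f : st X -> st X -> R) :
  EE f = EE (fun s s' => f s' s).
Proof.
rewrite /EE exchange_big; apply: eq_bigr => s _; apply: eq_bigr => s' _.
by rewrite [wt s * _]mulrC.
Qed.

Definition M (X : scheme) (l : R) := E (fun s : st X => vol s `^ l).

Lemma M1 X : M X 1 = v0.
Proof.
by rewrite -[RHS](mass X); apply: eq_bigr => s _; rewrite powRr1// ltW// vol_gt0.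
Qed.

Lemma M_ge0 X l : 0 <= M X l.
Proof. by apply: E_ge0 => s; exact: powR_ge0. Qed.

Lemma M_le_add X p l q : p <= l <= q -> M X l <= M X p + M X q.
Proof.
by move=> h; rewrite /M -ED; apply: E_le => s; apply: powR_le_add => //; exact: vol_gt0.
Qed.

Lemma ker_ge0 (X : scheme) (s s' : st X) : 0 <= ker s s'.
Proof.
have /andP[h _] := ker_bounds s s'; apply: le_trans h.
by rewrite mulr_ge0 ?(ltW K1_gt0)// addr_ge0// mulr_ge0// powR_ge0.
Qed.

(** The kernel bound is a sum of two products of functions of one state, so a double sum reduces to
    products of single moments. *)
Lemma ker_bound_prod (X : scheme) (f g : st X -> R) :
  (forall s, 0 <= f s) -> (forall s, 0 <= g s) ->
  EE (fun s s' => ker s s' * (f s * g s')) <=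
  K0 * (E (fun s => f s * vol s `^ (- alpha)) * E (fun s => g s * vol s `^ beta)
      + E (fun s => f s * vol s `^ beta) * E (fun s => g s * vol s `^ (- alpha))).
Proof.
move=> f0 g0; rewrite -!EEM -EED -EEZ; apply: EE_le => s s'.
have /andP[_ h] := ker_bounds s s'.
apply: le_trans (ler_wpM2r (mulr_ge0 (f0 s) (g0 s')) h) _.
by rewrite le_eqVlt; apply/orP; left; apply/eqP; ring.
Qed.

Lemma balanceE (X : scheme) (psi : st X -> R) :
  E (fun s => vol s * (speed X * (psi (shrink s) - psi s)))
  + kappa * E (fun s => vol s * (frate s * (psi (fuse s) - psi s)))
  + kappa * EE (fun s s' => vol s * (ker s s' * (psi (coalesce s s') - psi s))) = 0.
Proof. exact: balance. Qed.

Lemma volX (X : scheme) (s : st X) l : vol s * vol s `^ (l - 1) = vol s `^ l.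
Proof.
rewrite -{1}(powRr1 (ltW (vol_gt0 s))) -powRD; last first.
  by apply/implyP => _; rewrite gt_eqF// vol_gt0.
by rewrite addrC subrK.
Qed.

(** Stationarity tested with the power l - 1, which the factor [vol] of the scheme raises to l;
    fusion keeps volumes and drops out. *)
Lemma balance_vol (X : scheme) l :
  E (fun s : st X => vol s * (speed X * (vol (shrink s) `^ (l - 1) - vol s `^ (l - 1))))
  + kappa * EE (fun s s' : st X => ker s s' *
      (vol s * vol (coalesce s s') `^ (l - 1) - vol s `^ l)) = 0.
Proof.
rewrite -[RHS](balanceE (fun s : st X => vol s `^ (l - 1))).
rewrite [X in _ + _ * X + _](_ : _ = 0) ?mulr0 ?addr0; last first.
  by apply: big1 => s _; rewrite vol_fuse subrr !mulr0.
congr (_ + _ * _); apply: eq_bigr => s _; apply: eq_bigr => s' _; congr (_ * _).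
by rewrite -(volX s l); ring.
Qed.

(** Shrinking raises a negative power of the volume, but [speed X >= 1] keeps the factor exp((1 - l)
    / speed) below exp(1 - l), so the rate does not depend on the mesh. States stuck at the lower
    end of the grid contribute zero. *)
Lemma shrink_lt1 (X : scheme) l : l < 1 ->
  E (fun s : st X => vol s * (speed X * (vol (shrink s) `^ (l - 1) - vol s `^ (l - 1))))
  <= (1 - l) * expR (1 - l) * M X l.
Proof.
move=> l1; rewrite /M -EZ; apply: E_le => s.
have v0' := vol_gt0 s; have l1' := ltW l1; have n1 := speed_ge1 X.
have [->|[-> _]] := vol_shrink s; last first.
  by rewrite subrr !mulr0 !mulr_ge0 ?powR_ge0 ?expR_ge0// subr_ge0.
rewrite powRM ?expR_ge0 ?(ltW v0')// -expRM.
have -> : - (speed X)^-1 * (l - 1) = (1 - l) / speed X by ring.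
have -> (x y z w : R) : x * (y * (z * w - w)) = y * (z - 1) * (x * w) by ring.
rewrite volX; apply: ler_wpM2r; first exact: powR_ge0.
apply: le_trans (expR_slope _ n1) _.
rewrite ler_wpM2l ?subr_ge0// ler_expR ler_pdivrMr; last exact: lt_le_trans n1.
by rewrite ler_peMr// subr_ge0.
Qed.

(** Here the rescaling damps the moment. The states that do not shrink have volume at most 1, hence
    vol^l <= vol, and the mass [v0] covers them. *)
Lemma shrink_gt1 (X : scheme) l : 1 < l ->
  E (fun s : st X => vol s * (speed X * (vol (shrink s) `^ (l - 1) - vol s `^ (l - 1))))
  <= (l - 1) * expR (1 - l) * (v0 - M X l).
Proof.
move=> l1; rewrite mulrBr -(M1 X) /M -!EZ -EB; apply: E_le => s.
have v0' := vol_gt0 s; have l1' := ltW l1; have n1 := speed_ge1 X.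
have l10 : 0 < (l - 1) * expR (1 - l) by rewrite mulr_gt0 ?expR_gt0// subr_gt0.
have [->|[-> v1]] := vol_shrink s; last first.
  rewrite subrr !mulr0 subr_ge0 ler_wpM2l ?(ltW l10)//.
  by apply: ger_powR; rewrite ?v0'.
rewrite powRM ?expR_ge0 ?(ltW v0')// -expRM.
have -> : - (speed X)^-1 * (l - 1) = (1 - l) / speed X by ring.
have -> (x y z w : R) : x * (y * (z * w - w)) = y * (z - 1) * (x * w) by ring.
rewrite volX; apply: ler_wpDl; first by rewrite mulr_ge0 ?(ltW l10)// powR_ge0.
rewrite -mulNr; apply: ler_wpM2r; first exact: powR_ge0.
apply: le_trans (expR_slope _ n1) _.
rewrite -mulNr opprB; apply: ler_wnM2l; first by rewrite subr_le0.
rewrite ler_expR ler_pdivlMr; last exact: lt_le_trans n1.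
by nra.
Qed.

(* Merging with a larger particle multiplies a volume vol s <= 1 by 3/2 at
   least, hence decreases vol ^ (l - 1) by a fixed proportion. *)
Lemma small_pairs l : l < 1 -> exists2 C : R, 0 < C & forall X : scheme,
  EE (fun s s' : st X => if (vol s <= vol s') && (vol s <= 1)
        then vol s `^ (l - alpha) * vol s' `^ beta else 0) <= C * M X l.
Proof.
move=> l1; pose d : R := 1 - (3 / 2) `^ (l - 1).
have d0 : 0 < d.
  by rewrite subr_gt0 powRE; [rewrite expR_lt1 nmulr_rlt0 ?ln_gt0|]; lra.
exists ((K1 * d * kappa)^-1 * ((1 - l) * expR (1 - l))).
  by rewrite mulr_gt0 ?invr_gt0 ?mulr_gt0 ?expR_gt0// subr_gt0.
move=> X; rewrite -[leRHS]mulrA ler_pdivlMl ?mulr_gt0//.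
apply: le_trans (shrink_lt1 X l1); have := balance_vol X l.
rewrite addrC => /eqP; rewrite addr_eq0 => /eqP h.
rewrite -[leRHS]opprK -h [K1 * d * _]mulrC -mulrA -mulrN.
rewrite ler_pM2l// -EEZ -mulN1r -EEZ; apply: EE_le => s s'.
have vs := vol_gt0 s.
(* Merging never increases vol^(l - 1), so the pairs left out by the indicator can be discarded. *)
have key : 0 <= vol s `^ l - vol s * vol (coalesce s s') `^ (l - 1).
  rewrite -(volX s l) -mulrBr mulr_ge0 ?(ltW vs)// subr_ge0 !powRE//; last first.
    exact: lt_le_trans (vol_coalesce_ge s s').
  rewrite ler_expR; apply: ler_wnM2l; first by rewrite subr_le0 ltW.
  rewrite ler_ln ?posrE//; first exact: vol_coalesce_ge.
  exact: lt_le_trans (vol_coalesce_ge s s').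
have e : -1 * (ker s s' * (vol s * vol (coalesce s s') `^ (l - 1) - vol s `^ l))
   = ker s s' * (vol s `^ l - vol s * vol (coalesce s s') `^ (l - 1)) by ring.
rewrite e; case: ifP => [/andP[vv vs1]|_]; last first.
  by rewrite mulr0 mulr_ge0// ker_ge0.
have vm := vol_coalesce_gt vv vs1.
have k2 : d * vol s `^ l <= vol s `^ l - vol s * vol (coalesce s s') `^ (l - 1).
  rewrite mulrBl mul1r lerD2l lerN2 -(volX s l) mulrCA ler_wpM2l ?(ltW vs)//.
  rewrite -powRM ?(ltW vs) ?divr_ge0//.
  have m32 : 0 < 3 / 2 * vol s by rewrite mulr_gt0//; lra.
  rewrite !powRE//; last exact: lt_le_trans (vol_coalesce_ge s s').
  rewrite ler_expR; apply: ler_wnM2l; first by rewrite subr_le0 ltW.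
  by rewrite ler_ln ?posrE//; exact: lt_le_trans (vol_coalesce_ge s s').
have k1 : K1 * (vol s `^ (- alpha) * vol s' `^ beta) <= ker s s'.
  have /andP[h1 _] := ker_bounds s s'; apply: le_trans h1.
  by rewrite ler_wpM2l ?(ltW K1_gt0)// lerDl mulr_ge0// powR_ge0.
have -> : K1 * d * (vol s `^ (l - alpha) * vol s' `^ beta) =
    (K1 * (vol s `^ (- alpha) * vol s' `^ beta)) * (d * vol s `^ l).
  rewrite powRD; last by apply/implyP => _; rewrite gt_eqF.
  by ring.
apply: ler_pM => //; last by rewrite mulr_ge0 ?(ltW d0)// powR_ge0.
by rewrite mulr_ge0 ?(ltW K1_gt0)// mulr_ge0// powR_ge0.
Qed.

(* With l = beta - alpha + 2 t and p = beta - alpha + t, the pairs counted by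
   [small_pairs] yield (M p)^2 <= C M l <= C (M p + v0), which bounds M p. *)
Lemma M_one_sub_alpha : exists C : R, forall X : scheme, M X (1 - alpha) <= C.
Proof.
have /andP[b0 b1] := beta01.
(* The bound by alpha allows a power alpha - t to be moved to the larger volume; the bound by 1 -
   beta puts l below 1 and p below 1 - alpha, so that M X p and the mass control M X (1 - alpha). *)
pose t := Num.min alpha (1 - beta) / 2.
have ta : 2 * t <= alpha by rewrite mulrC divfK// ge_min lexx.
have tb : 2 * t <= 1 - beta by rewrite mulrC divfK// ge_min lexx orbT.
have t0 : 0 < t by rewrite divr_gt0// lt_min alpha_gt0 subr_gt0.
pose l := beta - alpha + 2 * t; pose p := beta - alpha + t.
have l1 : l < 1 by rewrite /l; lra.
have [C C0 hC] := small_pairs l1.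
exists (2 * C + 1 + 4 * C * v0 + v0 + v0) => X.
apply: le_trans (@M_le_add X p _ 1 _) _; first by rewrite /p; apply/andP; split; lra.
rewrite M1 lerD2r.
(* Only volumes at most 1 enter the quadratic inequality; on the others vol^p <= vol, since p <=
   1. *)
pose chi (s : st X) := if vol s <= 1 then vol s `^ p else 0.
have Mp : M X p <= E chi + v0.
  rewrite -(M1 X) -ED; apply: E_le => s; rewrite /chi; case: ifPn => [_|].
    by rewrite lerDl powR_ge0.
  by rewrite -ltNge add0r => v1; apply: ler_powR; rewrite /p; lra.
have Ml : M X l <= M X p + v0.
  by rewrite -(M1 X); apply: M_le_add; rewrite /p /l; apply/andP; split; lra.
have chi0 : 0 <= E chi.
  by apply: E_ge0 => s; rewrite /chi; case: ifP => // _; exact: powR_ge0.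
have sq : E chi * E chi <= 2 * (C * M X l).
  rewrite -EEM; apply: le_trans (_ : _ <= 2 * EE (fun s s' : st X =>
    if (vol s <= vol s') && (vol s <= 1)
    then vol s `^ (l - alpha) * vol s' `^ beta else 0)) _; last first.
    by rewrite ler_wpM2l.
  rewrite mulr_natl mulr2n [X in _ <= _ + X]EEC -EED; apply: EE_le => s s'.
  (* Both sides have the same total degree, as 2 p = l - alpha + beta, and x^(alpha - t) <= y^(alpha
     - t). *)
  have key (x y : R) : 0 < x -> 0 < y -> x <= y ->
      x `^ p * y `^ p <= x `^ (l - alpha) * y `^ beta.
    move=> x0 y0; rewrite -ler_ln ?posrE// => xy.
    by rewrite !powRE// -!expRD ler_expR /l /p; nra.
  have g0 (x y : R) (b : bool) : 0 <= (if b then x `^ (l - alpha) * y `^ beta else 0).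
    by case: ifP => // _; rewrite mulr_ge0// powR_ge0.
  have vs := vol_gt0 s; have vs' := vol_gt0 s'.
  rewrite /chi; have [vs1|vs1] := boolP (vol s <= 1); last by rewrite mul0r; apply: addr_ge0; exact: g0.
  have [vs'1|vs'1] := boolP (vol s' <= 1); last by rewrite mulr0; apply: addr_ge0; exact: g0.
  have [vv|/ltW vv] := leP (vol s) (vol s').
    by apply: ler_wpDr; [exact: g0|exact: key].
  apply: ler_wpDl; last by rewrite vv/= mulrC key.
  exact: lexx.
have : E chi * E chi <= 2 * C * E chi + 4 * C * v0 by nra.
move: (E chi) chi0 Mp => x x0 Mp xx; apply: le_trans Mp _; rewrite lerD2r.
have [x1|x1] := leP x 1; first by have := mulr_gt0 C0 v0_gt0; lra.
have Cv := mulr_gt0 C0 v0_gt0; rewrite leNgt; apply/negP => h; nra.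
Qed.

Lemma M_interp p l q e : 0 < e -> p <= l < q ->
  exists2 C : R, 0 < C & forall X, M X l <= e * M X q + C * M X p.
Proof.
move=> e0 h; have [C C0 hC] := powR_interpolation e0 h; exists C => // X.
by rewrite /M -!EZ -ED; apply: E_le => s; apply: hC; exact: vol_gt0.
Qed.

(** Induction with the test power l - 1 = n + 1. Coalescence produces M X (l - 1 - alpha) times M X
    (1 + beta), and M X (l - 1 + beta) times M X (1 - alpha). One factor of each product is bounded
    by the induction and [M_one_sub_alpha]; the other has order below l because beta < 1, so it is
    at most a small multiple of M X l plus a multiple of the mass. *)
Lemma M_nat n : exists C : R, forall X : scheme, M X n.+1%:R <= C.
Proof.
have /andP[b0 b1] := beta01.
have a0 := alpha_gt0.
elim: n => [|n [C hC]]; first by exists v0 => X; rewrite M1.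
have [A hA] := M_one_sub_alpha.
have [D D0 hD] := @expD_sub_le R n.
pose l : R := n.+2%:R; have lE : l = n%:R + 2 by rewrite /l -addn2 natrD.
have n0 : 0 <= n%:R :> R by [].
pose k : R := (l - 1) * expR (1 - l).
have l1 : 1 < l by rewrite lE; lra.
have k0 : 0 < k by rewrite mulr_gt0 ?expR_gt0// subr_gt0.
have [A' A'0 hA'] : exists2 A' : R, 0 <= A' & forall X, M X (1 - alpha) <= A'.
  by exists `|A| => // X; apply: le_trans (hA X) (ler_norm _).
have [C' C'0 hC'] : exists2 C' : R, 0 <= C' & forall X, M X (l - 1 - alpha) <= C'.
  exists (A' + `|C|) => [|X]; first by rewrite addr_ge0.
  apply: le_trans (@M_le_add X (1 - alpha) _ n.+1%:R _) _.
    by rewrite lE -[n.+1%:R]natr1; apply/andP; split; lra.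
  by rewrite lerD// (le_trans (hC X))// ler_norm.
pose Q := 2 * kappa * K0 * D * (A' + C').
have Q0 : 0 <= Q by rewrite !mulr_ge0 ?addr_ge0// ltW.
(* Small enough for the two interpolated factors together to cost at most half of the damping k. *)
pose e := k / 4 / (Q + 1).
have e0 : 0 < e by rewrite !divr_gt0// ltr_wpDl.
have [G G0 hG] : exists2 G : R, 0 < G & forall X, M X (1 + beta) <= e * M X l + G * M X 1.
  by apply: M_interp => //; rewrite lE; apply/andP; split; lra.
have [H H0 hH] : exists2 H : R, 0 < H & forall X, M X (l - 1 + beta) <= e * M X l + H * M X 1.
  by apply: M_interp => //; rewrite lE; apply/andP; split; lra.
exists ((k * v0 + Q * (G + H) * v0) / (k / 2)) => X.
rewrite -/l ler_pdivlMr ?divr_gt0//.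
have Ml0 := M_ge0 X l.
have coag : EE (fun s s' : st X => ker s s' *
      (vol s * vol (coalesce s s') `^ (l - 1) - vol s `^ l)) <=
    D * (2 * K0 * (M X (l - 1 - alpha) * M X (1 + beta) +
       M X (l - 1 + beta) * M X (1 - alpha))).
  have pm (s : st X) (x y : R) : vol s `^ x * vol s `^ y = vol s `^ (x + y).
    by rewrite -powRD//; apply/implyP => _; rewrite gt_eqF// vol_gt0.
  have p1 (s : st X) : vol s = vol s `^ 1 by rewrite powRr1// ltW// vol_gt0.
  pose f1 (s : st X) := vol s `^ (l - 1); pose f2 (s : st X) := vol s `^ 1.
  have f10 s : 0 <= f1 s by exact: powR_ge0.
  have f20 s : 0 <= f2 s by exact: powR_ge0.
  have B1 := ker_bound_prod f10 f20.
  have B2 := ker_bound_prod f20 f10.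
  have Ef f x y : f = (fun s : st X => vol s `^ x) ->
      E (fun s => f s * vol s `^ y) = M X (x + y).
    by move=> ->; apply: eq_bigr => s _; rewrite pm.
  rewrite !(Ef f1 (l - 1))// !(Ef f2 1)// in B1 B2.
  apply: le_trans (_ : _ <= D * (EE (fun s s' : st X => ker s s' * (f1 s * f2 s')) +
      EE (fun s s' : st X => ker s s' * (f2 s * f1 s')))) _; last first.
    rewrite ler_wpM2l ?(ltW D0)//; apply: le_trans (lerD B1 B2) _.
    rewrite -mulrDr -subr_ge0 le_eqVlt; apply/orP; left; apply/eqP.
    move: (M X (1 + - alpha)) (M X (l - 1 + - alpha)) => ? ?; ring.
  rewrite -EED -EEZ; apply: EE_le => s s'.
  rewrite -mulrDr mulrCA ler_wpM2l ?ker_ge0//.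
  have vs := vol_gt0 s; have vs' := vol_gt0 s'.
  have ln1 : l - 1 = n.+1%:R by rewrite lE -[n.+1%:R]natr1; lra.
  have vm := vol_gt0 (coalesce s s').
  rewrite /f1 /f2 !powRr1 ?(ltW vs) ?(ltW vs')// -(volX s l) ln1.
  rewrite !powR_mulrn ?(ltW vs) ?(ltW vs') ?(ltW vm)//.
  have h := hD _ _ (ltW vs) (ltW vs').
  have m : vol (coalesce s s') ^+ n.+1 <= (vol s + vol s') ^+ n.+1.
    apply: lerXn2r; last exact: vol_coalesce_le.
      by rewrite nnegrE ltW// vol_gt0.
    by rewrite nnegrE addr_ge0 ?(ltW vs) ?(ltW vs').
  have -> : D * (vol s ^+ n.+1 * vol s' + vol s * vol s' ^+ n.+1) =
     vol s * (D * (vol s ^+ n * vol s' + vol s' ^+ n.+1)) by rewrite (exprS (vol s)); ring.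
  by rewrite -mulrBr ler_wpM2l ?(ltW vs)//; lra.
have := balance_vol X l; have := shrink_gt1 X l1.
rewrite -/k; set T1 := E _; set T2 := EE _ in coag *.
have : kappa * T2 <= Q * ((e * M X l + G * v0) + (e * M X l + H * v0)).
  apply: le_trans (ler_wpM2l (ltW kappa_gt0) coag) _.
  have := hG X; have := hH X; rewrite M1 => hH' hG'.
  have := M_ge0 X (1 + beta); have := M_ge0 X (l - 1 + beta).
  have := hA' X; have := hC' X; have := M_ge0 X (1 - alpha).
  have := M_ge0 X (l - 1 - alpha) => a1 a2 a3 a4 a5 a6.
  have step : M X (l - 1 - alpha) * M X (1 + beta) + M X (l - 1 + beta) * M X (1 - alpha)
     <= (A' + C') * ((e * M X l + G * v0) + (e * M X l + H * v0)) by nra.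
  have -> : Q * (e * M X l + G * v0 + (e * M X l + H * v0)) = kappa * (D * (2 * K0 *
     ((A' + C') * ((e * M X l + G * v0) + (e * M X l + H * v0))))) by rewrite /Q; ring.
  apply: ler_wpM2l; first exact: ltW.
  apply: ler_wpM2l; first exact: ltW.
  by apply: ler_wpM2l => //; apply: mulr_ge0 => //; exact: ltW.
have Qe : Q * (2 * e) <= k / 2.
  rewrite /e; have -> : Q * (2 * (k / 4 / (Q + 1))) = k / 2 * (Q / (Q + 1)).
    by field; rewrite gt_eqF// ltr_wpDl.
  rewrite ler_piMr ?divr_ge0 ?(ltW k0)// ler_pdivrMr ?ltr_wpDl//; lra.
by nra.
Qed.

(** At most a quarter of the mass lies below d, by the bound on M X (1 - alpha), and at most a
    quarter above L, by the bound on the second moment; in between, v <= L^(1 - beta) v^beta. *)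
Lemma large_mass : exists d b : R, [/\ 0 < d <= 1, 0 < b & forall X : scheme,
  b <= E (fun s : st X => if d < vol s then vol s `^ beta else 0)].
Proof.
have /andP[b0 b1] := beta01; have a0 := alpha_gt0; have v00 := v0_gt0.
have [A hA] := M_one_sub_alpha; have [B hB] := M_nat 1.
pose e := v0 / 4 / (`|A| + 1).
have e0 : 0 < e by rewrite !divr_gt0// ltr_wpDl.
pose d := Num.min 1 (e `^ alpha^-1).
have d0 : 0 < d by rewrite lt_min ltr01 powR_gt0.
have de : d `^ alpha <= e.
  have -> : e = (e `^ alpha^-1) `^ alpha.
    by rewrite -powRrM mulVf ?gt_eqF// powRr1// ltW.
  apply: ge0_ler_powR; rewrite ?nnegrE ?(ltW a0) ?(ltW d0) ?powR_ge0//.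
  by rewrite /d ge_min lexx orbT.
pose L := 1 + 4 * (`|B| + 1) / v0.
have L0 : 0 < L by rewrite ltr_wpDr// divr_ge0 ?mulr_ge0 ?addr_ge0// ltW.
exists d, (v0 / 2 / L `^ (1 - beta)); split.
- by rewrite d0 ge_min lexx.
- by rewrite !divr_gt0// powR_gt0.
move=> X; rewrite ler_pdivrMr ?powR_gt0//.
set f := fun s : st X => _.
have : M X 1 <= e * M X (1 - alpha) + (L `^ (1 - beta) * E f + L^-1 * M X 2%:R).
  rewrite /M -!EZ -!ED; apply: E_le => s; have vs := vol_gt0 s.
  have p2 : 0 <= L^-1 * vol s `^ 2%:R by rewrite mulr_ge0 ?invr_ge0 ?(ltW L0) ?powR_ge0.
  have f0 : 0 <= L `^ (1 - beta) * f s.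
    by rewrite mulr_ge0 ?powR_ge0// /f; case: ifP => // _; exact: powR_ge0.
  have p1 : 0 <= e * vol s `^ (1 - alpha) by rewrite mulr_ge0 ?powR_ge0// ltW.
  have [vd|dv] := leP (vol s) d.
    apply: ler_wpDr; first exact: addr_ge0.
    have -> : vol s `^ 1 = vol s `^ alpha * vol s `^ (1 - alpha).
      by rewrite -powRD; [congr (_ `^ _); lra|apply/implyP => _; rewrite gt_eqF].
    apply: ler_wpM2r; first exact: powR_ge0.
    apply: le_trans de; apply: ge0_ler_powR; rewrite ?nnegrE ?(ltW a0) ?(ltW d0) ?(ltW vs)//.
  apply: ler_wpDl => //; have [vL|Lv] := leP (vol s) L.
    apply: ler_wpDr => //; rewrite /f dv.
    have -> : vol s `^ 1 = vol s `^ (1 - beta) * vol s `^ beta.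
      by rewrite -powRD; [congr (_ `^ _); lra|apply/implyP => _; rewrite gt_eqF].
    apply: ler_wpM2r; first exact: powR_ge0.
    by apply: ge0_ler_powR; rewrite ?nnegrE ?(ltW L0) ?(ltW vs)//; lra.
  apply: ler_wpDl => //; rewrite powRr1 ?(ltW vs)// powR_mulrn ?(ltW vs)//.
  by rewrite ler_pdivlMl// expr2 ler_wpM2r ?(ltW vs)// ltW.
rewrite M1; have := hA X; have := hB X; have := M_ge0 X (1 - alpha).
have h1 : e * M X (1 - alpha) <= v0 / 4.
  rewrite /e -mulrA ler_piMr ?divr_ge0 ?(ltW v00)//.
  rewrite ler_pdivrMl ?ltr_wpDl// mulr1 (le_trans (hA X))//.
  by rewrite (le_trans (ler_norm _))// lerDl.
have h2 : L^-1 * M X 2%:R <= v0 / 4.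
  rewrite ler_pdivrMl//; apply: le_trans (hB X) _; apply: le_trans (ler_norm _) _.
  have -> : L * (v0 / 4) = v0 / 4 + (`|B| + 1) by rewrite /L; field; rewrite gt_eqF.
  by rewrite addrA addrAC -[leLHS]add0r lerD ?addr_ge0 ?divr_ge0 ?(ltW v00)// lerDl.
rewrite mulrC; lra.
Qed.

(** A particle of volume at most d <= 1 forms a small pair with every particle larger than d. The
    sum over such pairs factorises, and its second factor is bounded below by [large_mass], so
    dividing by it bounds the part of the moment carried by small volumes. *)
Lemma M_step l : l < 1 -> (exists C : R, forall X : scheme, M X l <= C) ->
  exists C : R, forall X : scheme, M X (l - alpha) <= C.
Proof.
move=> l1 [A hA]; have a0 := alpha_gt0.
have [d [b [/andP[d0 d1] b0 hb]]] := large_mass.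
have [C C0 hC] := small_pairs l1.
exists (C * A / b + d `^ (l - alpha - 1) * v0) => X.
pose f (s : st X) := if vol s <= d then vol s `^ (l - alpha) else 0.
have f0 s : 0 <= f s by rewrite /f; case: ifP => // _; exact: powR_ge0.
apply: le_trans (_ : _ <= E f + d `^ (l - alpha - 1) * v0) _.
  rewrite -(M1 X) -EZ -ED; apply: E_le => s; rewrite /f; have vs := vol_gt0 s.
  have [vd|dv] := leP (vol s) d.
    by rewrite lerDl mulr_ge0// powR_ge0.
  rewrite add0r -{1}[l - alpha](subrK 1) powRD; last by apply/implyP => _; rewrite gt_eqF.
  apply: ler_wpM2r; first exact: powR_ge0.
  rewrite !powRE// ler_expR; apply: ler_wnM2l; first lra.
  by rewrite ler_ln ?posrE// ltW.
rewrite lerD2r ler_pdivlMr//.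
set g := (fun s : st X => if d < vol s then vol s `^ beta else 0) in hb *.
apply: le_trans (ler_wpM2l (E_ge0 f0) (hb X)) _; rewrite -EEM.
apply: le_trans (ler_wpM2l (ltW C0) (hA X)); apply: le_trans (hC X).
apply: EE_le => s s'; rewrite /f.
have [vd|dv] := leP (vol s) d; last first.
  by rewrite mul0r; case: ifP => // _; rewrite mulr_ge0// powR_ge0.
have [vd'|dv'] := leP (vol s') d.
  by rewrite mulr0; case: ifP => // _; rewrite mulr_ge0// powR_ge0.
by rewrite (ltW (le_lt_trans vd dv')) (le_trans vd d1).
Qed.

(** From 1 - alpha, [M_step] goes down by alpha at each turn; any real exponent lies between one of
    these and an integer. *)
Lemma M_bounded l : exists C : R, forall X : scheme, M X l <= C.
Proof.
have a0 := alpha_gt0.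
have neg k : exists C : R, forall X : scheme, M X (1 - k.+1%:R * alpha) <= C.
  elim: k => [|k [C hC]]; first by rewrite mul1r; exact: M_one_sub_alpha.
  have [||D hD] := @M_step (1 - k.+1%:R * alpha); [|by exists C|].
    by rewrite ltrBlDr ltrDl mulr_gt0.
  by exists D => X; rewrite -[k.+2%:R]natr1 mulrDl mul1r opprD addrA.
pose k := Num.truncn (`|1 - l| / alpha); pose n := Num.truncn `|l|.
have [A hA] := neg k; have [B hB] := M_nat n.
exists (A + B) => X; apply: le_trans (lerD (hA X) (hB X)).
apply: M_le_add; apply/andP; split.
  have := truncnS_gt (`|1 - l| / alpha); rewrite -/k ltr_pdivrMr//.
  by have := ler_norm (1 - l); lra.
by have := truncnS_gt `|l|; rewrite -/n; have := ler_norm l; lra.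
Qed.

Definition MA (X : scheme) (q s : R) := E (fun z : st X => area z `^ q * vol z `^ s).

Lemma MA_ge0 X q s : 0 <= MA X q s.
Proof. by apply: E_ge0 => z; rewrite mulr_ge0// powR_ge0. Qed.

(** The remainder in Young's inequality is a power of v alone, already bounded; the powers s and t
    of v are therefore arbitrary. *)
Lemma MA_absorb q Q s t e : 0 < e -> 0 <= q < Q ->
  exists2 C : R, 0 <= C & forall X : scheme, MA X q s <= e * MA X Q t + C.
Proof.
move=> e0 qQ; have [C [s' [C0 h]]] := young_weighted s t e0 qQ.
have [D hD] := M_bounded s'; exists (C * `|D|); first by rewrite mulr_ge0// ltW.
move=> X; apply: le_trans (_ : _ <= e * MA X Q t + C * M X s') _.
  by rewrite /MA /M -!EZ -ED; apply: E_le => z; apply: h; [exact: area_gt0|exact: vol_gt0].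
by rewrite lerD2l ler_wpM2l ?(ltW C0)// (le_trans (hD X))// ler_norm.
Qed.

(** Shrinking does not increase the area, so its term has a sign and is dropped; the loss by fusion
    is then at most the gain by coalescence. *)
Lemma fusion_balance (X : scheme) n :
  E (fun s : st X => vol s * (rate s * area s ^+ n.+1)) <=
  E (fun s : st X => vol s * (rate s * (c * vol s `^ (2 / 3) * area s ^+ n))) +
  EE (fun s s' : st X => vol s * (ker s s' * (area (coalesce s s') ^+ n.+1 - area s ^+ n.+1))).
Proof.
have := balanceE (fun s : st X => area s ^+ n.+1).
set T1 := E _; set T2 := E _; set T3 := EE _ => h.
have T10 : T1 <= 0.
  rewrite -oppr_ge0 /T1 -mulN1r -EZ; apply: E_ge0 => s.
  rewrite mulN1r oppr_ge0 mulr_ge0_le0 ?(ltW (vol_gt0 _))//.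
  rewrite mulr_ge0_le0 ?(le_trans ler01 (speed_ge1 X))// subr_le0.
  apply: lerXn2r; rewrite ?nnegrE ?(ltW (area_gt0 _))//; exact: area_shrink.
have T2le : T2 <= E (fun s : st X => vol s * (rate s * (c * vol s `^ (2 / 3) * area s ^+ n))) -
    E (fun s : st X => vol s * (rate s * area s ^+ n.+1)).
  rewrite -EB; apply: E_le => s; rewrite -mulrBr ler_wpM2l ?(ltW (vol_gt0 _))//.
  apply: le_trans (area_fuse s n) _; rewrite exprS le_eqVlt; apply/orP; left; apply/eqP; ring.
have k0 := kappa_gt0.
have : 0 <= T2 + T3 by rewrite -(pmulr_rge0 _ k0); lra.
by lra.
Qed.

Lemma coalesce_area_le (X : scheme) n D : 0 < D ->
  (forall x y : R, 0 <= x -> 0 <= y ->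
     (x + y) ^+ n.+1 - x ^+ n.+1 <= D * (x ^+ n * y + y ^+ n.+1)) ->
  EE (fun s s' : st X => vol s * (ker s s' * (area (coalesce s s') ^+ n.+1 - area s ^+ n.+1)))
  <= D * K0 * (MA X n%:R (1 - alpha) * MA X 1 beta + MA X n%:R (1 + beta) * MA X 1 (- alpha)
     + (M X (1 - alpha) * MA X n.+1%:R beta + M X (1 + beta) * MA X n.+1%:R (- alpha))).
Proof.
move=> D0 hD.
have pm (s : st X) (y : R) : vol s * vol s `^ y = vol s `^ (1 + y).
  by rewrite -{1}(powRr1 (ltW (vol_gt0 s))) -powRD//; apply/implyP => _; rewrite gt_eqF// vol_gt0.
pose f1 (s : st X) := vol s * area s ^+ n; pose g1 (s : st X) := area s.
pose f2 (s : st X) := vol s; pose g2 (s : st X) := area s ^+ n.+1.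
have v00 s : 0 <= vol (s : st X) by exact/ltW/vol_gt0.
have a00 s : 0 <= area (s : st X) by exact/ltW/area_gt0.
have f10 s : 0 <= f1 s by rewrite mulr_ge0 ?exprn_ge0.
have g20 s : 0 <= g2 s by rewrite exprn_ge0.
have B1 := ker_bound_prod f10 (a00 : forall s, 0 <= g1 s).
have B2 := ker_bound_prod (v00 : forall s, 0 <= f2 s) g20.
have e1 y : E (fun s => f1 s * vol s `^ y) = MA X n%:R (1 + y).
  by apply: eq_bigr => s _; rewrite powR_mulrn// -pm /f1; ring.
have e2 y : E (fun s => g1 s * vol s `^ y) = MA X 1 y.
  by apply: eq_bigr => s _; rewrite powRr1.
have e3 y : E (fun s => f2 s * vol s `^ y) = M X (1 + y).
  by apply: eq_bigr => s _; rewrite pm.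
have e4 y : E (fun s => g2 s * vol s `^ y) = MA X n.+1%:R y.
  by apply: eq_bigr => s _; rewrite powR_mulrn.
rewrite !e1 !e2 in B1; rewrite !e3 !e4 in B2.
apply: le_trans (_ : _ <= D * (EE (fun s s' : st X => ker s s' * (f1 s * g1 s')) +
      EE (fun s s' : st X => ker s s' * (f2 s * g2 s')))) _; last first.
  by rewrite -mulrA ler_wpM2l ?(ltW D0)// mulrDr lerD.
rewrite -EED -EEZ; apply: EE_le => s s'.
rewrite -mulrDr mulrCA [leRHS]mulrCA ler_wpM2l ?ker_ge0//.
have m : area (coalesce s s') ^+ n.+1 <= (area s + area s') ^+ n.+1.
  by apply: lerXn2r; rewrite ?nnegrE ?addr_ge0 ?area_coalesce.
have -> : D * (f1 s * g1 s' + f2 s * g2 s') =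
  vol s * (D * (area s ^+ n * area s' + area s' ^+ n.+1)) by rewrite /f1 /f2 /g1 /g2; ring.
by rewrite ler_wpM2l//; have := hD _ _ (a00 s) (a00 s'); lra.
Qed.

(** Tested with area^(n + 1), fusion supplies the moment of order Q = n + 1 + mu in a, strictly
    above every power of a on the other side since mu > 0. In each product coming from coalescence
    one factor is bounded, by induction or by [M_bounded], and the other is absorbed. *)
Lemma MA_bounded n s : exists2 C : R, 0 <= C & forall X : scheme, MA X n%:R s <= C.
Proof.
have m0 := mu_gt0; have c00 := c_gt0.
elim: n s => [|n IH] s.
  have [C hC] := M_bounded s; exists `|C| => // X.
  apply: le_trans (_ : M X s <= _); last by apply: le_trans (hC X) (ler_norm _).
  by apply: E_le => z; rewrite powRr0 mul1r.
have Mb l : exists2 C : R, 0 <= C & forall X : scheme, M X l <= C.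
  by have [C hC] := M_bounded l; exists `|C| => // X; apply: le_trans (hC X) (ler_norm _).
have [c1 c10 hc1] := IH (1 - alpha); have [c2 c20 hc2] := IH (1 + beta).
have [c3 c30 hc3] := Mb (1 - alpha); have [c4 c40 hc4] := Mb (1 + beta).
have [D D0 hD] := @expD_sub_le R n.
pose W := c * R1 + D * K0 * (c1 + c2 + c3 + c4).
have DK : 0 < D * K0 by rewrite mulr_gt0.
have W0 : 0 <= W.
  by rewrite addr_ge0 ?mulr_ge0 ?addr_ge0 ?(ltW DK) ?(ltW c00) ?(ltW R1_gt0) ?(ltW K0_gt0) ?(ltW D0).
pose Q := n.+1%:R + mu.
have n0 : 0 <= n%:R :> R by [].
have nE : n.+1%:R = n%:R + 1 :> R by rewrite natr1.
(* The absorbed terms have total coefficient at most W, so they use at most half of the fusion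
   term. *)
pose e := R0 / 2 / (W + 1).
have e0 : 0 < e by rewrite !divr_gt0// ltr_wpDl.
have absorb q y : 0 <= q < Q -> exists2 C : R, 0 <= C & forall X : scheme,
  MA X q y <= e * MA X Q (1 + sigma) + C by exact: MA_absorb.
have [|C1 C10 h1] := absorb 1 beta; first by rewrite /Q nE; apply/andP; split; lra.
have [|C2 C20 h2] := absorb 1 (- alpha); first by rewrite /Q nE; apply/andP; split; lra.
have [|C3 C30 h3] := absorb n.+1%:R beta; first by rewrite /Q nE; apply/andP; split; lra.
have [|C4 C40 h4] := absorb n.+1%:R (- alpha); first by rewrite /Q nE; apply/andP; split; lra.
(* The exponent 5/3 is 1, from the factor [vol], plus 2/3, from the area of the sphere. *)
have [|C5 C50 h5] := absorb (n%:R + mu) (sigma + 5 / 3).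
  by rewrite /Q nE; apply/andP; split; lra.
pose V := W * (C1 + C2 + C3 + C4 + C5).
have key X : MA X Q (1 + sigma) <= V / (R0 / 2).
  have h := fusion_balance X n; have h' := coalesce_area_le X D0 hD.
  have lo : R0 * MA X Q (1 + sigma) <= E (fun s : st X => vol s * (rate s * area s ^+ n.+1)).
    rewrite -EZ; apply: E_le => z; have /andP[r1 _] := rate_bounds z.
    have vz := vol_gt0 z; have az := area_gt0 z.
    have -> : R0 * (area z `^ Q * vol z `^ (1 + sigma)) =
       vol z * ((R0 * area z `^ mu * vol z `^ sigma) * area z ^+ n.+1).
      rewrite /Q !powRD; try by apply/implyP => _; rewrite gt_eqF.
      by rewrite powR_mulrn ?(ltW az)// powRr1 ?(ltW vz)//; ring.
    by rewrite ler_wpM2l ?(ltW vz)// ler_wpM2r// exprn_ge0// ltW.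
  have hi : E (fun s : st X => vol s * (rate s * (c * vol s `^ (2 / 3) * area s ^+ n)))
      <= c * R1 * MA X (n%:R + mu) (sigma + 5 / 3).
    rewrite -EZ; apply: E_le => z; have /andP[_ r1] := rate_bounds z.
    have vz := vol_gt0 z; have az := area_gt0 z.
    have -> : c * R1 * (area z `^ (n%:R + mu) * vol z `^ (sigma + 5 / 3)) =
       vol z * ((R1 * area z `^ mu * vol z `^ sigma) * (c * vol z `^ (2 / 3) * area z ^+ n)).
      have -> : sigma + 5 / 3 = sigma + (2 / 3 + 1) by lra.
      rewrite !powRD; try by apply/implyP => _; rewrite gt_eqF.
      by rewrite powR_mulrn ?(ltW az)// powRr1 ?(ltW vz)//; ring.
    rewrite ler_wpM2l ?(ltW vz)// ler_wpM2r// mulr_ge0 ?exprn_ge0 ?(ltW az)//.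
    by rewrite mulr_ge0 ?powR_ge0// ltW.
  set Z := MA X Q (1 + sigma) in lo h1 h2 h3 h4 h5 *.
  have Z0 : 0 <= Z by exact: MA_ge0.
  have mprod (x y x' y' : R) : 0 <= x -> 0 <= y -> x <= x' -> y <= y' -> x * y <= x' * y'.
    by move=> *; apply: ler_pM.
  have eZ (C : R) : 0 <= C -> 0 <= e * Z + C by move=> ?; rewrite addr_ge0// mulr_ge0// ltW.
  have t1 := mprod _ _ _ _ (MA_ge0 X _ _) (MA_ge0 X _ _) (hc1 X) (h1 X).
  have t2 := mprod _ _ _ _ (MA_ge0 X _ _) (MA_ge0 X _ _) (hc2 X) (h2 X).
  have t3 := mprod _ _ _ _ (M_ge0 X _) (MA_ge0 X _ _) (hc3 X) (h3 X).
  have t4 := mprod _ _ _ _ (M_ge0 X _) (MA_ge0 X _ _) (hc4 X) (h4 X).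
  have t5 : c * R1 * MA X (n%:R + mu) (sigma + 5 / 3) <= c * R1 * (e * Z + C5).
    by rewrite ler_wpM2l// mulr_ge0 ?(ltW c00) ?(ltW R1_gt0).
  have t6 := ler_wpM2l (ltW DK) (lerD (lerD t1 t2) (lerD t3 t4)).
  have t7 : R0 * Z <= c * R1 * (e * Z + C5) + D * K0 * (c1 * (e * Z + C1) +
      c2 * (e * Z + C2) + (c3 * (e * Z + C3) + c4 * (e * Z + C4))).
    exact: le_trans lo (le_trans h (lerD (le_trans hi t5) (le_trans h' t6))).
  have cR : 0 <= c * R1 by rewrite mulr_ge0 ?(ltW c00) ?(ltW R1_gt0).
  have t8 : R0 * Z <= W * (e * Z) + V.
    apply: le_trans t7 _; rewrite /V /W.
    move: (D * K0) (c * R1) (ltW DK) cR => x y x0 y0.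
    rewrite -subr_ge0.
    set rhs := (X in 0 <= X).
    have -> : rhs = y * (C1 + C2 + C3 + C4) + x * (c1 * (C2 + C3 + C4 + C5) +
      c2 * (C1 + C3 + C4 + C5) + c3 * (C1 + C2 + C4 + C5) + c4 * (C1 + C2 + C3 + C5)).
      by rewrite /rhs; ring.
    by rewrite !(addr_ge0, mulr_ge0).
  have We : W * (e * Z) <= R0 / 2 * Z.
    have W1 : 0 < W + 1 by rewrite ltr_wpDl.
    have -> : W * (e * Z) = R0 / 2 * Z * (W / (W + 1)) by rewrite /e; field; rewrite gt_eqF.
    rewrite ler_piMr ?mulr_ge0 ?divr_ge0 ?(ltW R0_gt0)//.
    by rewrite ler_pdivrMr// mul1r lerDl.
  by rewrite ler_pdivlMr ?divr_gt0//; lra.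
have [|C6 C60 h6] := absorb n.+1%:R s; first by rewrite /Q nE; apply/andP; split; lra.
have V0 : 0 <= V.
  by apply: mulr_ge0 => //; do 4 (apply: addr_ge0 => //).
exists (e * (V / (R0 / 2)) + C6) => [|X].
  by rewrite addr_ge0// mulr_ge0 ?(ltW e0)// divr_ge0// divr_ge0// ltW.
by apply: le_trans (h6 X) _; rewrite lerD2r ler_wpM2l// ltW.
Qed.

Lemma moment_bound n k : exists2 C : R, 0 <= C & forall X : scheme, MA X n k <= C.
Proof.
have c00 := c_gt0; have [n0|n0] := leP 0 n.
  have [A A0 hA] := MA_bounded 0 k; have [B B0 hB] := MA_bounded (Num.truncn n).+1 k.
  exists (A + B) => [|X]; first exact: addr_ge0.
  apply: le_trans (lerD (hA X) (hB X)); rewrite /MA -ED; apply: E_le => z.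
  rewrite -mulrDl; apply: ler_wpM2r; first exact: powR_ge0.
  apply: powR_le_add; first exact: area_gt0.
  by rewrite n0 ltW// truncnS_gt.
have [C C0 hC] := MA_bounded 0 (2 / 3 * n + k).
exists (c `^ n * C) => [|X]; first by rewrite mulr_ge0 ?powR_ge0.
apply: le_trans (ler_wpM2l (powR_ge0 _ _) (hC X)); rewrite /MA -EZ; apply: E_le => z.
have vz := vol_gt0 z; have az := area_gt0 z.
rewrite powRr0 mul1r powRD; last by apply/implyP => _; rewrite gt_eqF.
rewrite mulrA; apply: ler_wpM2r; first exact: powR_ge0.
rewrite powRrM -powRM ?(ltW c00) ?powR_ge0//.
have cv : 0 < c * vol z `^ (2 / 3) by rewrite mulr_gt0 ?powR_gt0.
move: cv (area_ge z); move: (c * _) => y y0 ya.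
rewrite !powRE// ler_expR; apply: ler_wnM2l; first exact: ltW.
by rewrite ler_ln ?posrE.
Qed.

End moments.

(** * Discretization of the equation *)

Section round_down.
Context {R : realType} (N : nat) (e : 'I_N.+1 -> R).

Definition round_down (u : R) : 'I_N.+1 := [arg max_(i > ord0 | e i <= u) (i : nat)].

Lemma round_downP u : e ord0 <= u ->
  e (round_down u) <= u /\ forall i, e i <= u -> (i <= round_down u)%N.
Proof. by move=> e0; rewrite /round_down; case: arg_maxnP. Qed.

Lemma round_down_next u (f : nat -> R) : e ord0 <= u -> (forall i : 'I_N.+1, e i = f i) ->
  round_down u = N :> nat \/ u < f (round_down u).+1.
Proof.
move=> e0 ef; have [_ h] := round_downP e0.
have [iN|] := ltnP (round_down u) N; last first.
  by left; apply/eqP; rewrite eqn_leq -ltnS ltn_ord.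
right; rewrite ltNge; apply/negP => le; have iN' : ((round_down u).+1 < N.+1)%N by [].
by have := h (Ordinal iN'); rewrite ef /= ltnn => /(_ le).
Qed.

End round_down.

(** Applied with p = 2/3: the constraint a >= c v^(2/3) is stable under addition of particles, so a
    merged particle has an aspect at least c. *)
Lemma powR_subadd (R : realType) (x y p : R) : 0 < x -> 0 < y -> p <= 1 ->
  (x + y) `^ p <= x `^ p + y `^ p.
Proof.
move=> x0 y0 p1; have s0 : 0 < x + y by exact: addr_gt0.
have E (z : R) : 0 < z -> z `^ p = z * z `^ (p - 1).
  move=> z0; rewrite -{2}(powRr1 (ltW z0)) -powRD; last by apply/implyP => _; rewrite gt_eqF.
  by rewrite addrC subrK.
have le (z : R) : 0 < z -> z <= x + y -> (x + y) `^ (p - 1) <= z `^ (p - 1).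
  move=> z0 zs; rewrite !powRE// ler_expR; apply: ler_wnM2l; first by rewrite subr_le0.
  by rewrite ler_ln ?posrE.
rewrite !E// mulrDl lerD// ler_wpM2l ?(ltW x0) ?(ltW y0)//; apply: le => //.
  by rewrite lerDl ltW.
by rewrite lerDr ltW.
Qed.

(** The jumps by D and F are linear in p; multiplying them by the total mass 1 makes them quadratic.
    The three jumps then form one tensor, nonnegative off the diagonal and summing to zero over the
    target state, as [quadratic_zero] requires. *)
Lemma tensor_balance (R : realType) (S : finType) (s0 : S) (d f : S -> R) (k : S -> S -> R)
    (D F : S -> S) (T : S -> S -> S) :
  (forall s, 0 <= d s) -> (forall s, 0 <= f s) -> (forall s s', 0 <= k s s') ->
  exists p : S -> R, [/\ forall s, 0 <= p s, \sum_s p s = 1 &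
    forall psi : S -> R,
      \sum_s p s * (d s * (psi (D s) - psi s)) +
      \sum_s p s * (f s * (psi (F s) - psi s)) +
      \sum_s \sum_s' p s * p s' * (k s s' * (psi (T s s') - psi s)) = 0].
Proof.
move=> d0 f0 k0.
pose ind (t u : S) : R := (t == u)%:R.
pose c s s' t := d s * (ind t (D s) - ind t s) + f s * (ind t (F s) - ind t s)
  + k s s' * (ind t (T s s') - ind t s).
have indE (psi : S -> R) u : \sum_t psi t * ind t u = psi u.
  rewrite (bigD1 u)//= /ind eqxx mulr1 big1 ?addr0// => t tu.
  by rewrite (negbTE tu) mulr0.
have cE psi s s' : \sum_t psi t * c s s' t = d s * (psi (D s) - psi s) +
    f s * (psi (F s) - psi s) + k s s' * (psi (T s s') - psi s).
  rewrite -(indE psi (D s)) -(indE psi (F s)) -(indE psi (T s s')) -(indE psi s).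
  rewrite /c -!sumrB !mulr_sumr -!big_split/=.
  by apply: eq_bigr => t _; ring.
have [||p [p0 p1 pc]] := @quadratic_zero R S s0 c.
- move=> s s'; have := cE (fun=> 1) s s'.
  by under eq_bigr do rewrite mul1r; move=> ->; rewrite !subrr !mulr0 !addr0.
- move=> s s' t ts; rewrite /c /ind (negbTE ts) !subr0.
  by rewrite !addr_ge0 ?mulr_ge0.
exists p; split=> // psi.
have : \sum_t psi t * (\sum_s \sum_s' p s * p s' * c s s' t) = 0.
  by apply: big1 => t _; rewrite pc mulr0.
under eq_bigr do rewrite mulr_sumr; rewrite exchange_big/=.
under eq_bigr do (under eq_bigr do rewrite mulr_sumr); rewrite /=.
under eq_bigr do rewrite exchange_big/=.
move=> h; rewrite -[RHS]h -!big_split/=; apply: eq_bigr => s _.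
have -> (z : R) : p s * z = \sum_s' p s * p s' * z.
  by rewrite -mulr_suml -mulr_sumr p1 mulr1.
have -> (z : R) : p s * z = \sum_s' p s * p s' * z.
  by rewrite -mulr_suml -mulr_sumr p1 mulr1.
rewrite -!big_split/=; apply: eq_bigr => s' _.
under eq_bigr do rewrite mulrCA; rewrite -mulr_sumr cE; ring.
Qed.

Section discretization.
Context {R : realType}.
Variables (alpha beta mu sigma kappa v0 K0 K1 R0 R1 c : R).
Variables (K : (R * R) * (R * R) -> R) (r : R * R -> R).
Local Notation scheme := (scheme alpha beta mu sigma kappa v0 K0 K1 R0 R1 c).

Definition pt (X : scheme) (s : st X) : R * R := (area s, vol s).

Definition aspect (x : R * R) : R := x.1 / x.2 `^ (2 / 3).

(* The parameter m is the inverse mesh of a grid with volumes exp(i / m) in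
   [exp(- m), exp m] and aspects c + j / m in [c, c + m]; the exceptional
   alternatives in the clauses below are the effect of the boundary of the grid. *)
Record refined (m : R) (X : scheme) : Prop := Refined {
  refined_speed : speed X = m;
  refined_ker : forall s s' : st X, ker s s' = K (pt s, pt s');
  refined_shrink : forall s : st X,
    pt (shrink s) = (expR (- (2 / 3) * m^-1) * area s, expR (- m^-1) * vol s) \/
    shrink s = s /\ vol s <= expR (- m);
  refined_frate : forall s : st X, frate s = r (pt s) * (aspect (pt s) - c) * m;
  refined_fuse : forall s : st X,
    pt (fuse s) = (area s - vol s `^ (2 / 3) / m, vol s) \/ aspect (pt s) = c;
  refined_coalesceC : forall s s' : st X, coalesce s s' = coalesce s' s;
  refined_vol_coalesce : forall s s' : st X, vol (coalesce s s') = expR m \/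
    vol s + vol s' < expR m^-1 * vol (coalesce s s');
  refined_aspect_coalesce_le : forall s s' : st X,
    aspect (pt (coalesce s s')) <= aspect (pt s + pt s');
  refined_aspect_coalesce : forall s s' : st X, aspect (pt (coalesce s s')) = c + m \/
    aspect (pt s + pt s') < aspect (pt (coalesce s s')) + m^-1
}.

Hypotheses (kappa_gt0 : 0 < kappa) (v0_gt0 : 0 < v0) (c_gt0 : 0 < c)
  (K1_gt0 : 0 < K1) (R0_gt0 : 0 < R0)
  (K_bounds : forall a v a' v' : R, 0 < a -> 0 < v -> 0 < a' -> 0 < v' ->
     K1 * (v `^ (- alpha) * v' `^ beta + v' `^ (- alpha) * v `^ beta)
       <= K ((a, v), (a', v'))
       <= K0 * (v `^ (- alpha) * v' `^ beta + v' `^ (- alpha) * v `^ beta))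
  (r_bounds : forall a v : R, 0 < a -> 0 < v ->
     R0 * a `^ mu * v `^ sigma <= r (a, v) <= R1 * a `^ mu * v `^ sigma).

Lemma refined_scheme_exists (n : nat) : (4 <= n)%N -> exists X, refined n%:R X.
Proof.
move=> n4; pose m : R := n%:R.
have m4 : 4 <= m by rewrite /m ler_nat.
have m0 : 0 < m by lra.
pose N := (2 * n ^ 2)%N; pose J := (n ^ 2)%N.
pose fv (i : nat) : R := expR ((i%:R - m ^+ 2) / m).
pose fx (j : nat) : R := c + j%:R / m.
pose ev (i : 'I_N.+1) := fv i; pose ex (j : 'I_J.+1) := fx j.
pose S : finType := ('I_N.+1 * 'I_J.+1)%type.
pose v (s : S) := ev s.1; pose x (s : S) := ex s.2; pose a s := x s * v s `^ (2 / 3).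
have fvS i : fv i.+1 = expR m^-1 * fv i.
  by rewrite /fv -expRD -[i.+1%:R]natr1; congr expR; field; rewrite gt_eqF.
have fxS j : fx j.+1 = fx j + m^-1.
  by rewrite /fx -[j.+1%:R]natr1; field; rewrite gt_eqF.
have fv0 : fv 0 = expR (- m) by rewrite /fv; congr expR; field; rewrite gt_eqF.
have fvN : fv N = expR m.
  by rewrite /fv /N natrM natrX -/m; congr expR; field; rewrite gt_eqF.
have fxJ : fx J = c + m by rewrite /fx /J natrX -/m; field; rewrite gt_eqF.
have v_gt0 s : 0 < v s by exact: expR_gt0.
have x_ge s : c <= x s by rewrite lerDl divr_ge0// ltW.
have x_gt0 s : 0 < x s by exact: lt_le_trans (x_ge s).
have y_gt0 s : 0 < v s `^ (2 / 3) by rewrite powR_gt0.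
have a_gt0 s : 0 < a s by exact: mulr_gt0.
have shp s : aspect (a s, v s) = x s by rewrite /aspect /a /= mulfK// gt_eqF.
pose D (s : S) : S := (inord s.1.-1, s.2).
pose F (s : S) : S := (s.1, inord s.2.-1).
(* Rounding down makes sense: a merged particle lies above the lowest volume and, by subadditivity
   of v^(2/3), above the lowest aspect. *)
have shift s s' : ev ord0 <= v s + v s' /\ ex ord0 <= aspect (a s + a s', v s + v s').
  split.
    apply: (@le_trans _ _ (v s)); last by rewrite lerDl ltW.
    by rewrite ler_expR ler_pM2r ?invr_gt0// lerD2r ler_nat.
  rewrite /ex /fx mul0r addr0 /aspect/= ler_pdivlMr ?powR_gt0 ?addr_gt0//.
  have : (v s + v s') `^ (2 / 3) <= v s `^ (2 / 3) + v s' `^ (2 / 3).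
    by apply: powR_subadd => //; lra.
  have h1 := ler_wpM2r (ltW (y_gt0 s)) (x_ge s).
  have h2 := ler_wpM2r (ltW (y_gt0 s')) (x_ge s').
  by move/(ler_wpM2l (ltW c_gt0))/le_trans; apply; rewrite mulrDr; exact: lerD h1 h2.
pose T (s s' : S) : S := (round_down ev (v s + v s'),
  round_down ex (aspect (a s + a s', v s + v s'))).
have Tv s s' : v s <= v (T s s') /\ v (T s s') <= v s + v s'.
  have [h _] := shift s s'; have [h1 h2] := round_downP h; split => //.
  have : (s.1 <= (T s s').1)%N by apply: h2; rewrite lerDl ltW.
  by move=> h3; rewrite ler_expR ler_pM2r ?invr_gt0// lerD2r ler_nat.
have Tv2 s s' : v (T s s') = expR m \/ v s + v s' < expR m^-1 * v (T s s').
  have [h _] := shift s s'; have [e|e] := round_down_next (f := fv) h (fun=> erefl).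
    by left; rewrite -fvN -e.
  by right; rewrite -fvS.
have Tx s s' : x (T s s') <= aspect (a s + a s', v s + v s').
  by have [_ h] := shift s s'; have [] := round_downP h.
have Tx2 s s' : x (T s s') = c + m \/ aspect (a s + a s', v s + v s') < x (T s s') + m^-1.
  have [_ h] := shift s s'; have [e|e] := round_down_next (f := fx) h (fun=> erefl).
    by left; rewrite -fxJ -e.
  by right; rewrite -fxS.
have Ta s s' : a (T s s') <= a s + a s'.
  have s0 : 0 < v s + v s' by rewrite addr_gt0.
  have -> : a s + a s' = aspect (a s + a s', v s + v s') * (v s + v s') `^ (2 / 3).
    by rewrite /aspect /= divfK// gt_eqF// powR_gt0.
  apply: ler_pM; rewrite ?(ltW (x_gt0 _)) ?powR_ge0//.
  apply: ge0_ler_powR; rewrite ?nnegrE ?(ltW s0) ?(ltW (v_gt0 _))//.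
  by have [] := Tv s s'.
have TC s s' : T s s' = T s' s.
  have vC : v s + v s' = v s' + v s := addrC _ _.
  have aC : a s + a s' = a s' + a s := addrC _ _.
  by rewrite /T vC aC.
(* As m >= 4, rounding keeps a fraction at least exp(- 1/m) >= 3/4 of v + v' >= 2 v; at the top of
   the grid, exp m is larger than 3/2. *)
have TV32 s s' : v s <= v s' -> v s <= 1 -> 3 / 2 * v s <= v (T s s').
  move=> vv v1; have [->|] := Tv2 s s'.
    have := expR_ge1Dx m; lra.
  rewrite -ltr_pdivrMl ?expR_gt0// -expRN => h.
  have := expR_ge1Dx (- m^-1); have : m^-1 <= 4^-1 by rewrite lef_pV2 ?posrE.
  have := v_gt0 s; have := v_gt0 s'; nra.
have Dcase s : (a (D s) = expR (- (2 / 3) * m^-1) * a s /\ v (D s) = expR (- m^-1) * v s) \/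
    (D s = s /\ v s <= expR (- m)).
  case: s => i j; have [i0|i0] := posnP i.
    right; split; last by rewrite -fv0 /v /ev i0.
    by congr pair; apply: val_inj; rewrite /= inordK i0.
  left; have e : v (D (i, j)) = expR (- m^-1) * v (i, j).
    rewrite /v /D /ev /= inordK; last by rewrite (leq_ltn_trans (leq_pred _)).
    by rewrite -{2}(prednK i0) fvS mulrA -expRD addNr expR0 mul1r.
  split=> //; rewrite /a e powRM ?expR_ge0 ?(ltW (v_gt0 _))// -expRM.
  rewrite /x /D /=; have -> : - m^-1 * (2 / 3) = - (2 / 3) * m^-1 by ring.
  by rewrite mulrCA.
have Fcase s : (a (F s) = a s - v s `^ (2 / 3) / m /\ m^-1 <= x s) \/ (F s = s /\ x s = c).
  case: s => i j; have [j0|j0] := posnP j.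
    right; split; last by rewrite /x /ex /fx j0 mul0r addr0.
    by congr pair; apply: val_inj; rewrite /= inordK j0.
  left; have e : x (F (i, j)) + m^-1 = x (i, j).
    rewrite /x /F /ex /= inordK; last by rewrite (leq_ltn_trans (leq_pred _)).
    by rewrite -fxS prednK.
  split; last by rewrite -e lerDr ltW.
  by rewrite /a -e; have -> : v (F (i, j)) = v (i, j) by []; ring.
have vF s : v (F s) = v s by [].
pose P s : R * R := (a s, v s).
have r_ge0 s : 0 <= r (P s).
  have /andP[h _] := r_bounds (a_gt0 s) (v_gt0 s); apply: le_trans h.
  by rewrite !mulr_ge0 ?powR_ge0// ltW.
have K_ge0 s s' : 0 <= K (P s, P s').
  have /andP[h _] := K_bounds (a_gt0 s) (v_gt0 s) (a_gt0 s') (v_gt0 s').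
  by apply: le_trans h; rewrite mulr_ge0 ?addr_ge0 ?mulr_ge0 ?powR_ge0// ltW.
pose fr s := r (P s) * (aspect (P s) - c) * m.
have fr_ge0 s : 0 <= fr s.
  by rewrite !mulr_ge0 ?(ltW m0)// shp subr_ge0.
(* Here p is the distribution of volume; the factor [v0] over the volume of the partner converts it
   back to a number of particles. *)
have [|||p [p0 p1 pb]] := @tensor_balance R S (ord0, ord0) (fun=> m)
  (fun s => kappa * fr s) (fun s s' => kappa * v0 * (K (P s, P s') / v s')) D F T.
- by move=> _; exact: ltW.
- by move=> s; rewrite mulr_ge0// ltW.
- by move=> s s'; rewrite mulr_ge0 ?divr_ge0 ?mulr_ge0 ?(ltW (v_gt0 _))// ltW.
pose w s := v0 * p s / v s.
have wv s : w s * v s = v0 * p s by rewrite divfK// gt_eqF.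
have w0 s : 0 <= w s by rewrite divr_ge0 ?mulr_ge0// ltW.
have aD s : a (D s) <= a s.
  have [[-> _]|[-> _]//] := Dcase s; rewrite ler_piMl ?(ltW (a_gt0 _))//.
  by rewrite expR_le1 mulNr oppr_le0 mulr_ge0// invr_ge0 ltW.
have vD s : v (D s) = expR (- m^-1) * v s \/ v (D s) = v s /\ v s <= 1.
  have [[_ ->]|[-> h]] := Dcase s; [by left|right; split=> //].
  by apply: le_trans h _; rewrite expR_le1 oppr_le0 ltW.
(* One factor suffices: (z - 1/m)^(k+1) <= z^k (z - 1/m), valid because z >= 1/m, shows that a step
   1/m taken at a rate proportional to m loses at least a multiple of z^k independent of m. *)
have aF s k : fr s * (a (F s) ^+ k.+1 - a s ^+ k.+1) <=
    - (r (P s) * (a s - c * v s `^ (2 / 3)) * a s ^+ k).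
  have [[-> xm]|[-> xc]] := Fcase s; last first.
    rewrite subrr mulr0 oppr_ge0 /a xc subrr mulr0 mul0r lexx//.
  rewrite /fr shp /a; set y := v s `^ (2 / 3); set z := x s in xm *.
  have y0 : 0 < y by exact: y_gt0.
  have zc : 0 <= z - c by rewrite subr_ge0 x_ge.
  have -> : z * y - y / m = (z - m^-1) * y by ring.
  have le : (z - m^-1) ^+ k.+1 <= z ^+ k * (z - m^-1).
    rewrite exprSr; apply: ler_wpM2r; first by rewrite subr_ge0.
    apply: lerXn2r; rewrite ?nnegrE ?subr_ge0 ?(ltW (x_gt0 _))//.
    by rewrite lerBlDr lerDl invr_ge0 ltW.
  have -> : - (r (P s) * (z * y - c * y) * (z * y) ^+ k) =
     r (P s) * (z - c) * m * (y ^+ k.+1 * (z ^+ k * (z - m^-1) - z ^+ k.+1)).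
    by rewrite exprMn exprS [z ^+ k.+1]exprSr; field; rewrite gt_eqF.
  apply: ler_wpM2l; first by rewrite !mulr_ge0 ?(ltW m0).
  rewrite !exprMn -mulrBl mulrC; apply: ler_wpM2l; first by rewrite exprn_ge0// ltW.
  by rewrite lerD2r.
have m1 : 1 <= m by lra.
have a_ge s : c * v s `^ (2 / 3) <= a s.
  by rewrite ler_wpM2r ?(ltW (y_gt0 _))// x_ge.
have msum : \sum_s w s * v s = v0.
  by under eq_bigr do rewrite wv; rewrite -mulr_sumr p1 mulr1.
have bal psi : \sum_s w s * (v s * (m * (psi (D s) - psi s)))
    + kappa * (\sum_s w s * (v s * (fr s * (psi (F s) - psi s))))
    + kappa * (\sum_s \sum_s' w s * w s' *
        (v s * (K (P s, P s') * (psi (T s s') - psi s)))) = 0.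
  rewrite -[RHS](mulr0 v0) -[in RHS](pb psi) !mulrDr; congr (_ + _ + _).
  - by rewrite mulr_sumr; apply: eq_bigr => s _; rewrite mulrA wv; ring.
  - rewrite !mulr_sumr; apply: eq_bigr => s _.
    by rewrite [w s * _]mulrA wv; ring.
  - rewrite !mulr_sumr; apply: eq_bigr => s _; rewrite !mulr_sumr; apply: eq_bigr => s' _.
    have -> : w s * w s' * (v s * (K (P s, P s') * (psi (T s s') - psi s))) =
      w s * v s * (w s' * (K (P s, P s') * (psi (T s s') - psi s))) by ring.
    by rewrite wv /w; field; rewrite gt_eqF.
pose X := @Scheme R alpha beta mu sigma kappa v0 K0 K1 R0 R1 c S w v a
  (fun s s' => K (P s, P s')) (fun s => r (P s)) fr D F T m w0 v_gt0 a_gt0 a_ge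
  (fun s s' => K_bounds (a_gt0 s) (v_gt0 s) (a_gt0 s') (v_gt0 s'))
  (fun s => r_bounds (a_gt0 s) (v_gt0 s)) m1 vD aD vF aF
  (fun s s' => proj1 (Tv s s')) (fun s s' => proj2 (Tv s s')) TV32 Ta msum bal.
exists X; split => //.
- move=> s; have [[e1 e2]|[e1 e2]] := Dcase s; [left|by right].
  by rewrite /pt /= e1 e2.
- move=> s; have [[e1 _]|[_ e2]] := Fcase s; [left|right].
    by rewrite /pt /= e1.
  by rewrite /pt /= shp.
- by move=> s s'; rewrite /pt /= shp; exact: Tx.
- by move=> s s'; rewrite /pt /= shp; exact: Tx2.
Qed.

End discretization.

(** * Vague limits of measures on the quadrant *)

Lemma segment_unif_continuous (R : realType) (f : R -> R) (a b e : R) :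
  continuous f -> 0 < e -> exists2 d : R, 0 < d &
  forall x y, a <= x <= b -> a <= y <= b -> `|x - y| <= d -> `|f x - f y| <= e.
Proof.
move=> cf e0; apply: contrapT => H.
have bad n : exists p : R * R, [/\ a <= p.1 <= b, a <= p.2 <= b,
    `|p.1 - p.2| <= 1 / n.+1%:R & e < `|f p.1 - f p.2|].
  apply: contrapT => H'; apply: H; exists (1 / n.+1%:R) => // x y xab yab xy.
  by rewrite leNgt; apply/negP => h; apply: H'; exists (x, y).
have /choice[p hp] := bad; have [U [UU UN]] := free_ultrafilter.
have [|x xab xl] := @ultra_bounded_cvg R _ U (fun n => (p n).1) a b UU.
  by move=> n; have [] := hp n.
have [|y yab yl] := @ultra_bounded_cvg R _ U (fun n => (p n).2) a b UU.
  by move=> n; have [] := hp n.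
have xy : x - y = 0.
  apply: (@cvgr_uniq _ _ U _ (fun n => (p n).1 - (p n).2)); first exact: cvgB.
  apply/cvgr0Pnorm_le => d d0.
  have /cvgr0Pnorm_le/(_ d d0) := @near0_div_nat R U (@ultra_proper _ _ UU) 1 UN.
  apply: filterS => n /=; apply: le_trans; have [_ _ h _] := hp n.
  by rewrite (le_trans h)// ler_norm.
have : (fun n => `|f (p n).1 - f (p n).2|) @ U --> (0 : R).
  have -> : (0 : R) = `|f x - f y| by rewrite (subr0_eq xy) subrr normr0.
  apply: cvg_norm; apply: cvgB; apply: continuous_cvg => //; exact: cf.
move=> lim0; have : e <= 0; last by rewrite leNgt e0.
apply: (cvg_ge_near lim0); apply: filterS filterT => n _ /=.
by have [_ _ _ /ltW] := hp n.
Qed.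

(** Serves for discrete sums and for Stieltjes integrals alike: I is the integral up to a point and
    G the distribution function. *)
Lemma riemann_step (R : realType) (I f G : R -> R) (c : nat -> R) (e : R) k :
  I (c 0%N) = 0 ->
  (forall i, (i < k)%N -> `|I (c i.+1) - I (c i) - f (c i.+1) * (G (c i.+1) - G (c i))|
       <= e * (G (c i.+1) - G (c i))) ->
  `|I (c k) - \sum_(0 <= i < k) f (c i.+1) * (G (c i.+1) - G (c i))| <= e * (G (c k) - G (c 0%N)).
Proof.
move=> I0; elim: k => [_|k IH h].
  by rewrite big_geq// I0 subrr normr0 subrr mulr0.
rewrite big_nat_recr//=.
have -> (x y z : R) : I (c k.+1) - (x + y * z) =
    (I (c k) - x) + (I (c k.+1) - I (c k) - y * z) by ring.
apply: le_trans (ler_normD _ _) _.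
have -> : G (c k.+1) - G (c 0%N) = (G (c k) - G (c 0%N)) + (G (c k.+1) - G (c k)) by ring.
rewrite [leRHS]mulrDr lerD//; last exact: h.
by apply: IH => i ik; apply: h; rewrite (ltn_trans ik).
Qed.

(** Summation by parts: the boundary terms vanish because G and H agree at both ends, and G - H,
    which lies between 0 and an increment of H, is paired with the small increments of f. *)
Lemma abel_bound (R : realType) (f G H : R -> R) (c : nat -> R) (e : R) k :
  0 <= e -> (forall i, (i < k)%N -> `|f (c i.+1) - f (c i)| <= e) ->
  (forall i, (i < k)%N -> H (c i) <= G (c i) <= H (c i.+1)) ->
  G (c 0%N) = H (c 0%N) -> G (c k) = H (c k) -> 
  `|\sum_(0 <= i < k) f (c i.+1) * (G (c i.+1) - G (c i)) -
    \sum_(0 <= i < k) f (c i.+1) * (H (c i.+1) - H (c i))| <= e * (H (c k) - H (c 0%N)).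
Proof.
move=> e0 fe HG GH0 GHk.
have key j : (j <= k)%N -> `|\sum_(0 <= i < j) f (c i.+1) * (G (c i.+1) - G (c i)) -
    \sum_(0 <= i < j) f (c i.+1) * (H (c i.+1) - H (c i)) - f (c j) * (G (c j) - H (c j))|
    <= e * (H (c j) - H (c 0%N)).
  elim: j => [_|j /[swap] jk /(_ (ltnW jk)) IH].
    by rewrite !big_geq// GH0 !subrr !mulr0 !subr0 normr0.
  rewrite !big_nat_recr//=; set A := \sum_(_ <= _ < _) _ in IH *; set B := \sum_(_ <= _ < _) _ in IH *.
  have -> : A + f (c j.+1) * (G (c j.+1) - G (c j)) - (B + f (c j.+1) * (H (c j.+1) - H (c j)))
     - f (c j.+1) * (G (c j.+1) - H (c j.+1)) =
    (A - B - f (c j) * (G (c j) - H (c j))) - (f (c j.+1) - f (c j)) * (G (c j) - H (c j)) by ring.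
  apply: le_trans (ler_normB _ _) _; rewrite normrM.
  have /andP[h1 h2] := HG _ jk; have fj := fe _ jk.
  have -> : H (c j.+1) - H (c 0%N) = (H (c j) - H (c 0%N)) + (H (c j.+1) - H (c j)) by ring.
  rewrite [leRHS]mulrDr lerD//; apply: ler_pM => //.
  by rewrite ger0_norm ?subr_ge0// lerD2r.
by have := key k (leqnn k); rewrite GHk subrr mulr0 subr0.
Qed.

(** * Helly selection on the line *)

Section right_envelope.
Context {R : realType} (F : R -> R).
Hypotheses (F_nd : {homo F : x y / x <= y}) (F_ge0 : forall x, 0 <= F x).

(** The right limit of F, that is, the right-continuous version that a Stieltjes measure
    requires. *)
Definition right_env (u : R) : R := inf [set F z | z in [set z | u < z]].

Let has_inf_env u : has_inf [set F z | z in [set z | u < z]].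
Proof.
split; first by exists (F (u + 1)), (u + 1) => //=; rewrite ltrDl.
by exists 0 => _ [z _ <-].
Qed.

Lemma right_env_ge u : F u <= right_env u.
Proof.
apply: lb_le_inf; first by have [] := has_inf_env u.
by move=> _ [z /= uz <-]; exact/F_nd/ltW.
Qed.

Lemma right_env_le u z : u < z -> right_env u <= F z.
Proof. by move=> uz; apply: ge_inf; [have [] := has_inf_env u|exists z]. Qed.

Lemma right_env_nd : {homo right_env : x y / x <= y}.
Proof.
move=> x y xy; apply: lb_le_inf; first by have [] := has_inf_env y.
by move=> _ [z /= yz <-]; apply: right_env_le; exact: le_lt_trans yz.
Qed.

Lemma right_env_rc : right_continuous right_env.
Proof.
move=> u; apply/cvgrPdist_le => e e0.
have [_ [z /= uz <-] h] := inf_adherent e0 (has_inf_env u).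
have : \forall t \near u^'+, u < t < z.
  near=> t; apply/andP; split; near: t; [exact: nbhs_right_gt|exact: nbhs_right_lt].
apply: filterS => t /andP[ut tz]; rewrite ler0_norm ?subr_le0 ?right_env_nd ?(ltW ut)//.
rewrite opprB lerBlDl; apply: le_trans (right_env_le tz) _; exact: ltW.
Unshelve. all: by end_near. Qed.

End right_envelope.

Definition pushforward_measure d1 d2 (X : measurableType d1) (Y : measurableType d2)
  (R : realType) (m : {measure set X -> \bar R}) (f : X -> Y)
  (mf : measurable_fun setT f) : {measure set Y -> \bar R} :=
  measure_function_pushforward__canonical__measure_function_Measure m mf.

Section stieltjes.
Context {R : realType}.

Let measurable_idR : measurable_fun setT (idfun : measurableTypeR R -> R).
Proof. by move=> _ Y mY; rewrite setTI; exact: mY. Qed.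

Definition stieltjes (G : cumulative R R) : {measure set R -> \bar R} :=
  pushforward_measure (lebesgue_stieltjes_measure G) measurable_idR.

Lemma stieltjes_itv (G : cumulative R R) (a b : R) : a <= b ->
  stieltjes G `]a, b]%classic = (G b - G a)%:E.
Proof.
move=> ab; rewrite /stieltjes /= /pushforward /= /lebesgue_stieltjes_measure /measure_extension preimage_id.
rewrite measurable_mu_extE/=; last exact: is_ocitv.
by rewrite wlength_itv_bnd.
Qed.

Lemma stieltjes_fin (G : cumulative R R) (a b : R) : (stieltjes G `]a, b]%classic < +oo)%E.
Proof.
have [ab|ba] := leP a b; first by rewrite stieltjes_itv// ltry.
by rewrite set_itv_ge ?measure0// bnd_simp -leNgt ltW.
Qed.

Lemma stieltjes_integrable (G : cumulative R R) (f : R -> R) (a b : R) :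
  continuous f -> (stieltjes G).-integrable `]a, b]%classic (EFin \o f).
Proof.
move=> cf; apply: measurable_bounded_integrable => //.
- exact: stieltjes_fin.
- by apply: measurable_funTS; exact: measurable_realfun.continuous_measurable_fun.
- have : compact (f @` `[a, b]%classic).
    apply: continuous_compact; last exact: segment_compact.
    by apply: continuous_subspaceT.
  move/compact_bounded => [M [Mr h]]; exists M; split=> // x Mx y /= yab.
  by apply: h => //; exists y => //; move: yab; rewrite /= !in_itv/= => /andP[/ltW-> ->].
Qed.

Lemma stieltjes_integral_step (G : cumulative R R) (f : R -> R) (a b c e : R) :
  continuous f -> a <= b <= c ->
  (forall x, b <= x <= c -> `|f x - f c| <= e) ->
  `|\int[stieltjes G]_(x in `]a, c]) f x - \int[stieltjes G]_(x in `]a, b]) f x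
    - f c * (G c - G b)| <= e * (G c - G b).
Proof.
move=> cf /andP[ab bc] fe.
have U : (`]a, c] = `]a, b] `|` `]b, c])%classic.
  by rewrite (@itv_bndbnd_setU _ _ _ (BRight b))// bnd_simp.
rewrite U Rintegral_setU//; last first.
- apply/disj_setPS => x [] /=; rewrite !in_itv/= => /andP[_ xb] /andP[bx _].
  by have := lt_le_trans bx xb; rewrite ltxx.
- by rewrite -U; exact: stieltjes_integrable.
rewrite [X in `|X - _ - _|]addrC addrK.
have mE : fine (stieltjes G `]b, c]%classic) = G c - G b by rewrite stieltjes_itv.
rewrite -mE -!Rintegral_cst// -RintegralB//; last 2 first.
- exact: stieltjes_integrable.
- by apply: stieltjes_integrable; exact: cst_continuous.
have fc : continuous (fun x => f x - f c).
  by move=> x; apply: cvgB; [exact: cf|exact: cvg_cst].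
apply: le_trans (le_normr_Rintegral _ _) _ => //; first exact: stieltjes_integrable.
apply: le_Rintegral => //.
- apply: (@stieltjes_integrable G (fun x => `|f x - f c|)) => x.
  by apply: cvg_norm; exact: fc.
- by apply: stieltjes_integrable; exact: cst_continuous.
- by move=> x /=; rewrite in_itv/= => /andP[bx xc]; apply: fe; rewrite (ltW bx).
Qed.

(** The distribution functions [FF m] converge at every point to a nondecreasing F, and G is its
    right-continuous version. On a grid adapted to f, discrete sums and integral are replaced by the
    sums SF and SG; since F and G may differ at jumps, these are compared by summation by parts and
    not term by term. The interval starts at -1 so as to keep an atom at 0. *)
Lemma stieltjes_ultralimit (U : set_system nat) (S : nat -> finType)
  (w t : forall m, S m -> R) (W : R) : UltraFilter U ->
  (forall m s, 0 <= w m s) -> (forall m s, 0 <= t m s <= 1) ->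
  (forall m, \sum_s w m s <= W) ->
  exists2 nu : {measure set R -> \bar R}, (nu `](-1)%R, 1%R]%classic < +oo)%E &
  forall f : R -> R, continuous f ->
    (fun m => \sum_s w m s * f (t m s)) @ U --> \int[nu]_(x in `]-1, 1]) f x.
Proof.
move=> UU w0 t01 wW; pose FF m u := \sum_(s | t m s <= u) w m s.
have FF01 m u : 0 <= FF m u <= W.
  rewrite sumr_ge0//=.
  by apply: le_trans (wW m); rewrite [leRHS](bigID (fun s => t m s <= u))/= lerDl sumr_ge0.
have FFnd m u z : u <= z -> FF m u <= FF m z.
  move=> uz; rewrite /FF [leRHS](bigID (fun s => t m s <= u))/=.
  rewrite [X in _ <= X + _](eq_bigl (fun s => t m s <= u)) => [|s]; first by rewrite lerDl sumr_ge0.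
  by case: (leP (t m s) u) => h; rewrite ?andbF// (le_trans h).
have /choice[F hF] : forall u, exists l : R, 0 <= l <= W /\ (fun m => FF m u) @ U --> l.
  by move=> u; have [l] := ultra_bounded_cvg UU (fun m => FF01 m u); exists l.
have F0 u : 0 <= F u by have [/andP[]] := hF u.
have Fnd : {homo F : u z / u <= z}.
  move=> u z uz; apply: (ler_cvg_to (hF u).2 (hF z).2).
  by apply: filterS filterT => m _; exact: FFnd.
pose G : cumulative R R := HB.pack (right_env F)
  (isCumulative.Build R _ R (right_env F) (right_env_nd F0) (right_env_rc F0)).
have GE u : G u = right_env F u by [].
have FFlo m u : u < 0 -> FF m u = 0.
  move=> u0; apply: big1_seq => s /andP[h _]; have /andP[t0 _] := t01 m s.
  by have := lt_le_trans u0 (le_trans t0 h); rewrite ltxx.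
have FFhi m u : 1 <= u -> FF m u = FF m 1.
  move=> u1; apply: eq_bigl => s; have /andP[_ t1] := t01 m s.
  by rewrite t1 (le_trans t1).
have Flo u : u < 0 -> F u = 0.
  move=> u0; apply: (cvgr_uniq (hF u).2); rewrite (_ : FF ^~ u = fun=> 0).
    exact: cvg_cst.
  by apply/funext => m; exact: FFlo.
have Fhi u : 1 <= u -> F u = F 1.
  move=> u1; apply: (cvgr_uniq (hF u).2); rewrite (_ : FF ^~ u = FF ^~ 1).
    exact: (hF 1).2.
  by apply/funext => m; exact: FFhi.
exists (stieltjes G); first exact: stieltjes_fin.
move=> f cf.
have [a0 a0P] : exists M, forall m, `|\sum_s w m s * f (t m s)| <= M.
  have : compact (f @` `[0, 1]%classic).
    apply: continuous_compact; last exact: segment_compact.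
    by apply: continuous_subspaceT.
  move/compact_bounded => [M [Mr h]]; exists ((`|M| + 1) * `|W|) => m.
  apply: le_trans (ler_norm_sum _ _ _) _.
  apply: le_trans (_ : \sum_s (`|M| + 1) * w m s <= _).
    apply: ler_sum => s _; rewrite normrM ger0_norm// mulrC ler_wpM2r//.
    apply: h; first by rewrite (le_lt_trans (ler_norm M))// ltrDl.
    by exists (t m s) => //=; rewrite in_itv/= t01.
  by rewrite -mulr_sumr ler_wpM2l// (le_trans (wW m))// ler_norm.
have [|l _ ul] := @ultra_bounded_cvg R _ U (fun m => \sum_s w m s * f (t m s)) (- a0) a0 UU.
  by move=> m; rewrite -ler_norml.
suff <- : l = \int[stieltjes G]_(x in `]-1, 1]) f x by [].
have W0 : 0 <= W by have /andP[h /(le_trans h)] := FF01 0%N 0.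
apply/eqP; rewrite -subr_eq0 -normr_le0; apply/ler_addgt0Pr => e e0.
pose e' := e / (3 * (W + 1)).
have e'0 : 0 < e' by rewrite divr_gt0// mulr_gt0// ltr_wpDl.
have [d d0 hd] := @segment_unif_continuous R f (-1) 2 e' cf e'0.
pose k := (Num.truncn (2 / d)).+1.
have kd : 2 / k%:R <= d.
  rewrite ler_pdivrMr ?ltr0n// mulrC -ler_pdivrMr//.
  by rewrite ltW// truncnS_gt.
pose c (i : nat) : R := -1 + i%:R * (2 / k%:R).
have c0 : c 0%N = -1 by rewrite /c mul0r addr0.
have ck : c k = 1 by rewrite /c mulrC divfK ?pnatr_eq0//; ring.
have cS i : c i.+1 = c i + 2 / k%:R by rewrite /c -[i.+1%:R]natr1; ring.
have k0 : 0 < 2 / k%:R :> R by rewrite divr_gt0// ltr0n.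
have cle i : -1 <= c i by rewrite /c lerDl mulr_ge0// ltW.
have cle1 i : (i <= k)%N -> c i <= 1.
  by move=> ik; rewrite -ck /c lerD2l ler_wpM2r ?(ltW k0)// ler_nat.
have fstep i x : (i < k)%N -> c i <= x <= c i.+1 -> `|f x - f (c i.+1)| <= e'.
  move=> ik /andP[x1 x2]; have := cle i; have := cle1 _ ik => h1 h2.
  have := cle i.+1; rewrite cS in x2 h1 *; move=> h3.
  apply: hd; try by apply/andP; split; lra.
  by rewrite ler_norml; apply/andP; split; lra.
pose Sm m := \sum_(0 <= i < k) f (c i.+1) * (FF m (c i.+1) - FF m (c i)).
pose SF := \sum_(0 <= i < k) f (c i.+1) * (F (c i.+1) - F (c i)).
pose SG := \sum_(0 <= i < k) f (c i.+1) * (G (c i.+1) - G (c i)).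
have SmSF : Sm @ U --> SF.
  apply: cvg_sumr => i _; apply: cvgM; first exact: cvg_cst.
  by apply: cvgB; exact: (hF _).2.
have dm m : `|\sum_s w m s * f (t m s) - Sm m| <= e' * W.
  pose I u := \sum_(s | t m s <= u) w m s * f (t m s).
  have -> : \sum_s w m s * f (t m s) = I (c k).
    by rewrite ck /I; apply: eq_bigl => s; have /andP[_ ->] := t01 m s.
  apply: le_trans (_ : _ <= e' * (FF m (c k) - FF m (c 0%N))) _; last first.
    rewrite ler_wpM2l ?(ltW e'0)// c0 (FFlo m (-1)) ?ltrN10// subr0.
    by have /andP[] := FF01 m (c k).
  apply: riemann_step => [|i ik].
    rewrite c0 /I; apply: big1_seq => s /andP[h _]; have /andP[t0 _] := t01 m s.
    by have := le_trans t0 h; rewrite leNgt ltrN10.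
  have cc : c i <= c i.+1 by rewrite cS lerDl ltW.
  have split (g : S m -> R) : \sum_(s | t m s <= c i.+1) g s - \sum_(s | t m s <= c i) g s =
      \sum_(s | (c i < t m s) && (t m s <= c i.+1)) g s.
    rewrite [X in X - _](bigID (fun s : S m => t m s <= c i))/=.
    rewrite [X in X + _ - _](eq_bigl (fun s : S m => t m s <= c i)) => [|s]; last first.
      by case: (leP (t m s) (c i)) => h; rewrite ?andbF// (le_trans h).
    rewrite addrC addKr; apply: eq_bigl => s; by rewrite -ltNge andbC.
  rewrite /I /FF !split mulr_sumr -sumrB.
  apply: le_trans (ler_norm_sum _ _ _) _; rewrite mulr_sumr; apply: ler_sum => s /andP[h1 h2].
  have -> : w m s * f (t m s) - f (c i.+1) * w m s = w m s * (f (t m s) - f (c i.+1)) by ring.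
  rewrite normrM ger0_norm// mulrC ler_wpM2r//; apply: fstep => //.
  by rewrite (ltW h1).
have dG : `|\int[stieltjes G]_(x in `]-1, 1]) f x - SG| <= e' * W.
  pose I u := \int[stieltjes G]_(x in `]-1, u]) f x.
  rewrite -[X in `|X - _|]/(I 1) -{1}ck.
  apply: le_trans (_ : _ <= e' * (G (c k) - G (c 0%N))) _; last first.
    rewrite ler_wpM2l ?(ltW e'0)// c0 ck.
    have h1 : right_env F 1 <= F 1.
      by rewrite -(Fhi 2) ?ler1n//; apply: right_env_le => //; rewrite ltr1n.
    have /andP[_ h2] := (hF 1).1; have h3 := right_env_ge Fnd F0 (-1); have h4 := F0 (-1).
    by rewrite !GE; lra.
  apply: riemann_step => [|i ik].
    by rewrite c0 /I set_itv_ge ?Rintegral_set0// bnd_simp ltxx.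
  apply: stieltjes_integral_step => //; first by rewrite cle cS lerDl ltW.
  by move=> x; exact: fstep.
have dFG : `|SG - SF| <= e' * W.
  apply: le_trans (_ : _ <= e' * (F (c k) - F (c 0%N))) _; last first.
    rewrite ler_wpM2l ?(ltW e'0)// c0 (Flo (-1)) ?subr0 ?ltrN10//.
    by have /andP[] := (hF (c k)).1.
  apply: abel_bound; first exact: ltW.
  - move=> i ik; rewrite distrC; apply: fstep => //.
    by rewrite lexx cS lerDl ltW.
  - move=> i ik; rewrite GE right_env_ge//=; apply: right_env_le => //.
    by rewrite cS ltrDl.
  - rewrite c0 GE; apply/eqP; rewrite eq_le right_env_ge// andbT.
    rewrite (Flo (-1)) ?ltrN10// -(Flo (- 2^-1)) ?oppr_lt0 ?invr_gt0//.
    by apply: right_env_le => //; rewrite ltrN2 invf_lt1// ltr1n.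
  - rewrite ck GE; apply/eqP; rewrite eq_le right_env_ge// andbT.
    by rewrite -(Fhi 2) ?ler1n//; apply: right_env_le => //; rewrite ltr1n.
have dl : `|l - SF| <= e' * W.
  apply: (@cvg_le_near _ U _ (fun m => `|\sum_s w m s * f (t m s) - Sm m|)).
    by apply: cvg_norm; apply: cvgB.
  by apply: filterS filterT => m _; exact: dm.
rewrite add0r; apply: le_trans (_ : _ <= 3 * (e' * W)) _.
  rewrite (_ : l - _ = (l - SF) - (SG - SF) - (\int[stieltjes G]_(x in `]-1, 1]) f x - SG)); last ring.
  apply: le_trans (ler_normB _ _) _; have := ler_normB (l - SF) (SG - SF); lra.
have -> : 3 * (e' * W) = e * (W / (W + 1)).
  by rewrite /e'; field; rewrite gt_eqF// ltr_wpDl.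
by rewrite ler_piMr ?(ltW e0)// ler_pdivrMr ?ltr_wpDl// mul1r lerDl.
Qed.

End stieltjes.

(** * Schoenberg's space-filling curve *)

Section curve.
Context {R : realType}.

(** The truncation of 1/2 - cos(pi t) to [0, 1]: a function of period 2, equal to 0 near even
    integers and to 1 near odd ones. *)
Definition tooth (t : R) : R :=
  (`|2^-1 - cos (pi * t)| - `|2^-1 - cos (pi * t) - 1| + 1) / 2.

Lemma tooth_continuous : continuous tooth.
Proof.
move=> t; have h : (fun t : R => 2^-1 - cos (pi * t)) @ t --> 2^-1 - cos (pi * t).
  apply: cvgB; first exact: cvg_cst.
  apply: continuous_cvg; first exact: continuous_cos.
  by apply: cvgM; [exact: cvg_cst|exact: cvg_id].
apply: cvgM; last exact: cvg_cst.
apply: cvgD; last exact: cvg_cst.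
apply: cvgB; first exact: cvg_norm.
by apply: cvg_norm; apply: cvgB => //; exact: cvg_cst.
Qed.

Lemma tooth01 t : 0 <= tooth t <= 1.
Proof.
rewrite /tooth; move: (2^-1 - _) => y.
have := ler_norm y; have := ler_norm (- y); have := ler_norm (y - 1).
have := ler_normD (y - 1) 1; have := ler_normB y 1; rewrite subrK normrN normr1.
by move=> *; apply/andP; split; lra.
Qed.

(** The angle is below pi / 4, so the cosine of its double is nonnegative and cos^2 >= 1/2. The
    bound 1/7 is the sum of 8^(-k) over k >= 1, the largest tail of a base-8 expansion with digits 0
    and 1. *)
Lemma cos_small (z : R) : 0 <= z <= 7^-1 -> 2^-1 <= cos (pi * z).
Proof.
move=> /andP[z0 z1]; have p0 := pi_gt0 R.
have c0 : 0 <= cos (pi * z) by apply: cos_ge0_pihalf; apply/andP; split; nra.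
have : 0 <= cos (pi * z + pi * z) by apply: cos_ge0_pihalf; apply/andP; split; nra.
by rewrite cosD; have := cos2Dsin2 (pi * z); rewrite !expr2; nra.
Qed.

Lemma tooth_digit (N : nat) (d : bool) (z : R) : 0 <= z <= 7^-1 ->
  tooth ((8 * N + d)%:R + z) = d%:R.
Proof.
move=> /cos_small h.
have E : cos (pi * ((8 * N + d)%:R + z)) = if d then - cos (pi * z) else cos (pi * z).
  have -> : pi * ((8 * N + d)%:R + z) = pi * (d%:R + z) + (pi *+ 2) *+ (4 * N).
    by rewrite -mulrnA -[pi *+ _]mulr_natr (natrD _ (8 * N)) !natrM; ring.
  rewrite (periodicn (@cosD2pi R)); case: d => /=.
    by rewrite mulrDr mulr1 addrC cosDpi.
  by rewrite add0r.
rewrite /tooth E; case: d {E} => /=.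
  by rewrite !ger0_norm; lra.
by rewrite !ler0_norm; lra.
Qed.

(** The term k reads the base-8 digit of t of index 2 k + i as a binary digit; i = 0 and i = 1 give
    the two coordinates. *)
Definition curve_sum (i : nat) (n : nat) (t : R) : R :=
  \sum_(0 <= k < n) 2^-1 ^+ k.+1 * tooth (8 ^+ (2 * k + i).+1 * t).

Lemma curve_sum_continuous i n : continuous (curve_sum i n).
Proof.
move=> t; apply: cvg_sumr => k _; apply: cvgM; first exact: cvg_cst.
apply: continuous_cvg; first exact: tooth_continuous.
by apply: cvgM; [exact: cvg_cst|exact: cvg_id].
Qed.

Lemma curve_sum_tail i n j t :
  0 <= curve_sum i (n + j) t - curve_sum i n t <= 2^-1 ^+ n - 2^-1 ^+ (n + j).
Proof.
elim: j => [|j]; first by rewrite addn0 !subrr lexx.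
rewrite addnS /curve_sum big_nat_recr//= -/(curve_sum i (n + j) t).
have /andP[h1 h2] := tooth01 (8 ^+ (2 * (n + j) + i).+1 * t).
have p0 : 0 < 2^-1 ^+ (n + j) :> R by rewrite exprn_gt0// invr_gt0.
move=> /andP[h3 h4]; rewrite exprS; apply/andP; split; nra.
Qed.

Lemma curve_coordinate i : exists X : R -> R,
  [/\ continuous X, forall t, 0 <= X t <= 1 &
   forall t n, `|X t - curve_sum i n t| <= 2^-1 ^+ n].
Proof.
have [U [UU UN]] := free_ultrafilter.
have b t n : 0 <= curve_sum i n t <= 1.
  have z0 : curve_sum i 0 t = 0 by rewrite /curve_sum big_geq.
  have := curve_sum_tail i 0 n t; rewrite add0n z0 !subr0 expr0.
  move=> /andP[-> h]/=; apply: le_trans h _.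
  by rewrite gerBl exprn_ge0// invr_ge0.
have /choice[X hX] : forall t, exists l : R, 0 <= l <= 1 /\ (fun n => curve_sum i n t) @ U --> l.
  by move=> t; have [l] := ultra_bounded_cvg UU (b t); exists l.
have tail t n : `|X t - curve_sum i n t| <= 2^-1 ^+ n.
  apply: (@cvg_le_near _ U _ (fun m => `|curve_sum i m t - curve_sum i n t|)).
    by apply: cvg_norm; apply: cvgB; [exact: (hX t).2|exact: cvg_cst].
  apply: UN; exists n => // m /= nm; have := curve_sum_tail i n (m - n) t.
  rewrite subnKC// => /andP[h1 h2]; rewrite ger0_norm//; apply: le_trans h2 _.
  by rewrite gerBl exprn_ge0// invr_ge0.
exists X; split => //; last by move=> t; have [] := hX t.
move=> t; apply/cvgrPdist_le => e e0.
have [n ne] : exists n, 2^-1 ^+ n <= e / 4.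
  have : (fun n => geometric (1 : R) 2^-1 n) @ \oo --> (0 : R).
    by apply: cvg_geometric; rewrite ger0_norm ?invr_ge0// invf_lt1// ltr1n.
  have e4 : 0 < e / 4 by rewrite divr_gt0.
  move/cvgr0Pnorm_le => /(_ _ e4)[n _ /(_ n (leqnn n))] /= h; exists n.
  by move: h; rewrite mul1r ger0_norm// exprn_ge0// invr_ge0.
have e2 : 0 < e / 2 by rewrite divr_gt0.
have /cvgrPdist_le/(_ _ e2) := @curve_sum_continuous i n t.
apply: filterS => u h; have := tail t n; have := tail u n.
rewrite (_ : X t - X u = (X t - curve_sum i n t) + (curve_sum i n t - curve_sum i n u)
   - (X u - curve_sum i n u)); last ring.
have := ler_normB ((X t - curve_sum i n t) + (curve_sum i n t - curve_sum i n u))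
  (X u - curve_sum i n u).
have := ler_normD (X t - curve_sum i n t) (curve_sum i n t - curve_sum i n u).
lra.
Qed.

Lemma binary_expansion (s : R) : 0 <= s <= 1 -> exists d : nat -> bool,
  forall n, 0 <= s - \sum_(0 <= k < n) 2^-1 ^+ k.+1 * (d k)%:R <= 2^-1 ^+ n.
Proof.
move=> s01; pose rem := fix rem n := if n is n'.+1 then
  2 * rem n' - (2^-1 <= rem n')%R%:R else s.
exists (fun k => 2^-1 <= rem k) => n.
have r01 k : 0 <= rem k <= 1.
  elim: k => [//|k /andP[h1 h2]] /=.
  by have [h|h] := leP 2^-1 (rem k); apply/andP; split; rewrite /=; lra.
have -> : s - \sum_(0 <= k < n) 2^-1 ^+ k.+1 * (2^-1 <= rem k)%R%:R = 2^-1 ^+ n * rem n.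
  elim: n => [|n IH]; first by rewrite big_geq// expr0 mul1r subr0.
  by rewrite big_nat_recr//= opprD addrA IH exprS; field.
have /andP[h1 h2] := r01 n; have p0 : 0 < 2^-1 ^+ n :> R by rewrite exprn_gt0// invr_gt0.
by apply/andP; split; nra.
Qed.

Lemma octal_number (D : nat -> bool) : exists2 t : R, 0 <= t <= 1 &
  forall k, exists N z, 0 <= z <= 7^-1 /\ 8 ^+ k.+1 * t = (8 * N + D k)%:R + z.
Proof.
pose N := fix N k := if k is k'.+1 then (8 * N k' + D k')%N else 0%N.
pose u k : R := (N k)%:R / 8 ^+ k.
have p0 k : 0 < 8 ^+ k :> R by rewrite exprn_gt0.
have tail n j : 0 <= u (n + j)%N - u n <= (7^-1) / 8 ^+ n - (7^-1) / 8 ^+ (n + j).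
  elim: j => [|j]; first by rewrite addn0 !subrr lexx.
  have -> : u (n + j.+1)%N = u (n + j)%N + (D (n + j)%N)%:R / 8 / 8 ^+ (n + j).
    rewrite addnS /u /= (natrD _ (8 * _)) natrM exprS; field.
    by rewrite gt_eqF.
  rewrite addnS exprS invfM; have : 0 < (8 ^+ (n + j))^-1 :> R by rewrite invr_gt0.
  by case: (D _) => /= h /andP[h1 h2]; apply/andP; split; lra.
have ub k : 0 <= u k <= 1.
  have u0 : u 0%N = 0 by rewrite /u mul0r.
  have := tail 0%N k; rewrite add0n u0 !subr0 expr0 invr1 mulr1 => /andP[-> h]/=.
  have : 0 < (8 ^+ k)^-1 :> R by rewrite invr_gt0.
  by lra.
have [U [UU UN]] := free_ultrafilter.
have [t t01 ut] := ultra_bounded_cvg UU ub.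
exists t => // k; exists (N k), (8 ^+ k.+1 * t - (8 * N k + D k)%:R).
split; last by rewrite addrC subrK.
have uk : u k.+1 * 8 ^+ k.+1 = (8 * N k + D k)%:R by rewrite /u divfK ?gt_eqF.
have h1 : u k.+1 <= t.
  apply: (cvg_ge_near ut); apply: UN; exists k.+1 => // m /= km.
  by have := tail k.+1 (m - k.+1)%N; rewrite subnKC// => /andP[]; rewrite subr_ge0.
have h2 : t <= u k.+1 + 7^-1 / 8 ^+ k.+1.
  apply: (cvg_le_near ut); apply: UN; exists k.+1 => // m /= km.
  have := tail k.+1 (m - k.+1)%N; rewrite subnKC// => /andP[_ h].
  have : 0 < (8 ^+ m)^-1 :> R by rewrite invr_gt0.
  lra.
have := ler_wpM2l (ltW (p0 k.+1)) h1; have := ler_wpM2l (ltW (p0 k.+1)) h2.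
have e1 : 8 ^+ k.+1 * u k.+1 = (8 * N k + D k)%:R by rewrite mulrC.
have e2 : 8 ^+ k.+1 * (7^-1 / 8 ^+ k.+1) = 7^-1 :> R by rewrite mulrC divfK ?gt_eqF.
by rewrite mulrDr e1 e2 => h3 h4; apply/andP; split; lra.
Qed.

(* Schoenberg's space-filling curve: the base-8 digits of the parameter are
   the interleaved binary digits of the two coordinates. *)
Lemma space_filling_curve : exists X Y : R -> R,
  [/\ continuous X /\ continuous Y,
      forall t, 0 <= X t <= 1 /\ 0 <= Y t <= 1 &
      forall x y, 0 <= x <= 1 -> 0 <= y <= 1 ->
        exists2 t, 0 <= t <= 1 & X t = x /\ Y t = y].
Proof.
have [X [cX X01 hX]] := curve_coordinate 0; have [Y [cY Y01 hY]] := curve_coordinate 1.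
exists X, Y; split => // x y /binary_expansion[d hd] /binary_expansion[d' hd'].
pose D k := if odd k then d' k./2 else d k./2.
have [t t01 ht] := octal_number D; exists t => //.
have digit i k : tooth (8 ^+ (2 * k + i).+1 * t) = (D (2 * k + i)%N)%:R.
  by have [N [z [z01 ->]]] := ht (2 * k + i)%N; exact: tooth_digit.
have [U [UU UN]] := free_ultrafilter.
have lim Z i (e : nat -> bool) (w : R) : (forall k, D (2 * k + i)%N = e k) ->
    (forall n, `|Z - curve_sum i n t| <= 2^-1 ^+ n) ->
    (forall n, 0 <= w - \sum_(0 <= k < n) 2^-1 ^+ k.+1 * (e k)%:R <= 2^-1 ^+ n) -> Z = w.
  move=> De hZ hw; have cs n : curve_sum i n t = \sum_(0 <= k < n) 2^-1 ^+ k.+1 * (e k)%:R.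
    by apply: eq_bigr => k _; rewrite digit De.
  have h n : `|Z - w| <= 2 * 2^-1 ^+ n.
    have := hZ n; have /andP[w1 w2] := hw n; rewrite cs !ler_norml => /andP[h1 h2].
    by apply/andP; split; lra.
  apply/eqP; rewrite -subr_eq0 -normr_le0.
  have c : (fun n => geometric (2 : R) 2^-1 n) @ U --> (0 : R).
    have : (fun n => geometric (2 : R) 2^-1 n) @ \oo --> (0 : R).
      by apply: cvg_geometric; rewrite ger0_norm ?invr_ge0// invf_lt1// ltr1n.
    by apply: cvg_trans => A; exact: UN.
  by apply: (cvg_ge_near c); apply: filterS filterT => n _; exact: h.
split; [apply: (lim _ 0%N d) | apply: (lim _ 1%N d')] => //.
- by move=> k; rewrite /D addn0 mul2n odd_double doubleK.
- by move=> k; rewrite /D addn1 mul2n /= odd_double /= uphalf_double.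
Qed.

End curve.

Lemma near0_continuous (R : realType) (T : topologicalType) (f : T -> R) (x : T) :
  (\forall p \near x, f p = 0) -> {for x, continuous f}.
Proof.
move=> n0; have e := nbhs_singleton n0; rewrite /prop_for /continuous_at e.
exact: cvg_near_cst.
Qed.

(** * Borel sets of the plane and vague limits on the quadrant *)

Section plane.
Context {R : realType}.

Lemma open_measurable_plane (O : set (R * R)) : open O -> measurable O.
Proof.
move=> oO; pose box (q : (rat * rat) * (rat * rat)) : set (R * R) :=
  `](ratr q.1.1), (ratr q.1.2)[%classic `*` `](ratr q.2.1), (ratr q.2.2)[%classic.
pose B q := if pselect (box q `<=` O) then box q else set0.
have -> : O = \bigcup_q B q.
  apply/seteqP; split=> [x Ox|x [q _]]; last first.
    by rewrite /B; case: pselect => // h; exact: h.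
  have : nbhs x O by apply: open_nbhs_nbhs; split.
  move=> /nbhs_ballP[e /= e0 he].
  have near (y : R) : exists q q' : rat, [/\ y - e < ratr q, ratr q < y < ratr q' & ratr q' < y + e].
    have [|q] := @rat_in_itvoo R (y - e) y; first by rewrite ltrBlDr ltrDl.
    have [|q'] := @rat_in_itvoo R y (y + e); first by rewrite ltrDl.
    by rewrite !in_itv/= => /andP[h3 h4] /andP[h1 h2]; exists q, q'; rewrite h2 h3.
  have [q1 [q2 [h1 h2 h3]]] := near x.1; have [q3 [q4 [h4 h5 h6]]] := near x.2.
  exists ((q1, q2), (q3, q4)) => //; rewrite /B; case: pselect => [sub|nsub] /=; last (exfalso; apply: nsub).
    by split => /=; rewrite in_itv.
  move=> y [/=]; rewrite !in_itv/= => /andP[a1 a2] /andP[a3 a4]; apply: he.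
  by split; rewrite /ball/= ltr_norml; apply/andP; split; lra.
apply: countable_bigcupT_measurable; first exact: countableP.
move=> q; rewrite /B; case: pselect => [sub|nsub] /=; last exact: measurable0.
by apply: measurableX; exact: measurable_itv.
Qed.

Lemma open_continuous_measurable_plane (D : set (R * R)) (f : R * R -> R) :
  open D -> (forall x, D x -> {for x, continuous f}) -> measurable_fun D f.
Proof.
move=> oD cf mD; apply: (measurability _ (measurable_realfun.RGenOInfty.measurableE R)) => //.
move=> _ [_ [a ->] <-]; apply: open_measurable_plane.
rewrite openE => x [Dx fx]; rewrite /interior.
apply: filterI; first by apply: open_nbhs_nbhs.
by apply: (cf x Dx); apply: open_nbhs_nbhs; split => //; exact: interval_open.
Qed.

Lemma continuous_measurable_plane (f : R * R -> R) :
  continuous f -> measurable_fun setT f.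
Proof. by move=> cf; apply: open_continuous_measurable_plane => [|x _]; [exact: openT|exact: cf]. Qed.

Lemma quadrant_open : open (@quadrant R).
Proof.
rewrite openE => x [x1 x2]; rewrite /interior.
have c1 : (fun y : R * R => y.1) @ x --> x.1 by exact: cvg_fst.
have c2 : (fun y : R * R => y.2) @ x --> x.2 by exact: cvg_snd.
apply: filterI; first by apply: (c1 [set u | 0 < u]); exact: lt_nbhsr.
by apply: (c2 [set u | 0 < u]); exact: lt_nbhsr.
Qed.

Lemma quadrant_measurable : measurable (@quadrant R).
Proof. by apply: open_measurable_plane; exact: quadrant_open. Qed.

Definition box (rho : R) : set (R * R) :=
  [set x | rho^-1 <= x.1 <= rho /\ rho^-1 <= x.2 <= rho].

Definition box_supported (f : R * R -> R) :=
  exists2 rho : R, 0 < rho & forall x, f x != 0 -> box rho x.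

Lemma box_quadrant (rho : R) (x : R * R) : 0 < rho -> box rho x -> quadrant x.
Proof.
by move=> r0 [/andP[h _] /andP[h' _]]; split;
  [apply: lt_le_trans h|apply: lt_le_trans h']; rewrite invr_gt0.
Qed.

Lemma box_compact rho : compact (box rho).
Proof.
have -> : box rho = `[rho^-1, rho]%classic `*` `[rho^-1, rho]%classic.
  by apply/seteqP; split => x /=; rewrite !in_itv.
by apply: compact_setX; exact: segment_compact.
Qed.

Lemma box_supported_bounded (f : R * R -> R) : continuous f -> box_supported f ->
  exists M : R, forall x, `|f x| <= M.
Proof.
move=> cf [rho rho0 frho].
have : compact (f @` box rho).
  by apply: continuous_compact; [exact: continuous_subspaceT|exact: box_compact].
move/compact_bounded => [M [Mr h]]; exists (`|M| + 1) => x.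
have [->|/frho xb] := eqVneq (f x) 0; first by rewrite normr0 addr_ge0.
by apply: h; [rewrite (le_lt_trans (ler_norm M))// ltrDl|exists x].
Qed.

(** The coordinate - ln (1 - X) blows up as X tends to 1, so it is either continuous or outside
    every box nearby; composition with a function supported in a box is continuous in both cases. *)
Let coord_local (X : R -> R) (t : R) : continuous X -> (forall t, 0 <= X t <= 1) ->
  {for t, continuous (fun t => - ln (1 - X t))} \/
  forall rho : R, 0 < rho -> \forall u \near t, ~ (rho^-1 <= - ln (1 - X u) <= rho).
Proof.
move=> cX X01; have [X1|X1] := ltP (X t) 1.
  left; apply: cvgN; apply: continuous_cvg; first by apply: continuous_ln; rewrite subr_gt0.
  by apply: cvgB; [exact: cvg_cst|exact: cX].
have {}X1 : X t = 1 by apply/eqP; rewrite eq_le X1 andbT; have /andP[] := X01 t.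
right=> rho rho0; have : \forall u \near t, 1 - expR (- rho) < X u.
  by apply: (cX t [set y | 1 - expR (- rho) < y]); apply: lt_nbhsr; rewrite X1 gtrBl expR_gt0.
apply: filterS => u; rewrite ltrBlDr -ltrBlDl => h.
have [Xu|Xu] := ltP (X u) 1; last first.
  (* Where X u = 1, the convention [ln 0 = 0] puts the coordinate at 0, again outside every box. *)
  rewrite ln0 ?subr_le0// oppr0 => /andP[h1 _].
  by move: h1; rewrite leNgt invr_gt0 rho0.
move=> /andP[_]; rewrite lerNl -ler_expR lnK ?posrE ?subr_gt0//.
by rewrite leNgt h.
Qed.

(* The quadrant is covered by the curve t |-> (- ln (1 - X t), - ln (1 - Y t)),
   so that the limit measure is the image of a Stieltjes measure on the line. *)
Lemma vague_ultralimit (U : set_system nat) (S : nat -> finType)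
    (w : forall m, S m -> R) (z : forall m, S m -> R * R) (W : R) : UltraFilter U ->
  (forall m s, 0 <= w m s) -> (forall m s, quadrant (z m s)) ->
  (forall m, \sum_s w m s <= W) ->
  exists g : {measure set (R * R)%type -> \bar R},
  [/\ g (~` @quadrant R) = 0%E, (g setT < +oo)%E &
    forall f : R * R -> R, continuous f -> box_supported f ->
      (fun m => \sum_s w m s * f (z m s)) @ U --> \int[g]_(x in @quadrant R) f x].
Proof.
move=> UU w0 zQ wW; have [X [Y [[cX cY] XY01 XYsurj]]] := @space_filling_curve R.
have X01 t : 0 <= X t <= 1 by have [] := XY01 t.
have Y01 t : 0 <= Y t <= 1 by have [] := XY01 t.
pose a t := - ln (1 - X t); pose b t := - ln (1 - Y t).
pose G t : R * R := (a t, b t).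
have mcoord (Z : R -> R) : continuous Z -> measurable_fun setT (fun t => - ln (1 - Z t)).
  move=> cZ; apply: measurableT_comp => //.
  apply: (measurableT_comp (@measurable_realfun.measurable_ln R)).
  apply: measurable_realfun.continuous_measurable_fun => t.
  by apply: cvgB; [exact: cvg_cst|exact: cZ].
have mG : measurable_fun setT G by apply: measurable_fun_pair; exact: mcoord.
have param m s : exists t, 0 <= t <= 1 /\ G t = z m s.
  have [z1 z2] := zQ m s.
  have e01 (y : R) : 0 < y -> 0 <= 1 - expR (- y) <= 1.
    by move=> y0; rewrite subr_ge0 gerBl expR_ge0 expR_le1 oppr_le0 ltW.
  have [t t01 [Xt Yt]] := XYsurj _ _ (e01 _ z1) (e01 _ z2).
  by exists t; split=> //; rewrite /G /a /b Xt Yt !subKr !expRK !opprK -surjective_pairing.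
pose t m s := projT1 (cid (param m s)).
have ht m s : 0 <= t m s <= 1 /\ G (t m s) = z m s := projT2 (cid (param m s)).
have [nu nufin nulim] := stieltjes_ultralimit UU w0 (fun m s => proj1 (ht m s)) wW.
pose I : set R := `]-1, 1]%classic; pose D := G @^-1` @quadrant R.
have mD : measurable D by rewrite -[D]setTI; apply: mG; [exact: measurableT|exact: quadrant_measurable].
have mDI : measurable (D `&` I) by apply: measurableI => //; exact: measurable_itv.
(* Restricting to D drops the parameters sent outside the quadrant, so that the image measure is
   carried by it. *)
pose nu' : {measure set R -> \bar R} := mrestr nu mDI.
exists (pushforward_measure nu' mG); split.
- rewrite /= /pushforward /mrestr [X in nu X](_ : _ = set0) ?measure0//.
  by apply/seteqP; split => // u [/= nq [q _]].
- rewrite /= /pushforward /mrestr preimage_setT setTI.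
  by apply: le_lt_trans nufin; apply: le_measure; rewrite ?inE//; exact: subIsetr.
move=> f cf [rho rho0 frho].
have fG0 u : ~ D u -> f (G u) = 0.
  move=> nD; apply/eqP; apply: contrapT => /negP/frho [/andP[h1 _] /andP[h2 _]].
  by apply: nD; split; [apply: lt_le_trans h1|apply: lt_le_trans h2]; rewrite invr_gt0.
have cfG : continuous (f \o G).
  move=> u; have [ca|na] := coord_local u cX X01; last first.
    apply: near0_continuous; apply: filterS (na _ rho0) => v h.
    by apply/eqP; apply: contrapT => /negP/frho [h' _]; exact: h.
  have [cb|nb] := coord_local u cY Y01; last first.
    apply: near0_continuous; apply: filterS (nb _ rho0) => v h.
    by apply/eqP; apply: contrapT => /negP/frho [_ h']; exact: h.
  have cG : G @ u --> G u by apply: (@cvg_pair _ _ _ _ (nbhs (a u)) (nbhs (b u))); [exact: ca|exact: cb].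
  by apply: continuous_comp; [exact: cG|exact: cf].
have := nulim _ cfG; rewrite (_ : \int[nu]_(x in `]-1, 1]) (f \o G) x =
    \int[pushforward_measure nu' mG]_(x in @quadrant R) f x).
  by under eq_fun do under eq_bigr do rewrite /= (proj2 (ht _ _)).
have [M fM] := box_supported_bounded cf (ex_intro2 _ _ rho rho0 frho).
have mI : measurable I by exact: measurable_itv.
have bnd (A : set R) : [bounded (f \o G) x | x in A].
  by exists M; split; [exact: num_real|move=> x /ltW Mx y _ /=; exact: le_trans Mx].
have intD : nu'.-integrable D (EFin \o (f \o G)).
  apply: measurable_bounded_integrable => //.
    rewrite /nu' /= /mrestr; apply: le_lt_trans nufin; apply: le_measure; rewrite ?inE//.
      by apply: measurableI => //; exact: measurableI.
    by move=> x [_ []].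
  by apply: measurable_funTS; exact: measurable_realfun.continuous_measurable_fun.
have /measurable_EFinP mf := continuous_measurable_plane cf.
rewrite /Rintegral; congr fine.
rewrite (@integral_pushforward _ _ _ _ _ G mG nu' _ _ mf intD quadrant_measurable).
rewrite -/D (@negligible_integral _ _ _ nu' D (~` I))//; last 2 first.
- exact: measurableC.
- by rewrite /nu' /= /mrestr setIC -setIA setICr setI0 measure0.
rewrite setDE setCK [RHS](@eq_measure_integral _ _ _ _ nu); last first.
  by move=> A mA AD; rewrite /nu' /= /mrestr; congr (nu _); exact/setIidPl.
rewrite integral_mkcondl; apply: eq_integral => u _.
rewrite patchE; case: ifPn => //; rewrite notin_setE => nD.
by rewrite /= fG0.
Qed.

End plane.

(** * Passage to the limit in sums over states *)

Section limit.
Context {R : realType}.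
Variables (U : set_system nat) (S : nat -> finType) (w : forall m, S m -> R)
  (z : forall m, S m -> R * R) (W : R) (g : {measure set (R * R)%type -> \bar R}).
Arguments w : clear implicits.
Arguments z : clear implicits.
Hypotheses (UU : UltraFilter U) (UN : \oo `<=` U)
  (w0 : forall m s, 0 <= w m s)
  (wW : forall m, \sum_s w m s <= W) (inhab : forall m, S m)
  (gfin : (g setT < +oo)%E)
  (vague : forall f : R * R -> R, continuous f -> box_supported f ->
      (fun m => \sum_s w m s * f (z m s)) @ U --> \int[g]_(x in @quadrant R) f x).

Local Notation Q := (@quadrant R).

Lemma W_ge0 : 0 <= W.
Proof. by apply: le_trans (wW 0%N); rewrite sumr_ge0. Qed.

Lemma cvgr0_eventually_le (u : nat -> R) :
  (forall e, 0 < e -> U [set m | `|u m| <= e]) -> u @ U --> (0 : R).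
Proof. by move=> h; apply/cvgr0Pnorm_le => e e0; exact: h. Qed.

(* If G_ m and G \o z m did not become uniformly close, states where they differ
   would accumulate in the compact box, against the last hypothesis. *)
Lemma states_limit (G_ : forall m, S m -> R) (G : R * R -> R) (rho : R) :
  0 < rho -> continuous G -> (forall x, G x != 0 -> box rho x) ->
  U [set m | forall s, G_ m s != 0 -> box rho (z m s)] ->
  (forall (s : forall m, S m) l, box rho l -> (fun m => z m (s m)) @ U --> l ->
     (fun m => G_ m (s m)) @ U --> G l) ->
  (fun m => \sum_s w m s * G_ m s) @ U --> \int[g]_(x in Q) G x.
Proof.
move=> rho0 cG Gsupp G_supp cc.
have -> : (fun m => \sum_s w m s * G_ m s) = (fun m => (\sum_s w m s * G_ m s -
    \sum_s w m s * G (z m s)) + \sum_s w m s * G (z m s)).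
  by apply/funext => m; rewrite subrK.
rewrite -[X in _ --> X]add0r; apply: cvgD; last by apply: vague => //; exists rho.
apply: cvgr0_eventually_le => e e0.
have W1 : 0 < W + 1 by rewrite ltr_wpDl// W_ge0.
pose d := e / (W + 1); have d0 : 0 < d by rewrite divr_gt0.
pose A := [set m | exists s, box rho (z m s) /\ d < `|G_ m s - G (z m s)|].
have [UA|UA] := in_ultra_setVsetC A UU; last first.
  apply: filterS2 UA G_supp => m nA supp /=; rewrite -sumrB.
  apply: le_trans (ler_norm_sum _ _ _) _.
  apply: le_trans (_ : \sum_s w m s * d <= _); last first.
    rewrite -mulr_suml; apply: le_trans (ler_wpM2r (ltW d0) (wW m)) _.
    rewrite /d mulrCA ler_piMr ?(ltW e0)// ler_pdivrMr// mul1r.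
    by rewrite lerDl.
  apply: ler_sum => s _; rewrite -mulrBr normrM ger0_norm// ler_wpM2l//.
  have [b|nb] := pselect (box rho (z m s)).
    by rewrite leNgt; apply/negP => h; apply: nA; exists s.
  have -> : G_ m s = 0 by apply/eqP; apply: contrapT => /negP/supp.
  have -> : G (z m s) = 0 by apply/eqP; apply: contrapT => /negP/Gsupp.
  by rewrite subrr normr0 ltW.
exfalso.
pose s m : S m := if pselect (A m) is left h then projT1 (cid h) else inhab m.
have sA m : A m -> box rho (z m (s m)) /\ d < `|G_ m (s m) - G (z m (s m))|.
  by move=> Am; rewrite /s; case: pselect => // h; exact: projT2 (cid h).
have [|l bl zl] := @ultra_compact_cvg (R * R)%type _ U (box rho) (fun m => z m (s m)) UU (@box_compact R rho).
  by apply: filterS UA => m /sA[].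
have h1 := cc s l bl zl.
have h2 : (fun m => G (z m (s m))) @ U --> G l by apply: continuous_cvg => //; exact: cG.
have h3 : (fun m => `|G_ m (s m) - G (z m (s m))|) @ U --> (0 : R).
  have -> : 0 = `|G l - G l| by rewrite subrr normr0.
  by apply: cvg_norm; exact: cvgB.
have : d <= 0 by apply: (cvg_ge_near h3); apply: filterS UA => m /sA[_ /ltW].
by rewrite leNgt d0.
Qed.

Lemma Rintegral_le_mass (f : R * R -> R) (e : R) : continuous f -> box_supported f ->
  (forall x, `|f x| <= e) -> `|\int[g]_(x in Q) f x| <= e * W.
Proof.
move=> cf bf fe; have c := vague cf bf.
apply: (@cvg_le_near _ U _ (fun m => `|\sum_s w m s * f (z m s)|)); first exact: cvg_norm.
apply: filterS filterT => m _ /=; apply: le_trans (ler_norm_sum _ _ _) _.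
apply: le_trans (_ : \sum_s w m s * e <= _).
  by apply: ler_sum => s _; rewrite normrM ger0_norm// ler_wpM2l.
rewrite -mulr_suml mulrC; apply: ler_wpM2l; last exact: wW.
by apply: le_trans (fe (0, 0)).
Qed.

Lemma compact_supp_integrable (f : R * R -> R) : continuous f -> box_supported f ->
  g.-integrable Q (EFin \o f).
Proof.
move=> cf bf; have [M fM] := box_supported_bounded cf bf.
apply: measurable_bounded_integrable.
- exact: quadrant_measurable.
- apply: le_lt_trans gfin; apply: le_measure; rewrite ?inE//.
  exact: quadrant_measurable.
- by apply: measurable_funTS; exact: continuous_measurable_plane.
- by exists M; split; [exact: num_real|move=> x /ltW Mx y _ /=; exact: le_trans Mx].
Qed.

Lemma section_continuous (H : R * R -> R * R -> R) x :
  continuous (fun p : (R * R) * (R * R) => H p.1 p.2) -> continuous (H x).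
Proof.
move=> cH y; apply: (@continuous_comp _ _ _ (fun y => (x, y)) (fun p => H p.1 p.2)).
  by apply: (@cvg_pair _ _ _ (nbhs y) (nbhs x) (nbhs y)); [exact: cvg_cst|exact: cvg_id].
exact: cH.
Qed.

(** By compactness of the box in y, the sections at u converge uniformly to the section at x as u
    tends to x; the integral moves by at most this distance times the mass. *)
Lemma section_integral_continuous (H : R * R -> R * R -> R) (rho : R) : 0 < rho ->
  continuous (fun p : (R * R) * (R * R) => H p.1 p.2) ->
  (forall x y, H x y != 0 -> box rho y) ->
  continuous (fun x => \int[g]_(y in Q) H x y).
Proof.
move=> rho0 cH Hsupp x; apply/cvgrPdist_le => e e0.
have W1 : 0 < W + 1 by rewrite ltr_wpDl// W_ge0.
pose d := e / (W + 1); have d0 : 0 < d by rewrite divr_gt0.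
have bH u : box_supported (H u) by exists rho => // y; exact: Hsupp.
have unif : \forall u \near x, forall y, `|H x y - H u y| <= d.
  apply: contrapT => nn.
  have bad n : exists p : (R * R) * (R * R), [/\ ball x n.+1%:R^-1 p.1 & d < `|H x p.2 - H p.1 p.2|].
    apply: contrapT => h; apply: nn; apply/nbhs_ballP; exists n.+1%:R^-1 => /=.
      by rewrite invr_gt0.
    move=> u xu y; rewrite leNgt; apply/negP => hd; apply: h.
    by exists (u, y).
  have /choice[p hp] := bad.
  have pb n : box rho (p n).2.
    have [_ h] := hp n; have [e1|/Hsupp//] := eqVneq (H x (p n).2) 0.
    have [e2|/Hsupp//] := eqVneq (H (p n).1 (p n).2) 0.
    by move: h; rewrite e1 e2 subrr normr0 ltNge (ltW d0).
  have [|l _ pl] := @ultra_compact_cvg (R * R)%type _ U (box rho) (fun m => (p m).2) UU (@box_compact R rho).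
    by apply: filterS filterT => m _; exact: pb.
  have px : (fun m => (p m).1) @ U --> x.
    apply/cvg_ballP => r r0.
    have /cvgr0Pnorm_lt/(_ r r0) := @near0_div_nat R U (@ultra_proper _ _ UU) 1 UN.
    apply: filterS => n /=; rewrite ger0_norm ?divr_ge0// mul1r => nr.
    by have [b _] := hp n; apply: le_ball b; exact: ltW.
  have h1 : (fun m => H x (p m).2) @ U --> H x l.
    by apply: continuous_cvg => //; exact: section_continuous.
  have h2 : (fun m => H (p m).1 (p m).2) @ U --> H x l.
    apply: (@continuous_cvg _ _ _ U _ (fun m => p m) (fun q : (R * R) * (R * R) => H q.1 q.2) (x, l)).
      exact: cH.
    have -> : (fun m => p m) = (fun m => ((p m).1, (p m).2)).
      by apply/funext => m; rewrite -surjective_pairing.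
    by apply: (@cvg_pair _ _ _ U (nbhs x) (nbhs l)).
  have h3 : (fun m => `|H x (p m).2 - H (p m).1 (p m).2|) @ U --> (0 : R).
    have -> : 0 = `|H x l - H x l| by rewrite subrr normr0.
    by apply: cvg_norm; exact: cvgB.
  have : d <= 0.
    by apply: (cvg_ge_near h3); apply: filterS filterT => m _ /=; have [_ /ltW] := hp m.
  by rewrite leNgt d0.
apply: filterS unif => u hu.
have cHu v := @section_continuous H v cH.
rewrite -RintegralB//; last 3 first.
- exact: quadrant_measurable.
- exact: compact_supp_integrable.
- exact: compact_supp_integrable.
apply: le_trans (@Rintegral_le_mass (fun y => H x y - H u y) d _ _ hu) _.
- by move=> y; apply: cvgB; exact: cHu.
- exists rho => // y; have [->|/Hsupp//] := eqVneq (H x y) 0.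
  by rewrite sub0r oppr_eq0 => /Hsupp.
- by rewrite /d -mulrA ler_piMr ?(ltW e0)// mulrC ler_pdivrMr// mul1r lerDl.
Qed.

(** Two uses of [states_limit]: along any convergent choice of s the inner sum tends to the inner
    integral, which is the hypothesis needed for the outer sum. *)
Lemma states_double_limit (H_ : forall m, S m -> S m -> R) (H : R * R -> R * R -> R) (rho : R) :
  0 < rho -> continuous (fun p : (R * R) * (R * R) => H p.1 p.2) ->
  (forall x y, H x y != 0 -> box rho x /\ box rho y) ->
  U [set m | forall s s', H_ m s s' != 0 -> box rho (z m s) /\ box rho (z m s')] ->
  (forall (s s' : forall m, S m) l l', box rho l -> box rho l' ->
     (fun m => z m (s m)) @ U --> l -> (fun m => z m (s' m)) @ U --> l' ->
     (fun m => H_ m (s m) (s' m)) @ U --> H l l') ->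
  (fun m => \sum_s \sum_s' w m s * w m s' * H_ m s s') @ U -->
    \int[g]_(x in Q) \int[g]_(y in Q) H x y.
Proof.
move=> rho0 cH Hsupp H_supp cc.
have -> : (fun m => \sum_s \sum_s' w m s * w m s' * H_ m s s') =
   (fun m => \sum_s w m s * (\sum_s' w m s' * H_ m s s')).
  apply/funext => m; apply: eq_bigr => s _; rewrite mulr_sumr.
  by apply: eq_bigr => s' _; rewrite mulrA.
apply: (@states_limit (fun m s => \sum_s' w m s' * H_ m s s') _ rho) => //.
- by apply: (@section_integral_continuous H rho) => // x y /Hsupp[].
- move=> x; apply: contra_neqP => nb; rewrite (_ : H x = fun=> 0).
    by rewrite Rintegral_cst ?mul0r//; exact: quadrant_measurable.
  by apply/funext => y; apply/eqP; apply: contrapT => /negP/Hsupp[].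
- apply: filterS H_supp => m supp s; apply: contra_neqP => nb.
  apply: big1 => s' _; rewrite (_ : H_ m s s' = 0) ?mulr0//.
  by apply/eqP; apply: contrapT => /negP/supp[].
- move=> s l bl sl; apply: (@states_limit (fun m s' => H_ m (s m) s') _ rho) => //.
  + exact: section_continuous.
  + by move=> y /Hsupp[].
  + by apply: filterS H_supp => m supp s' /supp[].
  + by move=> s' l' bl' sl'; exact: cc.
Qed.

End limit.

(** * Cutoffs and limits of unbounded integrands *)

Section cutoff.
Context {R : realType}.
Local Notation Q := (@quadrant R).

(* Proper on the quadrant: its sublevel sets are contained in boxes. *)
Definition Lam (x : R * R) : R := x.1 + x.1^-1 + (x.2 + x.2^-1).

Definition clamp (y : R) : R := (`|y| - `|y - 1| + 1) / 2.

(** On the quadrant it is 1 where Lam <= rho and 0 where Lam >= 2 rho. As 1 - chi <= Lam / rho, a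
    cutoff costs a factor [Lam] in a moment and gains 1 / rho. *)
Definition chi (rho : R) (x : R * R) : R :=
  if (0 < x.1) && (0 < x.2) then clamp (2 - Lam x / rho) else 0.

Lemma clamp_cases y : [\/ y <= 0 /\ clamp y = 0, 0 <= y <= 1 /\ clamp y = y |
  1 <= y /\ clamp y = 1].
Proof.
rewrite /clamp; have [y0|/ltW y0] := leP y 0.
  by constructor 1; split => //; rewrite !ler0_norm; lra.
have [y1|/ltW y1] := leP y 1.
  by constructor 2; rewrite y0; split => //; rewrite ger0_norm// ler0_norm; lra.
by constructor 3; split => //; rewrite !ger0_norm; lra.
Qed.

Lemma clamp_le y y' : y <= y' -> clamp y <= clamp y'.
Proof.
by case: (clamp_cases y) => -[h1 ->]; case: (clamp_cases y') => -[h2 ->]; lra.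
Qed.

Lemma Lam_gt0 x : Q x -> 0 < Lam x.
Proof. by case=> x1 x2; rewrite /Lam !addr_gt0// invr_gt0. Qed.

Lemma chi01 rho x : 0 <= chi rho x <= 1.
Proof.
rewrite /chi; case: ifP => _; last by rewrite lexx ler01.
by case: (clamp_cases (2 - Lam x / rho)) => -[h ->]; lra.
Qed.

Lemma chi_le rho rho' x : 0 < rho -> rho <= rho' -> chi rho x <= chi rho' x.
Proof.
move=> r0 rr; rewrite /chi; case: ifP => // /andP[x1 x2].
apply: clamp_le; rewrite lerD2l lerN2 ler_wpM2l ?(ltW (Lam_gt0 _))//.
by rewrite lef_pV2 ?posrE//; exact: lt_le_trans rr.
Qed.

Lemma chi_box rho x : 0 < rho -> chi rho x != 0 -> box (2 * rho) x.
Proof.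
move=> r0; rewrite /chi; case: ifP; last by rewrite eqxx.
move=> /andP[x1 x2]; case: (clamp_cases (2 - Lam x / rho)) => -[h ->] c; first by rewrite eqxx in c.
- have {h c} h : 0 < 2 - Lam x / rho by rewrite lt_neqAle eq_sym c; case/andP: h.
  have Ll : Lam x < 2 * rho by rewrite -ltr_pdivrMr//; lra.
  have i1 : 0 < x.1^-1 by rewrite invr_gt0. have i2 : 0 < x.2^-1 by rewrite invr_gt0.
  rewrite /Lam in Ll; have r2 : 0 < 2 * rho by rewrite mulr_gt0.
  split; apply/andP; split; try lra.
    by rewrite -[leRHS]invrK lef_pV2 ?posrE//; lra.
  by rewrite -[leRHS]invrK lef_pV2 ?posrE//; lra.
- have Ll : Lam x < 2 * rho by rewrite -ltr_pdivrMr//; lra.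
  have i1 : 0 < x.1^-1 by rewrite invr_gt0. have i2 : 0 < x.2^-1 by rewrite invr_gt0.
  rewrite /Lam in Ll; have r2 : 0 < 2 * rho by rewrite mulr_gt0.
  split; apply/andP; split; try lra.
    by rewrite -[leRHS]invrK lef_pV2 ?posrE//; lra.
  by rewrite -[leRHS]invrK lef_pV2 ?posrE//; lra.
Qed.

Lemma chi_tail rho x : 0 < rho -> Q x -> 1 - chi rho x <= Lam x / rho.
Proof.
move=> r0 [x1 x2]; rewrite /chi x1 x2/=.
have : 0 < Lam x / rho by rewrite divr_gt0// Lam_gt0.
by case: (clamp_cases (2 - Lam x / rho)) => -[h ->]; lra.
Qed.

Lemma chi_cvg x : Q x -> (fun n => chi n.+1%:R x) @ \oo --> (1 : R).
Proof.
move=> Qx; apply/cvgrPdist_le => e e0; exists (Num.truncn (Lam x / e)) => // n /= hn.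
have /andP[c0 c1] := chi01 n.+1%:R x; rewrite ger0_norm ?subr_ge0//.
apply: le_trans (chi_tail _ Qx) _ => //; rewrite ler_pdivrMr// mulrC -ler_pdivrMr//.
apply/ltW/(lt_le_trans (truncnS_gt _)); by rewrite ler_nat.
Qed.

Lemma Q_box_cases x : Q x \/ forall rho : R, 0 < rho -> \forall y \near x, ~ box rho y.
Proof.
have c1 : (fun y : R * R => y.1) @ x --> x.1 by exact: cvg_fst.
have c2 : (fun y : R * R => y.2) @ x --> x.2 by exact: cvg_snd.
have [x1|x1] := ltP 0 x.1; last first.
  right=> rho r0; have : \forall y \near x, y.1 < rho^-1.
    by apply: (c1 [set u | u < rho^-1]); apply: lt_nbhsl; rewrite (le_lt_trans x1)// invr_gt0.
  by apply: filterS => y h [/andP[h' _] _]; move: h; rewrite ltNge h'.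
have [x2|x2] := ltP 0 x.2; last first.
  right=> rho r0; have : \forall y \near x, y.2 < rho^-1.
    by apply: (c2 [set u | u < rho^-1]); apply: lt_nbhsl; rewrite (le_lt_trans x2)// invr_gt0.
  by apply: filterS => y h [_ /andP[h' _]]; move: h; rewrite ltNge h'.
by left.
Qed.

Lemma chi_continuous rho : 0 < rho -> continuous (chi rho).
Proof.
move=> r0 x; have [Qx|nQ] := Q_box_cases x; last first.
  have r2 : 0 < 2 * rho by rewrite mulr_gt0.
  apply: near0_continuous; apply: filterS (nQ _ r2) => y h.
  by apply/eqP; apply: contrapT => /negP/(chi_box r0).
have c1 : (fun y : R * R => y.1) @ x --> x.1 by exact: cvg_fst.
have c2 : (fun y : R * R => y.2) @ x --> x.2 by exact: cvg_snd.
case: (Qx) => x1 x2.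
have cL : Lam @ x --> Lam x.
  by apply: cvgD; apply: cvgD => //; apply: cvgV => //; rewrite gt_eqF.
have cl : (fun y => clamp (2 - Lam y / rho)) @ x --> clamp (2 - Lam x / rho).
  have h : (fun y => 2 - Lam y / rho) @ x --> 2 - Lam x / rho.
    by apply: cvgB; [exact: cvg_cst|apply: cvgM => //; exact: cvg_cst].
  apply: cvgM; last exact: cvg_cst.
  apply: cvgD; last exact: cvg_cst.
  by apply: cvgB; apply: cvg_norm => //; apply: cvgB => //; exact: cvg_cst.
rewrite /continuous_at; have -> : chi rho x = clamp (2 - Lam x / rho) by rewrite /chi x1 x2.
apply: cvg_trans cl; apply: near_eq_cvg.
have : \forall y \near x, Q y by apply: open_nbhs_nbhs; split => //; exact: quadrant_open.
by apply: filterS => y [y1 y2]; rewrite /chi y1 y2.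
Qed.

Lemma cut_continuous rho (f : R * R -> R) : 0 < rho ->
  (forall x, Q x -> {for x, continuous f}) -> continuous (fun x => chi rho x * f x).
Proof.
move=> r0 cf x; have [Qx|nQ] := Q_box_cases x.
  by apply: cvgM; [exact: chi_continuous|exact: cf].
have r2 : 0 < 2 * rho by rewrite mulr_gt0.
apply: near0_continuous; apply: filterS (nQ _ r2) => y h.
apply/eqP; rewrite mulf_eq0; apply/orP; left.
by apply: contrapT => /negP/(chi_box r0).
Qed.

Lemma cut_supp rho (f : R * R -> R) x : 0 < rho -> chi rho x * f x != 0 -> box (2 * rho) x.
Proof. by move=> r0; rewrite mulf_eq0 negb_or => /andP[/(chi_box r0)]. Qed.

End cutoff.

Section limit_moments.
Context {R : realType}.
Variables (U : set_system nat) (S : nat -> finType) (w : forall m, S m -> R)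
  (z : forall m, S m -> R * R) (g : {measure set (R * R)%type -> \bar R}).
Arguments w : clear implicits.
Arguments z : clear implicits.
Hypotheses (UU : UltraFilter U) (w0 : forall m s, 0 <= w m s) (zQ : forall m s, quadrant (z m s))
  (gfin : (g setT < +oo)%E)
  (vague : forall f : R * R -> R, continuous f -> box_supported f ->
      (fun m => \sum_s w m s * f (z m s)) @ U --> \int[g]_(x in @quadrant R) f x).

Local Notation Q := (@quadrant R).

(** Vague convergence bounds the integrals of the cut-off functions, which increase to F; monotone
    convergence concludes. *)
Lemma limit_moment_le (F : R * R -> R) (C : R) :
  (forall x, Q x -> {for x, continuous F}) -> (forall x, Q x -> 0 <= F x) ->
  (forall m, \sum_s w m s * F (z m s) <= C) ->
  (\int[g]_(x in Q) (F x)%:E <= C%:E)%E.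
Proof.
move=> cF F0 FC; pose f n x := chi n.+1%:R x * F x.
have n0 n : 0 < n.+1%:R :> R by rewrite ltr0n.
have cf n : continuous (f n) by apply: cut_continuous.
have bf n : box_supported (f n).
  by exists (2 * n.+1%:R) => [|x]; [rewrite mulr_gt0|exact: cut_supp].
have f0 n x : Q x -> 0 <= f n x.
  by move=> Qx; rewrite mulr_ge0 ?F0//; case/andP: (chi01 n.+1%:R x).
have fC n : \int[g]_(x in Q) f n x <= C.
  apply: (cvg_le_near (vague (cf n) (bf n))); apply: filterS filterT => m _ /=.
  apply: le_trans (FC m); apply: ler_sum => s _; rewrite ler_wpM2l//.
  by rewrite ler_piMl ?F0//; case/andP: (chi01 n.+1%:R (z m s)).
have fE n : (\int[g]_(x in Q) (f n x)%:E <= C%:E)%E.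
  have fin : (\int[g]_(x in Q) (f n x)%:E)%E \is a fin_num.
    apply: integrable_fin_num; first exact: quadrant_measurable.
    exact: compact_supp_integrable.
  by rewrite -(fineK fin) lee_fin; exact: fC.
have cvgF x : Q x -> (fun n => (f n x)%:E) @ \oo --> (F x)%:E.
  move=> Qx; apply: cvg_EFin; first by apply: nearW.
  rewrite -[X in _ --> X]mul1r; apply: cvgM; first exact: chi_cvg.
  exact: cvg_cst.
have -> : (\int[g]_(x in Q) (F x)%:E = \int[g]_(x in Q) (limn (fun n => (f n x)%:E)))%E.
  by apply: eq_integral => x /set_mem /cvgF h; apply/esym; apply: cvg_lim h.
rewrite monotone_convergence//.
- apply: lime_le; last by apply: nearW => n; exact: fE.
  apply: ereal_nondecreasing_is_cvgn => n m nm; apply: ge0_le_integral => //.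
  + exact: quadrant_measurable.
  + by move=> x Qx; rewrite lee_fin f0.
  + apply/measurable_EFinP; apply: measurable_funTS; exact: continuous_measurable_plane.
  + apply/measurable_EFinP; apply: measurable_funTS; exact: continuous_measurable_plane.
  + by move=> x Qx; rewrite lee_fin ler_wpM2r ?F0// chi_le// ler_nat.
- exact: quadrant_measurable.
- by move=> n; apply/measurable_EFinP; apply: measurable_funTS; exact: continuous_measurable_plane.
- by move=> x Qx n m nm; rewrite lee_fin ler_wpM2r ?F0// chi_le// ler_nat.
Qed.

Lemma limit_moment_integrable (F : R * R -> R) (C : R) :
  (forall x, Q x -> {for x, continuous F}) -> (forall x, Q x -> 0 <= F x) ->
  (forall m, \sum_s w m s * F (z m s) <= C) -> g.-integrable Q (EFin \o F).
Proof.
move=> cF F0 FC; apply/integrableP; split.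
  apply/measurable_EFinP; apply: open_continuous_measurable_plane => //; exact: quadrant_open.
apply: le_lt_trans (ltry C); apply: le_trans (limit_moment_le cF F0 FC).
rewrite le_eqVlt; apply/orP; left; apply/eqP.
by apply: eq_integral => x /set_mem Qx; rewrite /= ger0_norm ?F0.
Qed.

Lemma Rintegral_dominated (f_ : nat -> R * R -> R) (f F : R * R -> R) :
  (forall n, measurable_fun Q (f_ n)) -> (forall x, Q x -> (f_ ^~ x) @ \oo --> f x) ->
  g.-integrable Q (EFin \o F) -> (forall n x, Q x -> `|f_ n x| <= F x) ->
  (fun n => \int[g]_(x in Q) f_ n x) @ \oo --> \int[g]_(x in Q) f x.
Proof.
move=> mf ff iF fF; apply: fine_cvg.
have mf' : measurable_fun Q f by exact: measurable_fun_cvg mf ff.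
have fF' x : Q x -> `|f x| <= F x.
  move=> Qx; have c : (fun n => `|f_ n x|) @ \oo --> `|f x| by apply: cvg_norm; exact: ff.
  apply: (ler_cvg_to c (_ : (fun=> F x) @ \oo --> F x)); first exact: cvg_cst.
  by apply: nearW => n; exact: fF.
rewrite fineK; last first.
  apply: integrable_fin_num; first exact: quadrant_measurable.
  apply: le_integrable iF; first exact: quadrant_measurable.
  - exact/measurable_EFinP.
  - by move=> x Qx /=; rewrite lee_fin (le_trans (fF' _ Qx))// ler_norm.
apply: (@dominated_cvg _ _ _ g Q _ _ _ (EFin \o F)) => //.
- exact: quadrant_measurable.
- by move=> n; apply/measurable_EFinP; exact: mf.
- by move=> x Qx; apply: cvg_EFin; [exact: nearW|exact: ff].
Qed.

(** The bound on the sums of [Lam] times F is a uniform integrability: the cutoff at level n + 1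
    changes each sum by at most C / (n + 1). On the side of the integral the cutoff is removed by
    dominated convergence. *)
Lemma dominated_limit (f F : R * R -> R) (C : R) :
  (forall x, Q x -> {for x, continuous f}) -> (forall x, Q x -> {for x, continuous F}) ->
  (forall x, Q x -> `|f x| <= F x) ->
  (forall m, \sum_s w m s * F (z m s) <= C) ->
  (forall m, \sum_s w m s * (Lam (z m s) * F (z m s)) <= C) ->
  (fun m => \sum_s w m s * f (z m s)) @ U --> \int[g]_(x in Q) f x.
Proof.
move=> cf cF fF FC FLC.
have F0 x : Q x -> 0 <= F x by move=> /fF; exact: le_trans.
pose f_ n x := chi n.+1%:R x * f x.
have n0 n : 0 < n.+1%:R :> R by rewrite ltr0n.
have cf_ n : continuous (f_ n) by apply: cut_continuous.
have bf n : box_supported (f_ n).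
  by exists (2 * n.+1%:R) => [|x]; [rewrite mulr_gt0|exact: cut_supp].
have lim2 : (fun n => \int[g]_(x in Q) f_ n x) @ \oo --> \int[g]_(x in Q) f x.
  apply: (@Rintegral_dominated f_ f F).
  - by move=> n; apply: measurable_funTS; exact: continuous_measurable_plane.
  - move=> x Qx; rewrite -[X in _ --> X]mul1r; apply: cvgM; first exact: chi_cvg.
    exact: cvg_cst.
  - exact: limit_moment_integrable FC.
  - move=> n x Qx; rewrite normrM; have /andP[c0 c1] := chi01 n.+1%:R x.
    by rewrite ger0_norm// (le_trans _ (fF x Qx))// ler_piMl.
apply/cvgrPdist_le => e e0.
have e3 : 0 < e / 3 by rewrite divr_gt0.
have /cvgrPdist_le/(_ _ e3)[n1 _ hn1] := lim2.
pose n := maxn n1 (Num.truncn (C / (e / 3))).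
have hn : `|\int[g]_(x in Q) f x - \int[g]_(x in Q) f_ n x| <= e / 3.
  by apply: hn1 => /=; exact: leq_maxl.
have hC : C / n.+1%:R <= e / 3.
  rewrite ler_pdivrMr// mulrC -ler_pdivrMr//; apply: le_trans (ltW (truncnS_gt _)) _.
  by rewrite ler_nat ltnS leq_maxr.
have /cvgrPdist_le/(_ _ e3) := vague (cf_ n) (bf n).
apply: filterS => m hm.
have h3 : `|\sum_s w m s * f_ n (z m s) - \sum_s w m s * f (z m s)| <= e / 3.
  apply: le_trans hC; rewrite -sumrB; apply: le_trans (ler_norm_sum _ _ _) _.
  apply: le_trans (_ : (\sum_s w m s * (Lam (z m s) * F (z m s))) / n.+1%:R <= _); last first.
    by rewrite ler_wpM2r ?invr_ge0.
  rewrite mulr_suml; apply: ler_sum => s _.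
  rewrite -mulrBr normrM ger0_norm// -mulrA ler_wpM2l// /f_.
  have -> : chi n.+1%:R (z m s) * f (z m s) - f (z m s) = - ((1 - chi n.+1%:R (z m s)) * f (z m s)).
    by ring.
  have /andP[c0 c1] := chi01 n.+1%:R (z m s).
  rewrite normrN normrM ger0_norm ?subr_ge0// mulrAC.
  by apply: ler_pM; rewrite ?subr_ge0// ?chi_tail// fF.
rewrite (_ : _ - _ = (\int[g]_(x in Q) f x - \int[g]_(x in Q) f_ n x) +
  (\int[g]_(x in Q) f_ n x - \sum_s w m s * f_ n (z m s)) +
  (\sum_s w m s * f_ n (z m s) - \sum_s w m s * f (z m s))); last by ring.
apply: le_trans (ler_normD _ _) _; rewrite (_ : e = e / 3 + e / 3 + e / 3); last by field.
by apply: lerD => //; apply: le_trans (ler_normD _ _) _; exact: lerD.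
Qed.

End limit_moments.

Section double_limit.
Context {R : realType}.
Variables (U : set_system nat) (S : nat -> finType) (w : forall m, S m -> R)
  (z : forall m, S m -> R * R) (W : R) (g : {measure set (R * R)%type -> \bar R}).
Arguments w : clear implicits.
Arguments z : clear implicits.
Hypotheses (UU : UltraFilter U) (UN : \oo `<=` U)
  (w0 : forall m s, 0 <= w m s) (zQ : forall m s, quadrant (z m s))
  (wW : forall m, \sum_s w m s <= W) (inhab : forall m, S m)
  (gfin : (g setT < +oo)%E)
  (vague : forall f : R * R -> R, continuous f -> box_supported f ->
      (fun m => \sum_s w m s * f (z m s)) @ U --> \int[g]_(x in @quadrant R) f x).

Local Notation Q := (@quadrant R).

Variables (H_ : forall m, S m -> S m -> R) (H : R * R -> R * R -> R)
  (A B : R * R -> R) (C : R).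
Arguments H_ : clear implicits.
Hypotheses (cH : forall x y, Q x -> Q y ->
    {for (x, y), continuous (fun p : (R * R) * (R * R) => H p.1 p.2)})
  (cA : forall x, Q x -> {for x, continuous A}) (cB : forall x, Q x -> {for x, continuous B})
  (A0 : forall x, Q x -> 0 <= A x) (B0 : forall x, Q x -> 0 <= B x)
  (HD : forall x y, Q x -> Q y -> `|H x y| <= A x * B y + B x * A y)
  (H_D : forall m s s', `|H_ m s s'| <= A (z m s) * B (z m s') + B (z m s) * A (z m s'))
  (EA : forall m, \sum_s w m s * A (z m s) <= C)
  (EB : forall m, \sum_s w m s * B (z m s) <= C)
  (ELA : forall m, \sum_s w m s * (Lam (z m s) * A (z m s)) <= C)
  (ELB : forall m, \sum_s w m s * (Lam (z m s) * B (z m s)) <= C)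
  (ccH : forall (s s' : forall m, S m) l l', Q l -> Q l' ->
     (fun m => z m (s m)) @ U --> l -> (fun m => z m (s' m)) @ U --> l' ->
     (fun m => H_ m (s m) (s' m)) @ U --> H l l').

Let C0 : 0 <= C.
Proof. by apply: le_trans (EA 0%N); apply: sumr_ge0 => s _; rewrite mulr_ge0// A0. Qed.

Let cut (rho : R) (x y : R * R) : R := chi rho x * (chi rho y * H x y).

Let cut_cont rho : 0 < rho -> continuous (fun p : (R * R) * (R * R) => cut rho p.1 p.2).
Proof.
move=> r0 [x y]; have r2 : 0 < 2 * rho by rewrite mulr_gt0.
have c1 : (fun p : (R * R) * (R * R) => p.1) @ (x, y) --> x by exact: cvg_fst.
have c2 : (fun p : (R * R) * (R * R) => p.2) @ (x, y) --> y by exact: cvg_snd.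
have [Qx|nx] := Q_box_cases x; last first.
  apply: near0_continuous; have : \forall p \near (x, y), ~ box (2 * rho) p.1 by apply: (c1 _ (nx _ r2)).
  apply: filterS => p np; apply/eqP; rewrite mulf_eq0; apply/orP; left.
  by apply: contrapT => /negP/(chi_box r0).
have [Qy|ny] := Q_box_cases y; last first.
  apply: near0_continuous; have : \forall p \near (x, y), ~ box (2 * rho) p.2 by apply: (c2 _ (ny _ r2)).
  apply: filterS => p np; apply/eqP; rewrite !mulf_eq0; apply/orP; right; apply/orP; left.
  by apply: contrapT => /negP/(chi_box r0).
apply: cvgM; first by apply: continuous_cvg => //; exact: chi_continuous.
apply: cvgM; last exact: cH.
by apply: continuous_cvg => //; exact: chi_continuous.
Qed.

Let cut_box rho x y : 0 < rho -> cut rho x y != 0 -> box (2 * rho) x /\ box (2 * rho) y.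
Proof.
move=> r0; rewrite !mulf_eq0 !negb_or => /andP[/(chi_box r0) h1 /andP[/(chi_box r0) h2 _]].
by split.
Qed.

Let cut_limit rho : 0 < rho ->
  (fun m => \sum_s \sum_s' w m s * w m s' *
      (chi rho (z m s) * (chi rho (z m s') * H_ m s s'))) @ U -->
    \int[g]_(x in Q) \int[g]_(y in Q) cut rho x y.
Proof.
move=> r0; have r2 : 0 < 2 * rho by rewrite mulr_gt0.
apply: (@states_double_limit R U S w z W g UU UN w0 wW inhab gfin vague
  (fun m s s' => chi rho (z m s) * (chi rho (z m s') * H_ m s s')) (cut rho) (2 * rho) r2).
- exact: cut_cont.
- by move=> x y; exact: cut_box.
- apply: filterS filterT => m _ s s'.
  by rewrite !mulf_eq0 !negb_or => /andP[/(chi_box r0) h1 /andP[/(chi_box r0) h2 _]].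
- move=> s s' l l' bl bl' sl sl'.
  have Ql := box_quadrant r2 bl; have Ql' := box_quadrant r2 bl'.
  have cc (t : forall m, S m) k : (fun m => z m (t m)) @ U --> k ->
      (fun m => chi rho (z m (t m))) @ U --> chi rho k.
    by move=> tk; apply: continuous_cvg => //; exact: chi_continuous.
  by apply: cvgM; [exact: cc|apply: cvgM; [exact: cc|exact: ccH]].
Qed.

Let row_cont x : Q x -> forall y, Q y -> {for y, continuous (fun y => A x * B y + B x * A y)}.
Proof.
move=> Qx y Qy; apply: cvgD; (apply: cvgM; first exact: cvg_cst); [exact: cB|exact: cA].
Qed.

Let row_ge0 x : Q x -> forall y, Q y -> 0 <= A x * B y + B x * A y.
Proof. by move=> Qx y Qy; rewrite addr_ge0// mulr_ge0// ?A0 ?B0. Qed.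

Let row_moment x m : Q x -> \sum_s w m s * (A x * B (z m s) + B x * A (z m s)) <= C * (A x + B x).
Proof.
move=> Qx; rewrite mulrDr [C * A x]mulrC [C * B x]mulrC.
apply: le_trans (lerD (ler_wpM2l (A0 Qx) (EB m)) (ler_wpM2l (B0 Qx) (EA m))).
rewrite !mulr_sumr -big_split/=; apply: ler_sum => s _.
by rewrite le_eqVlt; apply/orP; left; apply/eqP; ring.
Qed.

Let cut_le rho x y : Q x -> Q y -> `|cut rho x y| <= A x * B y + B x * A y.
Proof.
move=> Qx Qy; apply: le_trans (HD Qx Qy); rewrite /cut mulrA normrM ler_piMl//.
have /andP[a1 a2] := chi01 rho x; have /andP[b1 b2] := chi01 rho y.
by rewrite ger0_norm ?mulr_ge0// mulr_ile1.
Qed.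

(** Dominated convergence twice: in y by the bound on a row, and in x by the integral of that bound,
    at most C (A x + B x). *)
Let cut_integral_limit :
  (fun n => \int[g]_(x in Q) \int[g]_(y in Q) cut n.+1%:R x y) @ \oo -->
     \int[g]_(x in Q) \int[g]_(y in Q) H x y.
Proof.
have n0 n : 0 < n.+1%:R :> R by rewrite ltr0n.
have rowi x : Q x -> g.-integrable Q (EFin \o (fun y => A x * B y + B x * A y)).
  move=> Qx; apply: (limit_moment_integrable UU w0 zQ gfin vague (C := C * (A x + B x))) => //.
  - exact: row_cont.
  - exact: row_ge0.
  - by move=> m; exact: row_moment.
have sc n x : continuous (cut n.+1%:R x).
  by apply: (@section_continuous R (cut n.+1%:R)); exact: cut_cont.
have bs n x : box_supported (cut n.+1%:R x).
  by exists (2 * n.+1%:R) => [|y]; [rewrite mulr_gt0|case/cut_box].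
apply: (@Rintegral_dominated R g (fun n x => \int[g]_(y in Q) cut n.+1%:R x y) _
  (fun x => C * (A x + B x))).
- move=> n; apply: measurable_funTS; apply: continuous_measurable_plane.
  apply: (@section_integral_continuous R U S w z W g UU UN w0 wW gfin vague (cut n.+1%:R) (2 * n.+1%:R)).
  + by rewrite mulr_gt0.
  + exact: cut_cont.
  + by move=> x y /cut_box[].
- move=> x Qx; apply: (@Rintegral_dominated R g (fun n y => cut n.+1%:R x y) _
    (fun y => A x * B y + B x * A y)).
  + by move=> n; apply: measurable_funTS; apply: continuous_measurable_plane; exact: sc.
  + move=> y Qy; rewrite /cut -[X in _ --> X]mul1r; apply: cvgM; first exact: chi_cvg.
    rewrite -[X in _ --> X]mul1r; apply: cvgM; first exact: chi_cvg.
    exact: cvg_cst.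
  + exact: rowi.
  + by move=> n y Qy; exact: cut_le.
- apply: (limit_moment_integrable UU w0 zQ gfin vague (C := C * (C + C))).
  + move=> x Qx; apply: cvgM; first exact: cvg_cst.
    by apply: cvgD; [exact: cA|exact: cB].
  + by move=> x Qx; rewrite mulr_ge0// addr_ge0// ?A0 ?B0.
  + move=> m; apply: le_trans (ler_wpM2l C0 (lerD (EA m) (EB m))).
    rewrite -big_split mulr_sumr; apply: ler_sum => s _.
    by rewrite /= le_eqVlt; apply/orP; left; apply/eqP; ring.
- move=> n x Qx.
  have ci := compact_supp_integrable gfin (sc n x) (bs n x).
  rewrite -lee_fin EFin_normr_Rintegral//; last exact: quadrant_measurable.
  apply: le_trans (limit_moment_le UU w0 zQ gfin vague (row_cont Qx) (row_ge0 Qx) (fun m => row_moment m Qx)).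
  apply: le_trans (le_abse_integral _ _ _) _; first exact: quadrant_measurable.
    exact: measurable_int ci.
  apply: ge0_le_integral => //.
  + exact: quadrant_measurable.
  + by apply: measurableT_comp => //; exact: measurable_int ci.
  + by have /integrableP[] := rowi _ Qx.
  + by move=> y Qy /=; rewrite lee_fin; exact: cut_le.
Qed.

(** The tail is controlled by 1 - c1 c2 <= (1 - c1) + (1 - c2). As the dominating function is a sum
    of two products, the tail splits into four products of single moments, each at most C^2; hence
    the constant 4 C C. *)
Lemma double_dominated_limit :
  (fun m => \sum_s \sum_s' w m s * w m s' * H_ m s s') @ U -->
    \int[g]_(x in Q) \int[g]_(y in Q) H x y.
Proof.
have n0 n : 0 < n.+1%:R :> R by rewrite ltr0n.
apply/cvgrPdist_le => e e0; have e3 : 0 < e / 3 by rewrite divr_gt0.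
have /cvgrPdist_le/(_ _ e3)[n1 _ hn1] := cut_integral_limit.
pose n := maxn n1 (Num.truncn (4 * C * C / (e / 3))).
have hn := hn1 n (leq_maxl _ _).
have hC : 4 * C * C / n.+1%:R <= e / 3.
  rewrite ler_pdivrMr// [X in _ <= X]mulrC -ler_pdivrMr//; apply: le_trans (ltW (truncnS_gt _)) _.
  by rewrite ler_nat ltnS leq_maxr.
have /cvgrPdist_le/(_ _ e3) := cut_limit (n0 n).
apply: filterS => m hm; set rho : R := n.+1%:R in hn hC hm *.
have r0 : 0 < rho by rewrite /rho.
set T1 := \sum_s \sum_s' _ in hm *; set T2 := \sum_s \sum_s' _.
have h3 : `|T1 - T2| <= e / 3.
  apply: le_trans hC.
  apply: le_trans (_ : (\sum_s \sum_s' w m s * w m s' * ((Lam (z m s) + Lam (z m s')) *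
     (A (z m s) * B (z m s') + B (z m s) * A (z m s')))) / rho <= _).
    rewrite /T1 /T2 -sumrB mulr_suml; apply: le_trans (ler_norm_sum _ _ _) _.
    apply: ler_sum => s _; rewrite -sumrB mulr_suml; apply: le_trans (ler_norm_sum _ _ _) _.
    apply: ler_sum => s' _; rewrite -mulrBr normrM ger0_norm ?mulr_ge0//.
    rewrite -mulrA ler_wpM2l ?mulr_ge0// mulrAC.
    have /andP[a1 a2] := chi01 rho (z m s); have /andP[b1 b2] := chi01 rho (z m s').
    have t1 := chi_tail r0 (zQ s); have t2 := chi_tail r0 (zQ s').
    set c1 := chi _ _ in a1 a2 t1 *; set c2 := chi _ _ in b1 b2 t2 *.
    have -> : c1 * (c2 * H_ m s s') - H_ m s s' = - ((1 - c1 * c2) * H_ m s s') by ring.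
    have c12 : c1 * c2 <= 1 by rewrite mulr_ile1.
    rewrite normrN normrM ger0_norm ?subr_ge0//; apply: ler_pM; rewrite ?subr_ge0 ?H_D//.
    have h : c1 * (1 - c2) <= 1 - c2 by rewrite ler_piMl// subr_ge0.
    rewrite mulrDl; apply: le_trans (lerD t1 t2).
    rewrite (_ : 1 - c1 * c2 = (1 - c1) + c1 * (1 - c2)); last by ring.
    by rewrite lerD2l.
  rewrite ler_wpM2r ?invr_ge0 ?(ltW r0)//.
  have L0 (s : S m) : 0 <= Lam (z m s) by exact/ltW/Lam_gt0.
  have A0' (s : S m) : 0 <= A (z m s) by exact: A0.
  have B0' (s : S m) : 0 <= B (z m s) by exact: B0.
  have sA : 0 <= \sum_s w m s * A (z m s) by apply: sumr_ge0 => s _; rewrite mulr_ge0.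
  have sB : 0 <= \sum_s w m s * B (z m s) by apply: sumr_ge0 => s _; rewrite mulr_ge0.
  have sLA : 0 <= \sum_s w m s * (Lam (z m s) * A (z m s)).
    by apply: sumr_ge0 => s _; rewrite !mulr_ge0.
  have sLB : 0 <= \sum_s w m s * (Lam (z m s) * B (z m s)).
    by apply: sumr_ge0 => s _; rewrite !mulr_ge0.
  rewrite (_ : \sum_s _ = 
      (\sum_s w m s * (Lam (z m s) * A (z m s))) * (\sum_s w m s * B (z m s)) +
      (\sum_s w m s * (Lam (z m s) * B (z m s))) * (\sum_s w m s * A (z m s)) +
      ((\sum_s w m s * A (z m s)) * (\sum_s w m s * (Lam (z m s) * B (z m s))) +
       (\sum_s w m s * B (z m s)) * (\sum_s w m s * (Lam (z m s) * A (z m s))))).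
    have := ler_pM sLA sB (ELA m) (EB m); have := ler_pM sLB sA (ELB m) (EA m). lra.
  rewrite !mulr_suml -!big_split/=; apply: eq_bigr => s _.
  rewrite !mulr_sumr -!big_split/=; apply: eq_bigr => s' _; ring.
rewrite (_ : _ - T2 = (\int[g]_(x in Q) \int[g]_(y in Q) H x y -
   \int[g]_(x in Q) \int[g]_(y in Q) cut rho x y) +
  (\int[g]_(x in Q) \int[g]_(y in Q) cut rho x y - T1) + (T1 - T2)); last by ring.
apply: le_trans (ler_normD _ _) _; rewrite (_ : e = e / 3 + e / 3 + e / 3); last by field.
by apply: lerD => //; apply: le_trans (ler_normD _ _) _; exact: lerD.
Qed.

End double_limit.

(** * Calculus of C1 functions of two variables *)

Section directional.
Context {R : realType}.
Implicit Types (f : R * R -> R) (x e l : R * R).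

Lemma is_derive_line f x e (t : R) : derivable f (x + t *: e) e ->
  is_derive t 1 (fun u : R => f (x + u *: e)) ('D_e f (x + t *: e)).
Proof.
have E : (fun h : R => h^-1 *: (((fun u : R => f (x + u *: e)) \o shift t) (h *: (1 : R)) - f (x + t *: e)))
   = (fun h : R => h^-1 *: ((f \o shift (x + t *: e)) (h *: e) - f (x + t *: e))).
  apply/funext => h; congr (_ *: (f _ - _)) => /=.
  by rewrite scalerDl [h *: 1]mulr1 addrCA.
by move=> df; split; rewrite /derivable /derive E.
Qed.

Lemma line_MVT f x e (h : R) :
  (forall t : R, `|t| <= `|h| -> derivable f (x + t *: e) e) ->
  exists2 t : R, `|t| <= `|h| & f (x + h *: e) - f x = h * 'D_e f (x + t *: e).
Proof.
move=> df; pose F (u : R) := f (x + u *: e).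
have dF (t : R) : `|t| <= `|h| -> is_derive t 1 F ('D_e f (x + t *: e)).
  by move=> /df; exact: is_derive_line.
have F0 : f x = F 0 by rewrite /F scale0r addr0.
have [h0|/ltW h0] := leP 0 h.
  have sub (t : R) : t \in `[0, h] -> `|t| <= `|h|.
    by rewrite in_itv/= => /andP[t0 th]; rewrite !ger0_norm.
  have [||t /sub th e1] := @MVT_segment R F (fun t => 'D_e f (x + t *: e)) 0 h h0.
  - by move=> t th; apply/dF/sub; exact: subset_itv_oo_cc.
  - by apply: derivable_within_continuous => t /sub/dF[].
  - by exists t => //; rewrite F0 -/(F h) e1 subr0 mulrC.
have sub (t : R) : t \in `[h, 0] -> `|t| <= `|h|.
  by rewrite in_itv/= => /andP[t0 th]; rewrite !ler0_norm// lerN2.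
have [||t /sub th e1] := @MVT_segment R F (fun t => 'D_e f (x + t *: e)) h 0 h0.
- by move=> t th; apply/dF/sub; exact: subset_itv_oo_cc.
- by apply: derivable_within_continuous => t /sub/dF[].
- by exists t => //; rewrite F0 -/(F h) -opprB e1; ring.
Qed.

(** A first-order expansion along e, uniform in the base point near l: the mean value theorem gives
    the derivative at a point of the segment, and continuity compares it with the one at l. *)
Lemma increment_approx f e l (eps : R) : 0 < eps ->
  (\forall x \near l, derivable f x e) -> {for l, continuous ('D_e f)} ->
  \forall p \near (l, 0 : R),
    `|f (p.1 + p.2 *: e) - f p.1 - p.2 * 'D_e f l| <= eps * `|p.2|.
Proof.
move=> eps0 df cD.
have close : \forall x \near l, derivable f x e /\ `|'D_e f x - 'D_e f l| <= eps.
  apply: filterS2 df (cD _ (nbhsx_ballx ('D_e f l) _ eps0)) => x dx bx; split => //.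
  by rewrite distrC; exact: ltW.
have : \forall p \near (l, 0 : R), derivable f (p.1 + p.2 *: e) e /\
    `|'D_e f (p.1 + p.2 *: e) - 'D_e f l| <= eps.
  have c : (fun p : (R * R) * R => p.1 + p.2 *: e) @ (l, 0) --> l + (0 : R) *: e.
    by apply: cvgD; [exact: cvg_fst|apply: cvgZr_tmp; exact: cvg_snd].
  by rewrite scale0r addr0 in c; exact: c close.
move=> /nbhs_ballP[d /= d0 hd]; apply/nbhs_ballP; exists d => //= -[x h] [/= bx bh].
have hd' (t : R) : `|t| <= `|h| -> derivable f (x + t *: e) e /\
    `|'D_e f (x + t *: e) - 'D_e f l| <= eps.
  move=> th; apply: (hd (x, t)); split => //=; move: bh.
  by rewrite /ball/= !sub0r !normrN; exact: le_lt_trans.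
have [|t th ->] := @line_MVT f x e h; first by move=> t /hd'[].
by rewrite -mulrBr normrM mulrC ler_wpM2r//; have [_] := hd' t th.
Qed.

(** Difference quotients with moving base point x, step h and speed k: the form taken by the jumps
    of the schemes. *)
Lemma increment_cvg (U : set_system nat) {FU : Filter U} f e l (x : nat -> R * R)
    (h k : nat -> R) (q : R) :
  (\forall x \near l, derivable f x e) -> {for l, continuous ('D_e f)} ->
  x @ U --> l -> h @ U --> (0 : R) -> (fun m => k m * h m) @ U --> q ->
  (fun m => k m * (f (x m + h m *: e) - f (x m))) @ U --> q * 'D_e f l.
Proof.
move=> df cD xl h0 kh; apply/cvgrPdist_le => eps eps0.
have q1 : 0 < `|q| + 1 by rewrite ltr_wpDl.
pose d := eps / 2 / (`|q| + 1); have d0 : 0 < d by rewrite !divr_gt0.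
have pc : (fun m => (x m, h m)) @ U --> (l, 0 : R).
  exact: (@cvg_pair _ _ _ U (nbhs l) (nbhs (0 : R))).
have h1 : U [set m | `|f (x m + h m *: e) - f (x m) - h m * 'D_e f l| <= d * `|h m|] :=
  pc _ (increment_approx d0 df cD).
have : (fun m => k m * h m * 'D_e f l) @ U --> q * 'D_e f l.
  by apply: cvgM => //; exact: cvg_cst.
move=> /cvgrPdist_le/(_ (eps / 2)); rewrite divr_gt0// => /(_ isT) h2.
have h3 : U [set m | `|k m * h m| <= `|q| + 1].
  have /cvgrPdist_le/(_ 1 ltr01) := kh; apply: filterS => m hm.
  rewrite /= -[k m * h m](subKr q); apply: le_trans (ler_normB _ _) _.
  by rewrite lerD2l.
apply: filterS3 h1 h2 h3 => m /= h1 h2 h3.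
have -> : q * 'D_e f l - k m * (f (x m + h m *: e) - f (x m)) =
  (q * 'D_e f l - k m * h m * 'D_e f l) -
   k m * (f (x m + h m *: e) - f (x m) - h m * 'D_e f l) by ring.
apply: le_trans (ler_normB _ _) _; rewrite [leRHS](splitr eps); apply: lerD => //.
rewrite normrM; apply: le_trans (ler_wpM2l (normr_ge0 _) h1) _.
rewrite mulrCA -normrM; apply: le_trans (ler_wpM2l (ltW d0) h3) _.
by rewrite /d divfK// gt_eqF.
Qed.

End directional.

Section C1_functions.
Context {R : realType}.
Local Notation Q := (@quadrant R).

Lemma nbhs_quadrant x : Q x -> \forall y \near x, Q y.
Proof. by move=> Qx; apply: open_nbhs_nbhs; split => //; exact: quadrant_open. Qed.

Lemma C1_near_derivable (f : R * R -> R) l : C1_quadrant f -> Q l ->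
  (\forall x \near l, derivable f x ((1, 0) : R * R)) /\
  (\forall x \near l, derivable f x ((0, 1) : R * R)).
Proof.
by move=> fC1 Ql; split; apply: filterS (nbhs_quadrant Ql) => x /fC1[].
Qed.

(** Only partial derivatives are at hand: l is joined to y by a segment along each axis, and each
    increment is at most its length times a constant. *)
Lemma C1_continuous (f : R * R -> R) l : C1_quadrant f -> Q l -> {for l, continuous f}.
Proof.
move=> fC1 Ql; have [_ _ ca cv] := fC1 _ Ql; have [da dv] := C1_near_derivable fC1 Ql.
have ha := increment_approx ltr01 da ca; have hv := increment_approx ltr01 dv cv.
have c1 : (fun y : R * R => y.1) @ l --> l.1 by exact: cvg_fst.
have c2 : (fun y : R * R => y.2) @ l --> l.2 by exact: cvg_snd.
have b1 : (fun y : R * R => y.1 - l.1) @ l --> (0 : R).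
  by rewrite -[X in _ --> X](subrr l.1); apply: cvgB => //; exact: cvg_cst.
have b2 : (fun y : R * R => y.2 - l.2) @ l --> (0 : R).
  by rewrite -[X in _ --> X](subrr l.2); apply: cvgB => //; exact: cvg_cst.
have p1 : (fun y : R * R => ((l.1, y.2), y.1 - l.1)) @ l --> (l, 0 : R).
  apply: (@cvg_pair _ _ _ (nbhs l) (nbhs l) (nbhs (0 : R))) => //.
  rewrite {2}(surjective_pairing l).
  by apply: (@cvg_pair _ _ _ (nbhs l) (nbhs l.1) (nbhs l.2)) => //; exact: cvg_cst.
have p2 : (fun y : R * R => (l, y.2 - l.2)) @ l --> (l, 0 : R).
  by apply: (@cvg_pair _ _ _ (nbhs l) (nbhs l) (nbhs (0 : R))) => //; exact: cvg_cst.
have n1 : \forall y \near l, `|f ((l.1, y.2) + (y.1 - l.1) *: ((1, 0) : R * R)) - f (l.1, y.2) -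
    (y.1 - l.1) * partial_a f l| <= 1 * `|y.1 - l.1| := p1 _ ha.
have n2 : \forall y \near l, `|f (l + (y.2 - l.2) *: ((0, 1) : R * R)) - f l -
    (y.2 - l.2) * partial_v f l| <= 1 * `|y.2 - l.2| := p2 _ hv.
have bound (u d : R) (t : R) : `|u - t * d| <= 1 * `|t| -> `|u| <= `|t| * (1 + `|d|).
  move=> ut; rewrite -[u](subrK (t * d)); apply: le_trans (ler_normD _ _) _.
  by rewrite normrM; lra.
have lim0 : (fun y : R * R => `|y.1 - l.1| * (1 + `|partial_a f l|) +
    `|y.2 - l.2| * (1 + `|partial_v f l|)) @ l --> (0 : R).
  have -> : (0 : R) = `|0 : R| * (1 + `|partial_a f l|) + `|0 : R| * (1 + `|partial_v f l|).
    by rewrite !normr0 !mul0r addr0.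
  by apply: cvgD; apply: cvgM; (try exact: cvg_cst); exact: cvg_norm.
apply/cvgrPdist_le => e e0; have /cvgr0Pnorm_le/(_ e e0) := lim0.
apply: filterS3 n1 n2 => y /= /bound n1 /bound n2 ye.
rewrite distrC; apply: le_trans ye; apply: le_trans (ler_norm _); apply: le_trans (lerD n1 n2).
have -> : (l.1, y.2) + (y.1 - l.1) *: ((1, 0) : R * R) = y.
  by case: (y) => a b; congr pair => /=; rewrite /GRing.scale/= ?mulr1 ?mulr0 ?addr0//; ring.
have -> : l + (y.2 - l.2) *: ((0, 1) : R * R) = (l.1, y.2).
  by case: (l) => a b; congr pair => /=; rewrite /GRing.scale/= ?mulr1 ?mulr0 ?addr0//; ring.
apply: le_trans (ler_normD _ _); rewrite le_eqVlt; apply/orP; left; apply/eqP.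
by congr `|_|; ring.
Qed.

Lemma box_ext_continuous (f : R * R -> R) rho : 0 < rho ->
  (forall x, Q x -> {for x, continuous f}) -> (forall x, f x != 0 -> box rho x) ->
  continuous f.
Proof.
move=> r0 cf bf x; have [Qx|nQ] := Q_box_cases x; first exact: cf.
apply: near0_continuous; apply: filterS (nQ _ r0) => y h.
by apply/eqP; apply: contrapT => /negP/bf.
Qed.

Lemma compact_quadrant_box (C : set (R * R)) : compact C -> C `<=` Q ->
  exists2 rho, 0 < rho & C `<=` box rho.
Proof.
move=> cC CQ.
have cL : {within C, continuous (@Lam R)}.
  apply: continuous_in_subspaceT => x /set_mem/CQ[x1 x2].
  have c1 : (fun y : R * R => y.1) @ x --> x.1 by exact: cvg_fst.
  have c2 : (fun y : R * R => y.2) @ x --> x.2 by exact: cvg_snd.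
  by apply: cvgD; apply: cvgD => //; apply: cvgV => //; rewrite gt_eqF.
have [M [_ hM]] := compact_bounded (continuous_compact cL cC).
pose rho : R := `|M| + 1; have r0 : 0 < rho by rewrite ltr_wpDl.
exists rho => // x Cx; have [x1 x2] := CQ _ Cx.
have Lx : Lam x <= rho.
  apply: le_trans (ler_norm _) _; apply: (hM rho); last by exists x.
  by rewrite (le_lt_trans (ler_norm M))// /rho ltrDl.
have i1 : 0 < x.1^-1 by rewrite invr_gt0. have i2 : 0 < x.2^-1 by rewrite invr_gt0.
rewrite /Lam in Lx.
by split; apply/andP; split; (try lra); rewrite -[leRHS]invrK lef_pV2 ?posrE//; lra.
Qed.

Lemma derive_off_closure (f : R * R -> R) (e x : R * R) :
  ~ closure [set x | f x != 0] x -> 'D_e f x = 0.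
Proof.
move=> nx; have : \forall y \near x, f y = 0.
  have : \forall y \near x, (~` closure [set x | f x != 0]) y.
    by apply: open_nbhs_nbhs; split => //; apply: closed_openC; exact: closed_closure.
  apply: filterS => y ny; apply/eqP; apply: contrapT => /negP fy; apply: ny.
  exact: subset_closure.
move=> fx; rewrite /derive; apply: cvg_lim; first exact: norm_hausdorff.
apply: cvg_near_cst.
have c : (fun h : R => h *: e + x) @ (0 : R) --> (0 : R) *: e + x.
  by apply: cvgD; [apply: cvgZr_tmp; exact: cvg_id|exact: cvg_cst].
rewrite scale0r add0r in c; have {}c : (fun h : R => h *: e + x) @ (0 : R)^' --> x.
  exact: cvg_within_filter.
have : \forall h \near (0 : R)^', f (h *: e + x) = 0 := c _ fx.
apply: filterS => h /= ->.
by rewrite (nbhs_singleton fx) subrr scaler0.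
Qed.

Lemma C1c_props (f : R * R -> R) : C1c_quadrant f ->
  exists2 rho, 0 < rho &
    [/\ forall x, f x != 0 -> box rho x, forall x, partial_a f x != 0 -> box rho x,
      forall x, partial_v f x != 0 -> box rho x,
      continuous f & continuous (partial_a f) /\ continuous (partial_v f)].
Proof.
move=> [fC1 cC CQ]; have [rho r0 Cb] := compact_quadrant_box cC CQ; exists rho => //.
have h1 x : f x != 0 -> box rho x by move=> fx; apply: Cb; exact: subset_closure.
have h2 x : partial_a f x != 0 -> box rho x.
  by move=> fx; apply: Cb; apply: contrapT => /derive_off_closure h; rewrite /partial_a h eqxx in fx.
have h3 x : partial_v f x != 0 -> box rho x.
  by move=> fx; apply: Cb; apply: contrapT => /derive_off_closure h; rewrite /partial_v h eqxx in fx.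
split => //; [|split]; (apply: (box_ext_continuous r0) => // x Qx).
- exact: C1_continuous.
- by case: (fC1 _ Qx).
- by case: (fC1 _ Qx).
Qed.

End C1_functions.

(** * The limit profile *)

Section profile.
Context {R : realType}.
Variables (alpha beta mu sigma kappa v0 K0 K1 R0 R1 c : R)
  (K : (R * R) * (R * R) -> R) (r : R * R -> R).
Local Notation Q := (@quadrant R).
Local Notation schemes := (scheme alpha beta mu sigma kappa v0 K0 K1 R0 R1 c).
Variables (U : set_system nat) (X : nat -> schemes)
  (g : {measure set (R * R)%type -> \bar R}).
Hypotheses (alpha_gt0 : 0 < alpha) (beta01 : 0 < beta < 1) (mu_gt0 : 0 < mu)
  (kappa_gt0 : 0 < kappa) (v0_gt0 : 0 < v0) (K0_gt0 : 0 < K0) (K1_gt0 : 0 < K1)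
  (R0_gt0 : 0 < R0) (R1_gt0 : 0 < R1) (c_gt0 : 0 < c).
Hypotheses (cK : forall x y, Q x -> Q y -> {for (x, y), continuous K})
  (K_sym : forall x y, Q x -> Q y -> K (x, y) = K (y, x))
  (K_le : forall x y, Q x -> Q y -> 0 <= K (x, y) <=
     K0 * (x.2 `^ (- alpha) * y.2 `^ beta + y.2 `^ (- alpha) * x.2 `^ beta))
  (cr : forall x, Q x -> {for x, continuous r}).
Hypotheses (UU : UltraFilter U) (UN : \oo `<=` U)
  (refX : forall m, refined K r m.+4%:R (X m)) (gfin : (g setT < +oo)%E).

Let w m (s : st (X m)) : R := wt s.
Let z m (s : st (X m)) : R * R := pt s.
Arguments w : clear implicits.
Arguments z : clear implicits.

Hypothesis vague : forall f : R * R -> R, continuous f -> box_supported f ->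
  (fun m => \sum_s w m s * f (z m s)) @ U --> \int[g]_(x in @quadrant R) f x.

Let PU : ProperFilter U. Proof. exact: ultra_proper. Qed.
#[local] Existing Instance PU.

Let w0 m s : 0 <= w m s. Proof. exact: wt_ge0. Qed.
Let zQ m s : Q (z m s). Proof. by split; [exact: area_gt0|exact: vol_gt0]. Qed.

Let inhab m : st (X m).
Proof.
case: (pickP (@predT (st (X m)))) => [s _|none]; first exact: s.
by exfalso; move: v0_gt0; rewrite -(mass (X m)) big_pred0 ?ltxx.
Qed.

Let monomial_bound n k : exists2 C : R, 0 <= C &
  forall m, \sum_s w m s * ((z m s).1 `^ n * (z m s).2 `^ k) <= C.
Proof.
have [C C0 hC] := moment_bound sigma alpha_gt0 beta01 mu_gt0 kappa_gt0 v0_gt0 K0_gt0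
  K1_gt0 R0_gt0 R1_gt0 c_gt0 n k.
by exists C => // m; exact: (hC (X m)).
Qed.

(** [Lam] turns a monomial into a sum of four, so bounds on all monomials include the uniform
    integrability of each. *)
Lemma Lam_monomial (x : R * R) n k : Q x -> Lam x * (x.1 `^ n * x.2 `^ k) =
  x.1 `^ (n + 1) * x.2 `^ k + x.1 `^ (n - 1) * x.2 `^ k +
  (x.1 `^ n * x.2 `^ (k + 1) + x.1 `^ n * x.2 `^ (k - 1)).
Proof.
case=> x1 x2; have D (y p q : R) : 0 < y -> y `^ (p + q) = y `^ p * y `^ q.
  by move=> y0; rewrite powRD//; apply/implyP => _; rewrite gt_eqF.
by rewrite !D// !powRN !powRr1 ?ltW// /Lam; ring.
Qed.

Let moments n k : exists2 C : R, 0 <= C & forall m,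
  \sum_s w m s * ((z m s).1 `^ n * (z m s).2 `^ k) <= C /\
  \sum_s w m s * (Lam (z m s) * ((z m s).1 `^ n * (z m s).2 `^ k)) <= C.
Proof.
have [C1 C10 h1] := monomial_bound n k.
have [C2 C20 h2] := monomial_bound (n + 1) k; have [C3 C30 h3] := monomial_bound (n - 1) k.
have [C4 C40 h4] := monomial_bound n (k + 1); have [C5 C50 h5] := monomial_bound n (k - 1).
exists (C1 + (C2 + C3 + (C4 + C5))); first by rewrite !addr_ge0.
move=> m; split; first by rewrite ler_wpDr// !addr_ge0.
rewrite ler_wpDl//; apply: le_trans (lerD (lerD (h2 m) (h3 m)) (lerD (h4 m) (h5 m))).
rewrite -!big_split/= le_eqVlt; apply/orP; left; apply/eqP; apply: eq_bigr => s _.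
by rewrite Lam_monomial//; ring.
Qed.

Let cvg1 (x : R * R) : (fun y : R * R => y.1) @ x --> x.1. Proof. exact: cvg_fst. Qed.
Let cvg2 (x : R * R) : (fun y : R * R => y.2) @ x --> x.2. Proof. exact: cvg_snd. Qed.

Lemma powR_continuous_at (p y : R) : 0 < y -> {for y, continuous (fun t : R => t `^ p)}.
Proof.
move=> y0; rewrite /continuous_at.
have h : (fun t => expR (p * ln t)) @ y --> expR (p * ln y).
  apply: continuous_cvg; first exact: continuous_expR.
  apply: cvgM; first exact: cvg_cst.
  exact: continuous_ln.
rewrite -powRE// in h; apply: cvg_trans h; apply: near_eq_cvg.
have : \forall t \near y, 0 < t by exact: lt_nbhsr.
by apply: filterS => t t0; rewrite powRE.
Qed.

Lemma vol_powR_continuous k x : Q x -> {for x, continuous (fun y : R * R => y.2 `^ k)}.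
Proof.
move=> [x1 x2].
by apply: (@continuous_cvg _ _ _ (nbhs x) _ (fun y : R * R => y.2) (fun t : R => t `^ k) x.2);
  [exact: powR_continuous_at|exact: cvg2].
Qed.

Lemma monomial_continuous n k x : Q x -> {for x, continuous (fun y : R * R => y.1 `^ n * y.2 `^ k)}.
Proof.
move=> Qx; have [x1 _] := Qx; apply: cvgM; last exact: vol_powR_continuous.
by apply: (@continuous_cvg _ _ _ (nbhs x) _ (fun y : R * R => y.1) (fun t : R => t `^ n) x.1);
  [exact: powR_continuous_at|exact: cvg1].
Qed.

Lemma limit_moment n k : (moment g n k < +oo)%E.
Proof.
have [C _ hC] := moments n k; apply: le_lt_trans (ltry C).
apply: (limit_moment_le UU w0 zQ gfin vague).
- by move=> x; exact: monomial_continuous.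
- by move=> x _; rewrite mulr_ge0// powR_ge0.
- by move=> m; have [] := hC m.
Qed.

Lemma limit_mass : (\int[g]_(x in Q) (x.2)%:E)%E = v0%:E.
Proof.
have [C _ hC] := moments 0 1.
have E1 (x : R * R) : Q x -> x.1 `^ 0 * x.2 `^ 1 = x.2.
  by case=> x1 x2; rewrite powRr0 powRr1 ?mul1r// ltW.
have h1 : (fun m => \sum_s w m s * (z m s).2) @ U --> \int[g]_(x in Q) x.2.
  apply: (dominated_limit UU w0 zQ gfin vague (C := C) (F := fun x => x.2)).
  - by move=> x Qx; exact: cvg2.
  - by move=> x Qx; exact: cvg2.
  - by move=> x [_ x2]; rewrite gtr0_norm.
  - move=> m; have [h _] := hC m; apply: le_trans h; rewrite le_eqVlt; apply/orP; left; apply/eqP.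
    by apply: eq_bigr => s _; rewrite E1.
  - move=> m; have [_ h] := hC m; apply: le_trans h; rewrite le_eqVlt; apply/orP; left; apply/eqP.
    by apply: eq_bigr => s _; rewrite E1.
have h2 : (fun m => \sum_s w m s * (z m s).2) @ U --> v0.
  rewrite (_ : (fun m => _) = cst v0); first exact: cvg_cst.
  by apply/funext => m; exact: mass.
rewrite -(cvgr_uniq h1 h2) /Rintegral fineK//; apply: integrable_fin_num.
  exact: quadrant_measurable.
apply: (limit_moment_integrable UU w0 zQ gfin vague (C := C)).
- by move=> x _; exact: cvg2.
- by move=> x [_ /ltW].
- move=> m; have [h _] := hC m; apply: le_trans h; rewrite le_eqVlt; apply/orP; left; apply/eqP.
  by apply: eq_bigr => s _; rewrite E1.
Qed.

Lemma limit_alpha_beta :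
  (\int[g]_(x in Q) (x.2 `^ (- alpha) + x.2 `^ beta)%:E < +oo)%E.
Proof.
have [C _ hC] := moments 0 (- alpha); have [C' _ hC'] := moments 0 beta.
apply: le_lt_trans (ltry (C + C')); apply: (limit_moment_le UU w0 zQ gfin vague).
- by move=> x Qx; apply: cvgD; exact: vol_powR_continuous.
- by move=> x _; rewrite addr_ge0// powR_ge0.
- move=> m; have [h _] := hC m; have [h' _] := hC' m; apply: le_trans (lerD h h').
  rewrite -big_split/= le_eqVlt; apply/orP; left; apply/eqP.
  by apply: eq_bigr => s _; rewrite !powRr0 !mul1r mulrDr.
Qed.

(** The function f is twice the positive part of c v^(2/3) - a. It vanishes at every state, so its
    integral in the limit is zero and it vanishes almost everywhere. *)
Lemma limit_isoperimetric : g [set x | quadrant x /\ x.1 < c * x.2 `^ (2 / 3)] = 0%E.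
Proof.
have [C C0 hC] := moments 0 (2 / 3).
pose f (x : R * R) : R := `|c * x.2 `^ (2 / 3) - x.1| + (c * x.2 `^ (2 / 3) - x.1).
pose F (x : R * R) : R := 2 * c * (x.1 `^ 0 * x.2 `^ (2 / 3)).
have cF x : Q x -> {for x, continuous F}.
  by move=> Qx; apply: cvgM; [exact: cvg_cst|exact: monomial_continuous].
have c3 x : Q x -> (fun y : R * R => c * y.2 `^ (2 / 3) - y.1) @ x --> c * x.2 `^ (2 / 3) - x.1.
  move=> Qx; apply: cvgB; last exact: cvg1.
  apply: cvgM; first exact: cvg_cst.
  exact: vol_powR_continuous.
have cf x : Q x -> {for x, continuous f}.
  by move=> /c3 h; apply: cvgD => //; exact: cvg_norm.
have f0 (x : R * R) : 0 <= f x.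
  by rewrite /f -lerBlDr sub0r -normrN ler_norm.
have fF x : Q x -> `|f x| <= F x.
  move=> [x1 x2]; rewrite ger0_norm// /f /F powRr0 mul1r.
  have p0 : 0 <= x.2 `^ (2 / 3) by exact: powR_ge0.
  have cp : 0 <= c * x.2 `^ (2 / 3) by rewrite mulr_ge0// ltW.
  by have [h|h] := leP 0 (c * x.2 `^ (2 / 3) - x.1); [rewrite ger0_norm//|rewrite ltr0_norm//]; lra.
have FC m : \sum_s w m s * F (z m s) <= 2 * c * C.
  rewrite (eq_bigr (fun s => 2 * c * (w m s * ((z m s).1 `^ 0 * (z m s).2 `^ (2 / 3))))).
    by rewrite -mulr_sumr ler_wpM2l ?mulr_ge0 ?(ltW c_gt0)//; have [] := hC m.
  by move=> s _; rewrite /F; ring.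
have LFC m : \sum_s w m s * (Lam (z m s) * F (z m s)) <= 2 * c * C.
  rewrite (eq_bigr (fun s => 2 * c * (w m s * (Lam (z m s) * ((z m s).1 `^ 0 * (z m s).2 `^ (2 / 3)))))).
    by rewrite -mulr_sumr ler_wpM2l ?mulr_ge0 ?(ltW c_gt0)//; have [] := hC m.
  by move=> s _; rewrite /F; ring.
have h1 := dominated_limit UU w0 zQ gfin vague cf cF fF FC LFC.
have h2 : (fun m => \sum_s w m s * f (z m s)) @ U --> (0 : R).
  rewrite (_ : (fun m => _) = cst 0); first exact: cvg_cst.
  apply/funext => m; apply: big1 => s _; rewrite /f ler0_norm ?addNr ?mulr0//.
  by rewrite subr_le0; exact: area_ge.
have int0 := cvgr_uniq h1 h2.
have intf : g.-integrable Q (EFin \o f).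
  apply: (limit_moment_integrable UU w0 zQ gfin vague (C := 2 * c * C)) => // m.
  apply: le_trans (FC m); apply: ler_sum => s _; rewrite ler_wpM2l//.
  by apply: le_trans (fF _ (zQ s)); exact: ler_norm.
have mf := measurable_int _ intf.
have fin := integrable_fin_num quadrant_measurable intf.
have int0E : (\int[g]_(x in Q) `|(EFin \o f) x| = 0)%E.
  rewrite (eq_integral (EFin \o f)); last by move=> x _ /=; rewrite ger0_norm.
  by rewrite -(fineK fin) -[X in _ = X]/(0%:E) -int0.
have ae0 := (ae_eq_integral_abs g quadrant_measurable mf).1 int0E.
have Eset : [set x | Q x /\ x.1 < c * x.2 `^ (2 / 3)] = Q `&` [set x | (0 < (EFin \o f) x)%E].
  apply/seteqP; split=> x /= [Qx h]; split => //.
    have h' : 0 < c * x.2 `^ (2 / 3) - x.1 by rewrite subr_gt0.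
    by rewrite lte_fin /f gtr0_norm// addr_gt0.
  rewrite lte_fin /f in h; rewrite ltNge; apply/negP => h'.
  by move: h; rewrite ler0_norm ?subr_le0// addNr ltxx.
rewrite Eset; apply: measure_negligible.
  exact: (emeasurable_fun_o_infty quadrant_measurable mf 0%E).
apply: negligibleS ae0 => x [Qx] /= fx h.
by move: fx; rewrite h// ltxx.
Qed.

Let N m : R := m.+4%:R.

Let N_gt0 m : 0 < N m. Proof. by rewrite /N. Qed.

Let N_ge1 m : 1 <= N m. Proof. by rewrite /N ler1n. Qed.

Let N_inv : (fun m => (N m)^-1) @ U --> (0 : R).
Proof.
apply: (@squeeze_cvgr _ _ _ _ (cst 0) (fun m => 1 / m.+1%:R)); last 2 first.
- exact: cvg_cst.
- exact: near0_div_nat.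
apply: filterS filterT => m _ /=; rewrite invr_ge0 (ltW (N_gt0 m)) mul1r lef_pV2 ?posrE//.
by rewrite ler_nat -addn4 -addn1 leq_add2l.
Qed.

Let N_large (b : R) : U [set m | b < N m].
Proof.
apply: UN; exists (Num.truncn b) => // m /= bm; apply: lt_le_trans (truncnS_gt _) _.
by rewrite ler_nat ltnS (leq_trans bm)// -addn3 leq_addr.
Qed.

Let N_expR_cvg (q : R) : (fun m => N m * (expR (q / N m) - 1)) @ U --> q.
Proof.
apply: (@squeeze_cvgr _ _ _ _ (cst q) (fun m => q * expR (q / N m))).
- apply: filterS filterT => m _ /=; set t := q / N m.
  have qt : q = N m * t by rewrite /t mulrCA divff ?mulr1// gt_eqF.
  rewrite [X in X <= _ <= _]qt [X in _ <= _ <= X * _]qt -mulrA !ler_pM2l//; apply/andP; split.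
    by rewrite lerBrDl; exact: expR_ge1Dx.
  have := expR_ge1Dx (- t); rewrite -(ler_pM2r (expR_gt0 t)) -expRD addNr expR0; lra.
- exact: cvg_cst.
- rewrite -[X in _ --> X]mulr1; apply: cvgM; first exact: cvg_cst.
  rewrite -expR0; apply: continuous_cvg; first exact: continuous_expR.
  by rewrite -[X in _ --> X](mulr0 q); apply: cvgM; [exact: cvg_cst|exact: N_inv].
Qed.

Let N_small (k : nat -> R) (q : R) : (fun m => N m * k m) @ U --> q -> k @ U --> (0 : R).
Proof.
move=> kq; rewrite (_ : k = fun m => (N m)^-1 * (N m * k m)).
  by rewrite -[X in _ --> X](mul0r q); apply: cvgM.
by apply/funext => m; rewrite mulrA mulVf ?mul1r// gt_eqF.
Qed.

Lemma box_le (rho rho' : R) x : 0 < rho -> rho <= rho' -> box rho x -> box rho' x.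
Proof.
move=> r0 rr [/andP[h1 h2] /andP[h3 h4]].
have i : rho'^-1 <= rho^-1 by rewrite lef_pV2// posrE// (lt_le_trans r0).
by split; apply/andP; split; [exact: le_trans h1|exact: le_trans rr|exact: le_trans h3|exact: le_trans rr].
Qed.

Variables (phi : R * R -> R) (rho : R).
Hypotheses (rho_gt0 : 0 < rho) (phiC1 : C1_quadrant phi)
  (bphi : forall x, phi x != 0 -> box rho x)
  (ba : forall x, partial_a phi x != 0 -> box rho x)
  (bv : forall x, partial_v phi x != 0 -> box rho x)
  (cphi : continuous phi) (ca : continuous (partial_a phi)) (cv : continuous (partial_v phi)).

(** The balance carries a factor [vol], which this division compensates. *)
Let psi m (s : st (X m)) : R := phi (pt s) / vol s.

Let phi_increment_a l (x : nat -> R * R) (h k : nat -> R) (q : R) : Q l -> x @ U --> l -> h @ U --> (0 : R) ->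
  (fun m => k m * h m) @ U --> q ->
  (fun m => k m * (phi (x m + h m *: ((1, 0) : R * R)) - phi (x m))) @ U --> q * partial_a phi l.
Proof.
move=> Ql xl h0 kq; have [da _] := C1_near_derivable phiC1 Ql.
exact: (@increment_cvg R U _ phi ((1, 0) : R * R) l x h k q da (@ca l) xl h0 kq).
Qed.

Let phi_increment_v l (x : nat -> R * R) (h k : nat -> R) (q : R) : Q l -> x @ U --> l -> h @ U --> (0 : R) ->
  (fun m => k m * h m) @ U --> q ->
  (fun m => k m * (phi (x m + h m *: ((0, 1) : R * R)) - phi (x m))) @ U --> q * partial_v phi l.
Proof.
move=> Ql xl h0 kq; have [_ dv] := C1_near_derivable phiC1 Ql.
exact: (@increment_cvg R U _ phi ((0, 1) : R * R) l x h k q dv (@cv l) xl h0 kq).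
Qed.

Let coord1 (x : nat -> R * R) (l : R * R) : x @ U --> l -> (fun m => (x m).1) @ U --> l.1.
Proof.
move=> xl; apply: (@continuous_cvg _ _ _ U _ x (fun y : R * R => y.1) l); [exact: cvg1|exact: xl].
Qed.

Let coord2 (x : nat -> R * R) (l : R * R) : x @ U --> l -> (fun m => (x m).2) @ U --> l.2.
Proof.
move=> xl; apply: (@continuous_cvg _ _ _ U _ x (fun y : R * R => y.2) l); [exact: cvg2|exact: xl].
Qed.

Let coordP (u v : nat -> R) (p q : R) : u @ U --> p -> v @ U --> q -> (fun m => (u m, v m)) @ U --> (p, q).
Proof. by move=> up vq; exact: (@cvg_pair _ _ _ U (nbhs p) (nbhs q)). Qed.

(** Because of the division in [psi], a step from x to y contributes N (exp(1/N) phi(y) - phi(x)).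
    The excess N (exp(1/N) - 1) tends to 1 and produces the term without derivative; the increments
    in v and in a produce the other two. *)
Lemma shrink_limit :
  (fun m => \sum_s w m s * (vol s * (speed (X m) * (psi (shrink s) - psi s)))) @ U -->
  \int[g]_(x in Q) (phi x - 2 / 3 * (x.1 * partial_a phi x) - x.2 * partial_v phi x).
Proof.
have [C _ hC] := moments 0 0.
have wW m : \sum_s w m s <= C.
  have [h _] := hC m; apply: le_trans h; rewrite le_eqVlt; apply/orP; left; apply/eqP.
  by apply: eq_bigr => s _; rewrite !powRr0 !mulr1.
(* One step divides each coordinate by at most exp 1. *)
pose rho' := expR 1 * rho.
have r' : 0 < rho' by rewrite mulr_gt0// expR_gt0.
have e1 : 1 <= expR 1 :> R by rewrite -[X in X <= _]expR0 ler_expR.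
have rr : rho <= rho' by rewrite ler_peMl// ltW.
apply: (states_limit UU w0 wW inhab vague (G_ := fun m s => vol s * (speed (X m) * (psi (shrink s) - psi s)))
   (G := fun x => phi x - 2 / 3 * (x.1 * partial_a phi x) - x.2 * partial_v phi x) (rho := rho')) => //.
- move=> x; apply: cvgB; first apply: cvgB.
  + exact: cphi.
  + by apply: cvgM; [exact: cvg_cst|apply: cvgM; [exact: cvg1|exact: ca]].
  + by apply: cvgM; [exact: cvg2|exact: cv].
- move=> x; have [p0|/bphi h _] := eqVneq (phi x) 0; last exact: box_le h.
  have [a0|/ba h _] := eqVneq (partial_a phi x) 0; last exact: box_le h.
  have [v0'|/bv h _] := eqVneq (partial_v phi x) 0; last exact: box_le h.
  by rewrite p0 a0 v0' !mulr0 !subr0 eqxx.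
- apply: filterS filterT => m _ s; rewrite /psi.
  have [p0|/bphi h _] := eqVneq (phi (pt s)) 0; last exact: box_le h.
  have [e|[-> _]] := refined_shrink (refX m) s; last by rewrite subrr !mulr0 eqxx.
  rewrite e p0 mul0r subr0 => nz.
  have /bphi[] : phi (expR (- (2 / 3) / N m) * area s, expR (- (N m)^-1) * vol s) != 0.
    by apply: contra_neq nz => ->; rewrite mul0r !mulr0.
  have bd (t y : R) : 0 <= t <= 1 -> 0 < y -> rho^-1 <= expR (- t) * y <= rho -> rho'^-1 <= y <= rho'.
    move=> /andP[t0 t1] y0 /andP[h1 h2]; apply/andP; split.
      apply: le_trans (_ : rho^-1 <= _); first by rewrite lef_pV2.
      apply: (le_trans h1); rewrite ler_piMl ?(ltW y0)//.
      by rewrite -expR0 ler_expR oppr_le0.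
    have -> : y = expR t * (expR (- t) * y) by rewrite mulrA -expRD subrr expR0 mul1r.
    by apply: ler_pM => //; rewrite ?expR_ge0 ?mulr_ge0 ?expR_ge0 ?(ltW y0)// ler_expR.
  have /andP[Ni0 Ni1] : 0 <= (N m)^-1 <= 1.
    by rewrite invr_ge0 (ltW (N_gt0 m)) invf_le1 ?N_gt0 ?N_ge1.
  rewrite mulNr => h1 h2; split.
    by apply: bd h1; [apply/andP; split|exact: area_gt0];
      [rewrite mulr_ge0//; lra|apply: le_trans Ni1; rewrite ler_piMl//; lra].
  by apply: bd h2; [rewrite Ni0|exact: vol_gt0].
move=> s l bl sl; have Ql := box_quadrant r' bl; have [l1 l2] := Ql.
pose x m := z m (s m); have xl : x @ U --> l by exact: sl.
pose h1 m := (expR (- (2 / 3) / N m) - 1) * (x m).1.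
pose h2 m := (expR (- (N m)^-1) - 1) * (x m).2.
have Nh1 : (fun m => N m * h1 m) @ U --> - (2 / 3) * l.1.
  rewrite (_ : (fun m => _) = fun m => N m * (expR (- (2 / 3) / N m) - 1) * (x m).1).
    by apply: cvgM; [exact: N_expR_cvg|exact: coord1].
  by apply/funext => m; rewrite /h1 mulrA.
have Nh2 : (fun m => N m * h2 m) @ U --> - 1 * l.2.
  rewrite (_ : (fun m => _) = fun m => N m * (expR (- 1 / N m) - 1) * (x m).2).
    by apply: cvgM; [exact: N_expR_cvg|exact: coord2].
  by apply/funext => m; rewrite /h2 mulrA mulN1r.
pose x' m := x m + h1 m *: ((1, 0) : R * R).
pose y m := x' m + h2 m *: ((0, 1) : R * R).
have shift (u : nat -> R * R) (h : nat -> R) e : u @ U --> l -> h @ U --> (0 : R) ->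
    (fun m => u m + h m *: e) @ U --> l.
  move=> ul h0; have : (fun m => u m + h m *: e) @ U --> l + (0 : R) *: e.
    by apply: cvgD => //; exact: cvgZr_tmp.
  by rewrite scale0r addr0.
have x'l : x' @ U --> l by apply: shift => //; exact: N_small Nh1.
have yl : y @ U --> l by apply: shift => //; exact: N_small Nh2.
have main : (fun m => N m * (expR (1 / N m) - 1) * phi (y m) + N m * (phi (y m) - phi (x' m)) +
    N m * (phi (x' m) - phi (x m))) @ U -->
    1 * phi l + (- 1 * l.2) * partial_v phi l + (- (2 / 3) * l.1) * partial_a phi l.
  apply: cvgD; first apply: cvgD.
  - apply: cvgM; first exact: N_expR_cvg.
    by apply: continuous_cvg => //; exact: cphi.
  - by apply: phi_increment_v => //; exact: N_small Nh2.
  - by apply: phi_increment_a => //; exact: N_small Nh1.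
rewrite (_ : _ - _ - _ = 1 * phi l + (- 1 * l.2) * partial_v phi l +
  (- (2 / 3) * l.1) * partial_a phi l); last by ring.
apply: cvg_trans main; apply: near_eq_cvg.
(* The volume stays away from 0, hence eventually above the lowest grid value, and the step is a
   regular one. *)
have low : U [set m | l.2 / 2 < (x m).2].
  have c2 := coord2 xl; apply: (c2 [set t : R | l.2 / 2 < t]).
  by apply: lt_nbhsr; rewrite ltr_pdivrMr//; lra.
apply: filterS2 low (N_large (2 / l.2)) => m /= low Nl.
have [e|[_ vs]] := refined_shrink (refX m) (s m); last first.
  exfalso; have : expR (- N m) < l.2 / 2.
    rewrite expRN -[X in _ < X]invrK ltf_pV2 ?posrE ?expR_gt0 ?invr_gt0 ?divr_gt0//.
    rewrite invf_div; apply: (lt_le_trans Nl); apply: le_trans (expR_ge1Dx _).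
    by rewrite lerDr.
  by move=> h; move: (lt_le_trans low vs); rewrite ltNge (ltW h).
have yE : pt (shrink (s m)) = y m.
  rewrite e /y /x' /h1 /h2 /x /z /pt; congr pair => /=; rewrite /GRing.scale/=; ring.
have vE : vol (shrink (s m)) = expR (- (N m)^-1) * vol (s m) by have := congr1 snd e.
rewrite /psi yE vE (refined_speed (refX m)) -/(N m) mul1r -/(z m (s m)) -/(x m).
have vn : vol (s m) != 0 by rewrite gt_eqF// vol_gt0.
rewrite invfM -expRN opprK; field; by rewrite vn.
Qed.

Let mass_le : exists C : R, forall m, \sum_s w m s <= C.
Proof.
have [C _ hC] := moments 0 0; exists C => m.
have [h _] := hC m; apply: le_trans h; rewrite le_eqVlt; apply/orP; left; apply/eqP.
by apply: eq_bigr => s _; rewrite !powRr0 !mulr1.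
Qed.

Lemma aspect_cvg (x : nat -> R * R) (l : R * R) : Q l -> x @ U --> l ->
  (fun m => aspect (x m)) @ U --> aspect l.
Proof.
move=> Ql xl; have [l1 l2] := Ql; apply: cvgM; first exact: coord1 xl.
apply: cvgV; first by rewrite gt_eqF// powR_gt0.
apply: (@continuous_cvg _ _ _ U _ (fun m => (x m).2) (fun t : R => t `^ (2 / 3)) l.2).
  exact: powR_continuous_at.
exact: coord2 xl.
Qed.

Lemma fuse_limit :
  (fun m => \sum_s w m s * (vol s * (frate s * (psi (fuse s) - psi s)))) @ U -->
  \int[g]_(x in Q) (r x * (c * x.2 `^ (2 / 3) - x.1) * partial_a phi x).
Proof.
have [C wW] := mass_le.
(* Fusion lowers the area by at most v^(2/3) <= 1 + v, with v <= rho. *)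
have [rho' rE] : exists rho', rho' = 2 * rho + 1 by eexists.
have r' : 0 < rho' by rewrite rE; have := rho_gt0; lra.
have rr : rho <= rho' by rewrite rE; have := rho_gt0; lra.
have supp x : r x * (c * x.2 `^ (2 / 3) - x.1) * partial_a phi x != 0 -> box rho' x.
  by rewrite mulf_eq0 negb_or => /andP[_ /ba h]; apply: box_le h.
apply: (states_limit UU w0 wW inhab vague (G_ := fun m s => vol s * (frate s * (psi (fuse s) - psi s)))
   (G := fun x => r x * (c * x.2 `^ (2 / 3) - x.1) * partial_a phi x) (rho := rho')).
- exact: r'.
- apply: (box_ext_continuous r' _ supp) => x Qx.
  apply: cvgM; last exact: ca.
  apply: cvgM; first exact: cr.
  apply: cvgB; last exact: cvg1.
  by apply: cvgM; [exact: cvg_cst|exact: vol_powR_continuous].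
- exact: supp.
- apply: filterS filterT => m _ s; rewrite /psi vol_fuse.
  have [p0|/bphi h _] := eqVneq (phi (pt s)) 0; last exact: box_le h.
  have [e|e] := refined_fuse (refX m) s; last first.
    by rewrite (refined_frate (refX m)) e subrr !(mulr0, mul0r) eqxx.
  rewrite e p0 mul0r subr0 => nz.
  have /bphi[/= h1 h2] : phi (area s - vol s `^ (2 / 3) / N m, vol s) != 0.
    by apply: contra_neq nz => ->; rewrite mul0r !mulr0.
  have vs := vol_gt0 s; move: h1 h2 => /andP[h1 h1'] /andP[h2 h2'].
  have p0' : 0 <= vol s `^ (2 / 3) by exact: powR_ge0.
  have p1 : vol s `^ (2 / 3) / N m <= vol s `^ (2 / 3).
    by rewrite ler_pdivrMr// ler_peMr.
  have p2 : 0 <= vol s `^ (2 / 3) / N m by rewrite divr_ge0// ltW.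
  have p3 : vol s `^ (2 / 3) <= 1 + vol s.
    have := @powR_le_add R (vol s) 0 (2 / 3) 1 vs; rewrite powRr0 powRr1 ?(ltW vs)//.
    by apply; lra.
  have i : rho'^-1 <= rho^-1 by rewrite lef_pV2// posrE.
  move: h1 h1' h2 h2' i; rewrite /= /box/= => h1 h1' h2 h2' i.
  move: p1 p2 h1 h1'; move: (vol s `^ (2 / 3) / N m) => q p1 p2 h1 h1'.
  by split; apply/andP; split; lra.
move=> s l bl sl; have Ql := box_quadrant r' bl; have [l1 l2] := Ql.
pose x m := z m (s m); have xl : x @ U --> l by exact: sl.
pose h m := - ((x m).2 `^ (2 / 3)) / N m.
have Nh : (fun m => N m * h m) @ U --> - (l.2 `^ (2 / 3)).
  rewrite (_ : (fun m => _) = fun m => - ((x m).2 `^ (2 / 3))).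
    apply: cvgN; apply: (@continuous_cvg _ _ _ U _ (fun m => (x m).2) (fun t : R => t `^ (2 / 3)) l.2).
      exact: powR_continuous_at.
    exact: coord2 xl.
  by apply/funext => m; rewrite /h mulrCA divff ?mulr1// gt_eqF.
have main : (fun m => r (x m) * (aspect (x m) - c) *
      (N m * (phi (x m + h m *: ((1, 0) : R * R)) - phi (x m)))) @ U -->
    r l * (aspect l - c) * (- (l.2 `^ (2 / 3)) * partial_a phi l).
  apply: cvgM; last by apply: phi_increment_a; [exact: Ql|exact: xl|exact: N_small Nh|exact: Nh].
  apply: cvgM; first by apply: (@continuous_cvg _ _ _ U _ x r l); [exact: cr|exact: xl].
  by apply: cvgB; [exact: aspect_cvg|exact: cvg_cst].
(* Multiplying aspect - c by - v^(2/3) gives c v^(2/3) - a. *)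
rewrite (_ : _ * partial_a phi l = r l * (aspect l - c) * (- (l.2 `^ (2 / 3)) * partial_a phi l)); last first.
  have pn : l.2 `^ (2 / 3) != 0 by rewrite gt_eqF// powR_gt0.
  by rewrite /aspect; field; rewrite pn.
apply: cvg_trans main; apply: near_eq_cvg; apply: filterS filterT => m _.
rewrite /psi vol_fuse (refined_frate (refX m)) -/(z m (s m)) -/(x m) -/(N m).
have vn : vol (s m) != 0 by rewrite gt_eqF// vol_gt0.
have [e|e] := refined_fuse (refX m) (s m); last first.
  by rewrite -/(z m (s m)) -/(x m) in e; rewrite e subrr !(mulr0, mul0r).
have yE : pt (fuse (s m)) = x m + h m *: ((1, 0) : R * R).
  rewrite e /h /x /z /pt; congr pair => /=; rewrite /GRing.scale/=; [|ring].
  by rewrite -/(N m); ring.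
by rewrite yE; field; rewrite vn.
Qed.

(* The symmetrised integrand of the coalescence term, the first factor being the
   trace of the discretisation of v + v'. *)
Let jump m (s s' : st (X m)) : R :=
  ker s s' * ((vol s + vol s') / vol (coalesce s s') * phi (pt (coalesce s s')) -
    phi (pt s) - phi (pt s')).

Let vol_ratio m (s s' : st (X m)) :
  1 <= (vol s + vol s') / vol (coalesce s s') <= 2.
Proof.
have t0 := vol_gt0 (coalesce s s'); have h1 := vol_coalesce_ge s s'.
have := vol_coalesce_ge s' s; rewrite (refined_coalesceC (refX m)) => h2.
rewrite ler_pdivlMr// ler_pdivrMr// mul1r vol_coalesce_le mulr_natl mulr2n.
exact: lerD.
Qed.

(** Along convergent states the upper ends of the grids are eventually out of reach, so rounding
    divides the volume by a factor between 1 and exp(1/N) and lowers the aspect by at most 1/N; the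
    area is recovered from both. *)
Let coalesce_cvg (s s' : forall m, st (X m)) l l' : Q l -> Q l' ->
  (fun m => z m (s m)) @ U --> l -> (fun m => z m (s' m)) @ U --> l' ->
  (fun m => (vol (s m) + vol (s' m)) / vol (coalesce (s m) (s' m))) @ U --> (1 : R) /\
  (fun m => pt (coalesce (s m) (s' m))) @ U --> l + l'.
Proof.
move=> Ql Ql' sl sl'; have [l1 l2] := Ql; have [l1' l2'] := Ql'.
have Qll : Q (l + l') by split; rewrite /= addr_gt0.
pose x m := z m (s m) + z m (s' m); have xl : x @ U --> l + l' by apply: cvgD.
pose T m := coalesce (s m) (s' m).
have xv m : (x m).2 = vol (s m) + vol (s' m) by [].
have xl2 := coord2 xl; have xl1 := coord1 xl; have xla := aspect_cvg Qll xl.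
have vbig : U [set m | (x m).2 < (l + l').2 + 1].
  by apply: (xl2 [set t : R | t < (l + l').2 + 1]); apply: lt_nbhsl; rewrite ltrDl.
have abig : U [set m | aspect (x m) < aspect (l + l') + 1].
  by apply: (xla [set t : R | t < aspect (l + l') + 1]); apply: lt_nbhsl; rewrite ltrDl.
have vT : U [set m | (x m).2 < expR (N m)^-1 * vol (T m)].
  apply: filterS2 vbig (N_large ((l + l').2 + 1)) => m /= h1 h2.
  have [e|//] := refined_vol_coalesce (refX m) (s m) (s' m).
  exfalso; have := vol_coalesce_le (s m) (s' m); rewrite e -xv leNgt => /negP; apply.
  apply: (lt_le_trans h1); apply: (le_trans (ltW h2)); apply: le_trans (expR_ge1Dx _).
  by rewrite lerDr.
have aT : U [set m | aspect (x m) - (N m)^-1 < aspect (pt (T m))].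
  apply: filterS2 abig (N_large (aspect (l + l') + 1 - c)) => m /= h1 h2.
  have [e|] := refined_aspect_coalesce (refX m) (s m) (s' m); last by rewrite -ltrBlDr.
  exfalso; have := refined_aspect_coalesce_le (refX m) (s m) (s' m).
  rewrite e -/(x m) leNgt => /negP; apply; apply: (lt_trans h1).
  by rewrite -ltrBlDl.
have eN : (fun m => expR (N m)^-1) @ U --> (1 : R).
  rewrite -expR0; apply: (@continuous_cvg _ _ _ U _ (fun m => (N m)^-1) expR 0).
    exact: continuous_expR.
  exact: N_inv.
have ratio : (fun m => (x m).2 / vol (T m)) @ U --> (1 : R).
  apply: (@squeeze_cvgr _ _ _ _ (cst 1) (fun m => expR (N m)^-1)); last 2 first.
  - exact: cvg_cst.
  - exact: eN.
  apply: filterS vT => m h; apply/andP; split.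
    by have /andP[] := vol_ratio (s m) (s' m).
  by rewrite ler_pdivrMr ?vol_gt0//; exact: ltW.
have volT : (fun m => vol (T m)) @ U --> (l + l').2.
  rewrite (_ : (fun m => _) = fun m => (x m).2 / ((x m).2 / vol (T m))).
    rewrite -[X in _ --> X]divr1; apply: cvgM; first exact: xl2.
    by apply: cvgV; [exact: oner_neq0|exact: ratio].
  apply/funext => m; have v1 := vol_gt0 (s m); have v2 := vol_gt0 (s' m).
  have vx : (x m).2 != 0 by rewrite xv gt_eqF// addr_gt0.
  by rewrite invf_div mulrCA divff// mulr1.
have aspT : (fun m => aspect (pt (T m))) @ U --> aspect (l + l').
  apply: (@squeeze_cvgr _ _ _ _ (fun m => aspect (x m) - (N m)^-1) (fun m => aspect (x m))); last 2 first.
  - rewrite -[X in _ --> X]subr0; apply: cvgB; [exact: xla|exact: N_inv].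
  - exact: xla.
  apply: filterS aT => m /= /ltW -> /=; exact: (refined_aspect_coalesce_le (refX m)).
split; first exact: ratio.
have areaT : (fun m => area (T m)) @ U --> (l + l').1.
  have Ea (y : R * R) : 0 < y.2 -> y.1 = aspect y * y.2 `^ (2 / 3).
    by move=> y0; rewrite /aspect divfK// gt_eqF// powR_gt0.
  have Qll2 : 0 < (l + l').2 by case: Qll.
  rewrite (Ea _ Qll2) (_ : (fun m => _) = fun m => aspect (pt (T m)) * (vol (T m)) `^ (2 / 3)).
    apply: cvgM; first exact: aspT.
    apply: (@continuous_cvg _ _ _ U _ (fun m => vol (T m)) (fun t : R => t `^ (2 / 3)) (l + l').2).
      exact: powR_continuous_at.
    exact: volT.
  by apply/funext => m; rewrite -[LHS]/((pt (T m)).1) Ea//; exact: vol_gt0.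
rewrite (surjective_pairing (l + l')); exact: coordP areaT volT.
Qed.

(** Averaging over the exchange of s and s' yields [jump] and the factor 1/2. If P bounds phi, the
    bracket in [jump] is at most 4 P because the ratio of volumes is at most 2, and the kernel bound
    supplies the dominating products. *)
Lemma coalesce_limit :
  (fun m => \sum_s \sum_s' w m s * w m s' *
     (vol s * (ker s s' * (psi (coalesce s s') - psi s)))) @ U -->
  2^-1 * \int[g]_(x in Q) \int[g]_(y in Q) (K (x, y) * (phi (x + y) - phi x - phi y)).
Proof.
have sym m : \sum_s \sum_s' w m s * w m s' * (vol s * (ker s s' * (psi (coalesce s s') - psi s))) =
    2^-1 * \sum_s \sum_s' w m s * w m s' * jump s s'.
  pose f (s s' : st (X m)) := vol s * (ker s s' * (psi (coalesce s s') - psi s)).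
  rewrite -[LHS]/(EE f); have h : EE f + EE f = \sum_s \sum_s' w m s * w m s' * jump s s'.
    rewrite {2}EEC /EE -big_split; apply: eq_bigr => s _; rewrite -big_split; apply: eq_bigr => s' _.
    rewrite /= -mulrDr /f /jump /psi; congr (_ * _).
    rewrite (refined_coalesceC (refX m) s') !(refined_ker (refX m)) (K_sym (zQ s') (zQ s)).
    have n1 : vol s != 0 by rewrite gt_eqF// vol_gt0.
    have n2 : vol s' != 0 by rewrite gt_eqF// vol_gt0.
    have n3 : vol (coalesce s s') != 0 by rewrite gt_eqF// vol_gt0.
    by rewrite /z; field; rewrite n1 n2 n3.
  by rewrite -h; field.
under eq_fun do rewrite sym.
apply: cvgM; first exact: cvg_cst.
have [W wW] := mass_le.
have [P phiP] := box_supported_bounded cphi (ex_intro2 _ _ rho rho_gt0 bphi).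
have P0 : 0 <= P by exact: le_trans (phiP (0, 0)).
have [C1 C10 h1] := moments 0 (- alpha); have [C2 C20 h2] := moments 0 beta.
pose k : R := 4 * K0 * P; have k0 : 0 <= k by rewrite !mulr_ge0// ltW.
pose A (x : R * R) : R := k * (x.1 `^ 0 * x.2 `^ (- alpha)).
pose B (x : R * R) : R := x.1 `^ 0 * x.2 `^ beta.
pose C := k * C1 + C2.
have bound x y (d : R) : Q x -> Q y -> `|d| <= 4 * P -> `|K (x, y) * d| <= A x * B y + B x * A y.
  move=> Qx Qy dP; have /andP[k1 k2] := K_le Qx Qy; rewrite normrM ger0_norm//.
  apply: le_trans (ler_pM k1 (normr_ge0 _) k2 dP) _.
  by rewrite /A /B /k !powRr0 !mul1r le_eqVlt; apply/orP; left; apply/eqP; ring.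
apply: (double_dominated_limit UU UN w0 zQ wW inhab gfin vague (H_ := jump)
  (H := fun x y => K (x, y) * (phi (x + y) - phi x - phi y)) (A := A) (B := B) (C := C)).
- move=> x y Qx Qy.
  have c1 : (fun p : (R * R) * (R * R) => p.1) @ (x, y) --> x by exact: cvg_fst.
  have c2 : (fun p : (R * R) * (R * R) => p.2) @ (x, y) --> y by exact: cvg_snd.
  have phi_cvg (u : (R * R) * (R * R) -> R * R) t : u @ (x, y) --> t ->
      (fun p => phi (u p)) @ (x, y) --> phi t.
    by move=> ut; apply: (@continuous_cvg _ _ _ (nbhs (x, y)) _ u phi t); [exact: cphi|exact: ut].
  apply: cvgM.
    rewrite (_ : (fun p => _) = K); first exact: cK.
    by apply/funext => -[].
  apply: cvgB; last exact: phi_cvg.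
  by apply: cvgB; apply: phi_cvg; [apply: cvgD; [exact: c1|exact: c2]|exact: c1].
- by move=> x Qx; apply: cvgM; [exact: cvg_cst|exact: monomial_continuous].
- by move=> x Qx; exact: monomial_continuous.
- by move=> x _; apply: mulr_ge0; [exact: k0|rewrite mulr_ge0 ?powR_ge0].
- by move=> x _; rewrite /B mulr_ge0 ?powR_ge0.
- move=> x y Qx Qy; apply: bound => //.
  apply: le_trans (ler_normB _ _) _; apply: le_trans (lerD (ler_normB _ _) (lexx _)) _.
  have := phiP (x + y); have := phiP x; have := phiP y; lra.
- move=> m s s'; rewrite /jump (refined_ker (refX m)); apply: bound; [exact: zQ|exact: zQ|].
  apply: le_trans (ler_normB _ _) _; apply: le_trans (lerD (ler_normB _ _) (lexx _)) _.
  have := phiP (pt s); have := phiP (pt s').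
  have : `|(vol s + vol s') / vol (coalesce s s') * phi (pt (coalesce s s'))| <= 2 * P.
    have /andP[r1 r2] := vol_ratio s s'; rewrite normrM; apply: ler_pM => //.
    by rewrite ger0_norm// (le_trans ler01).
  lra.
- move=> m; have [h _] := h1 m; apply: le_trans (_ : k * C1 <= _); last by rewrite lerDl.
  apply: le_trans (ler_wpM2l k0 h); rewrite mulr_sumr le_eqVlt; apply/orP; left; apply/eqP.
  by apply: eq_bigr => s _; rewrite /A; ring.
- by move=> m; have [h _] := h2 m; rewrite (le_trans h)// lerDr mulr_ge0.
- move=> m; have [_ h] := h1 m; apply: le_trans (_ : k * C1 <= _); last by rewrite lerDl.
  apply: le_trans (ler_wpM2l k0 h); rewrite mulr_sumr le_eqVlt; apply/orP; left; apply/eqP.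
  by apply: eq_bigr => s _; rewrite /A; ring.
- by move=> m; have [_ h] := h2 m; rewrite (le_trans h)// lerDr mulr_ge0.
move=> s s' l l' Ql Ql' sl sl'; have [ratio Tl] := coalesce_cvg Ql Ql' sl sl'.
have phi_cvg (u : nat -> R * R) t : u @ U --> t -> (fun m => phi (u m)) @ U --> phi t.
  by move=> ut; apply: (@continuous_cvg _ _ _ U _ u phi t); [exact: cphi|exact: ut].
apply: cvgM.
  rewrite (_ : (fun m => _) = fun m => K (z m (s m), z m (s' m))).
    apply: (@continuous_cvg _ _ _ U _ (fun m => (z m (s m), z m (s' m))) K (l, l')).
      exact: cK.
    exact: (@cvg_pair _ _ _ U (nbhs l) (nbhs l')).
  by apply/funext => m; exact: (refined_ker (refX m)).
apply: cvgB; last exact: phi_cvg sl'.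
apply: cvgB; last exact: phi_cvg sl.
rewrite -[X in _ --> X]mul1r; apply: cvgM; first exact: ratio.
exact: phi_cvg Tl.
Qed.

Lemma profile_balance :
  \int[g]_(x in Q) phi x
  - 2 / 3 * \int[g]_(x in Q) (x.1 * partial_a phi x)
  - \int[g]_(x in Q) (x.2 * partial_v phi x)
  + kappa * coag_form K g phi
  + kappa * \int[g]_(x in Q) (r x * (c * x.2 `^ (2 / 3) - x.1) * partial_a phi x) = 0.
Proof.
have ci (f : R * R -> R) : (forall x, f x != 0 -> box rho x) ->
    (forall x, Q x -> {for x, continuous f}) -> g.-integrable Q (EFin \o f).
  move=> bf cf; apply: compact_supp_integrable; [exact: gfin|exact: box_ext_continuous bf|].
  by exists rho; [exact: rho_gt0|exact: bf].
have ia : g.-integrable Q (EFin \o (fun x => x.1 * partial_a phi x)).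
  apply: ci => x; first by rewrite mulf_eq0 negb_or => /andP[_ /ba].
  by move=> _; apply: cvgM; [exact: cvg1|exact: ca].
have iv : g.-integrable Q (EFin \o (fun x => x.2 * partial_v phi x)).
  apply: ci => x; first by rewrite mulf_eq0 negb_or => /andP[_ /bv].
  by move=> _; apply: cvgM; [exact: cvg2|exact: cv].
have i2 : g.-integrable Q (EFin \o (fun x => 2 / 3 * (x.1 * partial_a phi x))).
  apply: ci => x; first by rewrite !mulf_eq0 !negb_or => /andP[_ /andP[_ /ba]].
  by move=> _; apply: cvgM; [exact: cvg_cst|apply: cvgM; [exact: cvg1|exact: ca]].
have ip : g.-integrable Q (EFin \o phi) by apply: ci => // x _; exact: cphi.
have ip2 : g.-integrable Q (EFin \o (fun x => phi x - 2 / 3 * (x.1 * partial_a phi x))).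
  have h := integrableB quadrant_measurable ip i2; exact: h.
have split_int : \int[g]_(x in Q) (phi x - 2 / 3 * (x.1 * partial_a phi x) - x.2 * partial_v phi x) =
    \int[g]_(x in Q) phi x - 2 / 3 * \int[g]_(x in Q) (x.1 * partial_a phi x)
    - \int[g]_(x in Q) (x.2 * partial_v phi x).
  rewrite RintegralB; [|exact: quadrant_measurable|exact: ip2|exact: iv].
  rewrite RintegralB; [|exact: quadrant_measurable|exact: ip|exact: i2].
  by rewrite RintegralZl; [|exact: quadrant_measurable|exact: ia].
rewrite -split_int /coag_form addrAC.
have kc : (fun=> kappa) @ U --> kappa by exact: cvg_cst.
pose F m := \sum_s w m s * (vol s * (speed (X m) * (psi (shrink s) - psi s)))
  + kappa * (\sum_s w m s * (vol s * (frate s * (psi (fuse s) - psi s))))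
  + kappa * (\sum_s \sum_s' w m s * w m s' *
      (vol s * (ker s s' * (psi (coalesce s s') - psi s)))).
have F0 : F @ U --> (0 : R).
  rewrite (_ : F = cst 0); first exact: cvg_cst.
  by apply/funext => m; exact: (balance (@psi m)).
apply: (@cvgr_uniq R nat U PU F _ _ _ F0).
by apply: cvgD; [apply: cvgD; [exact: shrink_limit|exact: cvgM kc fuse_limit]|exact: cvgM kc coalesce_limit].
Qed.

End profile.

Theorem theorem2p3 (R : realType) (mu alpha v0 sigma beta gamma : R)
  (mu_gt0 : 0 < mu) (alpha_gt0 : 0 < alpha) (v0_gt0 : 0 < v0)
  (beta01 : 0 < beta < 1)
  (gammaE : gamma = beta - alpha) (gamma01 : 0 <= gamma < 1)
  (K : (R * R) * (R * R) -> R)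
  (K_ge0 : forall x y, quadrant x -> quadrant y -> 0 <= K (x, y))
  (K_cont : {within @quadrant R `*` @quadrant R, continuous K})
  (K_homo : forall a v a' v' lambda : R,
     0 < a -> 0 < v -> 0 < a' -> 0 < v' -> 0 < lambda ->
     K ((lambda `^ (2 / 3) * a, lambda * v),
        (lambda `^ (2 / 3) * a', lambda * v'))
     = lambda `^ gamma * K ((a, v), (a', v')))
  (K_sym : forall a v a' v' : R, 0 < a -> 0 < v -> 0 < a' -> 0 < v' ->
     K ((a, v), (a', v')) = K ((a', v'), (a, v)))
  (K0 K1 : R) (K0_gt0 : 0 < K0) (K1_gt0 : 0 < K1)
  (K_bounds : forall a v a' v' : R, 0 < a -> 0 < v -> 0 < a' -> 0 < v' ->
     K1 * (v `^ (- alpha) * v' `^ beta + v' `^ (- alpha) * v `^ beta)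
       <= K ((a, v), (a', v'))
       <= K0 * (v `^ (- alpha) * v' `^ beta + v' `^ (- alpha) * v `^ beta))
  (r : R * R -> R)
  (r_C1 : C1_quadrant r)
  (R0 R1 : R) (R0_gt0 : 0 < R0) (R1_gt0 : 0 < R1)
  (r_bounds : forall a v : R, 0 < a -> 0 < v ->
     R0 * a `^ mu * v `^ sigma <= r (a, v) <= R1 * a `^ mu * v `^ sigma)
  (r_homo : forall a v lambda : R, 0 < a -> 0 < v -> 0 < lambda ->
     r (lambda `^ (2 / 3) * a, lambda * v) = lambda `^ (gamma - 1) * r (a, v))
  (mu_sigma : 2 / 3 * mu + sigma = gamma - 1)
  (B : R) (B_gt0 : 0 < B)
  (r_lower : forall a v : R, 0 < a -> 0 < v -> c0 R * v `^ (2 / 3) <= a ->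
     0 <= (partial_a r (a, v) - mu * a^-1 * r (a, v))
            * (a - c0 R * v `^ (2 / 3)) + r (a, v))
  (r_upper : forall a v : R, 0 < a -> 0 < v -> c0 R * v `^ (2 / 3) <= a ->
     partial_a r (a, v) <= B * a^-1 * r (a, v)) :
  exists g : {measure set (R * R)%type -> \bar R},
    [/\ self_similar_profile alpha beta gamma K r g,
        (\int[g]_(x in @quadrant R) (x.2)%:E)%E = v0%:E &
        forall n k : R, (moment g n k < +oo)%E].
Proof.
have kappa_gt0 : 0 < 1 - gamma by rewrite subr_gt0; case/andP: gamma01.
have c_gt0 : 0 < c0 R.
  by rewrite powR_gt0// mulr_gt0// pi_gt0.
have openQQ : open (@quadrant R `*` @quadrant R).
  rewrite openE => -[x y] [/= Qx Qy]; exists (@quadrant R, @quadrant R) => //=.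
  by split; exact: nbhs_quadrant.
have cK x y : quadrant x -> quadrant y -> {for (x, y), continuous K}.
  move=> Qx Qy; move: K_cont; rewrite continuous_open_subspace// => cK.
  by apply: cK; rewrite inE.
have Ksym x y : quadrant x -> quadrant y -> K (x, y) = K (y, x).
  by case: x y => [a v] [a' v'] [/= ? ?] [/= ? ?]; exact: K_sym.
have K_le x y : quadrant x -> quadrant y -> 0 <= K (x, y) <=
    K0 * (x.2 `^ (- alpha) * y.2 `^ beta + y.2 `^ (- alpha) * x.2 `^ beta).
  move=> Qx Qy; rewrite K_ge0//=; case: x y Qx Qy => [a v] [a' v'] [/= a1 v1] [/= a2 v2].
  by have /andP[] := K_bounds _ _ _ _ a1 v1 a2 v2.
have cr x : quadrant x -> {for x, continuous r} by exact: C1_continuous.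
(* The inverse mesh starts at 4, as the growth of merged volumes by 3/2 requires. *)
have /choice[X refX] : forall m : nat,
    exists X : scheme alpha beta mu sigma (1 - gamma) v0 K0 K1 R0 R1 (c0 R), refined K r m.+4%:R X.
  by move=> m; apply: refined_scheme_exists.
have [U [UU UN]] := free_ultrafilter.
(* The moment of order zero bounds the total weight, which the vague limit needs. *)
have [W _ hW] := moment_bound sigma alpha_gt0 beta01 mu_gt0 kappa_gt0 v0_gt0 K0_gt0
  K1_gt0 R0_gt0 R1_gt0 c_gt0 0 0.
have zQ m (s : st (X m)) : quadrant (pt s) by split; [exact: area_gt0|exact: vol_gt0].
have wW m : \sum_(s : st (X m)) wt s <= W.
  apply: le_trans (hW (X m)); rewrite le_eqVlt; apply/orP; left; apply/eqP.
  by apply: eq_bigr => s _; rewrite !powRr0 !mulr1.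
have [g [g0 gfin vague]] := vague_ultralimit UU (fun m s => @wt_ge0 _ _ _ _ _ _ _ _ _ _ _ _ (X m) s) zQ wW.
exists g; split.
- split.
  + split; last first.
      exact: (limit_isoperimetric alpha_gt0 beta01 mu_gt0 kappa_gt0 v0_gt0
        K0_gt0 K1_gt0 R0_gt0 R1_gt0 c_gt0 UU gfin vague).
    split=> // C cC _; apply: le_lt_trans gfin; apply: le_measure; rewrite ?inE//.
    have -> : C = ~` ~` C by rewrite setCK.
    apply: measurableC; apply: open_measurable_plane; apply: closed_openC.
    by apply: compact_closed => //; exact: norm_hausdorff.
  + exact: (limit_alpha_beta alpha_gt0 beta01 mu_gt0 kappa_gt0 v0_gt0
      K0_gt0 K1_gt0 R0_gt0 R1_gt0 c_gt0 UU gfin vague).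
  + move=> phi phiC; have [rho rho0 [bphi ba bv cphi [ca cv]]] := C1c_props phiC.
    have [phiC1 _ _] := phiC.
    exact: (profile_balance alpha_gt0 beta01 mu_gt0 kappa_gt0 v0_gt0 K0_gt0 K1_gt0
      R0_gt0 R1_gt0 c_gt0 cK Ksym K_le cr UU UN refX gfin vague rho0 phiC1 bphi ba bv cphi ca cv).
- exact: (limit_mass alpha_gt0 beta01 mu_gt0 kappa_gt0 v0_gt0
    K0_gt0 K1_gt0 R0_gt0 R1_gt0 c_gt0 UU gfin vague).
- exact: (limit_moment alpha_gt0 beta01 mu_gt0 kappa_gt0 v0_gt0
    K0_gt0 K1_gt0 R0_gt0 R1_gt0 c_gt0 UU gfin vague).
Qed.
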